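(* Let $B_1\subset\mathbb{R}^n$ be the open unit ball and let $u\in\operatorname{Lip}(B_1)$ be a solution, in the sense of distributions, to $\operatorname{div}(G(Du))=0$ in $B_1$, where $G\in C^0([Du],\mathbb{R}^n)$ fulfills $$(G(b)-G(a),b-a)\ge\sigma(|b-a|)\qquad\forall a,b\in[Du],$$ for some continuous, strictly increasing, convex function $\sigma\colon[0,\infty)\to[0,\infty)$. Then $\mathcal H^{n-1}(S)=0$, where $$S=\Big\{x\in B_1\colon\liminf_{r\to0}\frac1{|B_r(x)|}\int_{B_r(x)}\sigma\Big(\Big|Du(y)-\frac1{|B_r(x)|}\int_{B_r(x)}Du(z)\,dz\Big|\Big)dy>0\Big\}.$$
   Context: $[Du]$ denotes the essential range of $Du$ in $B_1$: the smallest closed set $F\subset\mathbb{R}^n$ such that $Du(x)\in F$ for a.e. $x\in B_1$. $\mathcal H^{n-1}$ is the $(n-1)$-dimensional Hausdorff measure. *)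

(* Defs.v *)
From HB Require Import structures.
From mathcomp Require Import all_boot all_order all_algebra.
From mathcomp Require Import all_classical all_reals all_analysis.
From mathcomp Require Import measurable_realfun.

Set Implicit Arguments.
Unset Strict Implicit.
Unset Printing Implicit Defensive.

Import Order.TTheory GRing.Theory Num.Theory.
Import numFieldNormedType.Exports.

Local Open Scope classical_set_scope.
Local Open Scope ring_scope.

(* R^n is 'rV[R]_n. The norm `|x| that the library puts on 'rV[R]_n is the
   sup norm; it gives the right topology, but metric notions (balls, diameters,
   Lipschitz constants) use the Euclidean norm enorm. *)
Definition dotv (R : realType) (n : nat) (x y : 'rV[R]_n) : R :=
  \sum_(i < n) x 0 i * y 0 i.

Definition enorm (R : realType) (n : nat) (x : 'rV[R]_n) : R :=
  Num.sqrt (dotv x x).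

Definition eball (R : realType) (n : nat) (x : 'rV[R]_n) (r : R) :
  set 'rV[R]_n := [set y | enorm (y - x) < r].

Definition Lip (R : realType) (n : nat) (D : set 'rV[R]_n)
    (u : 'rV[R]_n -> R) : Prop :=
  exists L : R, forall x y, D x -> D y -> `|u x - u y| <= L * enorm (x - y).

(* The sigma-algebra on matrices generated by the entries, in the same way as
   the library does for n.-tuple; measurable_rVE below shows that on 'rV[R]_n
   it is the Borel sigma-algebra. *)
Section measurable_matrix.
Context {d : measure_display} {T : measurableType d} {m n : nat}.

Definition matrix_measurable : set (set 'M[T]_(m, n)) :=
  <<s [set A | exists i j (B : set T),
         measurable B /\ A = (fun M : 'M[T]_(m, n) => M i j) @^-1` B] >>.

Let matrix_measurable0 : matrix_measurable set0.
Proof. exact: sigma_algebra0. Qed.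

Let matrix_measurableC A : matrix_measurable A -> matrix_measurable (~` A).
Proof. exact: sigma_algebraC. Qed.

Let matrix_measurable_bigcup (F : (set 'M[T]_(m, n))^nat) :
  (forall i, matrix_measurable (F i)) -> matrix_measurable (\bigcup_i F i).
Proof. exact: sigma_algebra_bigcup. Qed.

HB.instance Definition _ := @isMeasurable.Build default_measure_display
  'M[T]_(m, n) matrix_measurable matrix_measurable0 matrix_measurableC
  matrix_measurable_bigcup.

End measurable_matrix.

Lemma measurable_entry (d : measure_display) (T : measurableType d) (m n : nat)
    (i : 'I_m) (j : 'I_n) :
  measurable_fun [set: 'M[T]_(m, n)] (fun M => M i j).
Proof.
move=> _ B mB; rewrite setTI; apply: sub_sigma_algebra.
by exists i, j, B.
Qed.

Lemma measurable_fun_matrix (d d' : measure_display) (S : measurableType d')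
    (T : measurableType d) (m n : nat) (f : S -> 'M[T]_(m, n)) :
  (forall i j, measurable_fun setT (fun x => f x i j)) ->
  measurable_fun setT f.
Proof.
move=> mf; apply: (@measurability _ _ _ _ _ _ [set A | exists i j (B : set T),
  measurable B /\ A = (fun M : 'M[T]_(m, n) => M i j) @^-1` B]) => //.
by move=> _ [_ [i [j [B [mB ->]]]] <-]; exact: (mf i j).
Qed.

Section lebesgue_measure_rV.
Context {R : realType}.

Definition consv (n : nat) (p : measurableTypeR R * 'rV[R]_n) : 'rV[R]_n.+1 :=
  row_mx (p.1 : R)%:M p.2.

Lemma consvE0 (n : nat) (p : measurableTypeR R * 'rV[R]_n) :
  consv p 0 ord0 = p.1.
Proof.
rewrite /consv (_ : ord0 = lshift n (ord0 : 'I_1)); last exact/val_inj.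
by rewrite (row_mxEl (_ : 'M[R]_1)) mxE eqxx mulr1n.
Qed.

Lemma consvES (n : nat) (p : measurableTypeR R * 'rV[R]_n) (i : 'I_n) :
  consv p 0 (lift ord0 i) = p.2 0 i.
Proof.
rewrite /consv (_ : lift ord0 i = rshift 1 i); last exact/val_inj.
by rewrite (row_mxEr (_ : 'M[R]_1)).
Qed.

Lemma consvK (n : nat) (x : 'rV[R]_n.+1) :
  consv (x 0 ord0, \row_i x 0 (lift ord0 i)) = x.
Proof.
apply/rowP => i; have [->|[j ->]] : i = ord0 \/ exists j, i = lift ord0 j.
  by case: (unliftP ord0 i) => [j ->|->]; [right; exists j|left].
  by rewrite consvE0.
by rewrite consvES mxE.
Qed.

Lemma measurable_consv (n : nat) : measurable_fun setT (@consv n).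
Proof.
apply: measurable_fun_matrix => i j; rewrite ord1.
case: (unliftP ord0 j) => [k ->|->].
- under eq_fun do rewrite consvES.
  apply: (@measurableT_comp _ _ _ _ _ _ (fun v : 'rV[R]_n => v 0 k)).
    exact: measurable_entry.
  exact: measurable_snd.
- under eq_fun do rewrite consvE0.
  exact: measurable_fst.
Qed.

Section step.
Variables (n : nat) (mu : {sigma_finite_measure set 'rV[R]_n -> \bar R}).

Definition lebesgue_rV_step : set 'rV[R]_n.+1 -> \bar R :=
  pushforward (@lebesgue_measure R \x mu)%E (@consv n).

HB.instance Definition _ := Measure.copy lebesgue_rV_step
  (measure_function_pushforward__canonical__measure_function_Measure
     (@lebesgue_measure R \x mu)%E (@measurable_consv n)).

Let lebesgue_rV_step_sigma_finite : sigma_finite setT lebesgue_rV_step.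
Proof.
have mt : measurable_fun [set: 'rV[R]_n.+1]
    (fun x => \row_(i < n) x 0 (lift ord0 i)).
  apply: measurable_fun_matrix => i j.
  by under eq_fun do rewrite mxE; exact: measurable_entry.
pose g (x : 'rV[R]_n.+1) : measurableTypeR R * 'rV[R]_n :=
  (x 0 ord0, \row_i x 0 (lift ord0 i)).
have mg : measurable_fun setT g.
  by apply/measurable_fun_pair => //; exact: measurable_entry.
have /sigma_finiteP[F [TF ndF Foo]] := sigma_finiteT (@lebesgue_measure R).
have /sigma_finiteP[G [TG ndG Goo]] := sigma_finiteT mu.
exists (fun k => g @^-1` (F k `*` G k)).
  apply/seteqP; split => // x _.
  have [k _ Fk] : (\bigcup_k F k) (g x).1 by rewrite -TF.
  have [l _ Gl] : (\bigcup_k G k) (g x).2 by rewrite -TG.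
  exists (maxn k l) => //; split => /=.
  - by move: Fk; exact/subsetPset/ndF/leq_maxl.
  - by move: Gl; exact/subsetPset/ndG/leq_maxr.
move=> k; have [mF Fk] := Foo k; have [mG Gk] := Goo k; split.
  by rewrite -[X in measurable X]setTI; apply: mg => //; exact: measurableX.
rewrite /lebesgue_rV_step /pushforward.
rewrite (_ : (@consv n) @^-1` _ = F k `*` G k); last first.
  by apply/seteqP; split => p /=; rewrite /g consvE0 (_ : (\row_i _) = p.2)//;
    apply/rowP => i; rewrite mxE consvES.
by rewrite product_measure1E// lte_mul_pinfty// ge0_fin_numE.
Qed.

HB.instance Definition _ := @Measure_isSigmaFinite.Build _ _ _
  lebesgue_rV_step lebesgue_rV_step_sigma_finite.

Definition lebesgue_rV_succ : {sigma_finite_measure set 'rV[R]_n.+1 -> \bar R} :=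
  lebesgue_rV_step.
End step.

(* The n-fold product of the Lebesgue measure of the line, transported to
   'rV[R]_n; it is characterized by its value on boxes, see lebesgue_rV_box. *)
Fixpoint lebesgue_rV (n : nat) : {sigma_finite_measure set 'rV[R]_n -> \bar R} :=
  if n is m.+1 then lebesgue_rV_succ (lebesgue_rV m) else \d_(0 : 'rV[R]_0).

Lemma lebesgue_rV_box (n : nat) (B : 'I_n -> set R) :
  (forall i, measurable (B i)) ->
  lebesgue_rV n [set x | forall i, B i (x 0 i)] =
  (\prod_(i < n) @lebesgue_measure R (B i))%E.
Proof.
elim: n B => [|n IH] B mB.
  by rewrite big_ord0 /= diracE mem_set//= => -[].
rewrite big_ord_recl -IH//.
have mX : measurable [set x : 'rV[R]_n | forall i, B (lift ord0 i) (x 0 i)].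
  rewrite (_ : [set _ | _] = \bigcap_(i in [set: 'I_n])
     ((fun x : 'rV[R]_n => x 0 i) @^-1` B (lift ord0 i))); last first.
    by apply/seteqP; split => x /= H i => [_|]; exact: H.
  apply: fin_bigcap_measurable => // i _.
  by rewrite -[X in measurable X]setTI; exact: measurable_entry.
rewrite -product_measure1E//; last exact: (mB ord0).
rewrite [LHS]/= /pushforward.
apply: (congr1 (@lebesgue_measure R \x lebesgue_rV n)%E); apply/seteqP; split => p /= => [H|[H0 HS] i].
  by split => [|i]; [have := H ord0|have := H (lift ord0 i)];
    rewrite ?consvE0 ?consvES.
by case: (unliftP ord0 i) => [k ->|->]; rewrite ?consvE0 ?consvES//.
Qed.

End lebesgue_measure_rV.

Lemma measurable_rVE (R : realType) (n : nat) :
  @measurable _ 'rV[R]_n = <<s open >>.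
Proof.
apply/seteqP; split => A.
  apply: smallest_sub; first exact: smallest_sigma_algebra.
  move=> _ [i [j [B [mB ->]]]].
  pose C := [set B : set R |
    <<s open >> ((fun x : 'rV[R]_n => x i j) @^-1` B)].
  suff : <<s @RGenOpens.G R >> `<=` C.
    by apply; rewrite -[X in X B]RGenOpens.measurableE.
  apply: smallest_sub.
    split; rewrite /C /=.
    - by rewrite preimage_set0; exact: sigma_algebra0.
    - move=> D mD; rewrite setTD preimage_setC; exact: sigma_algebraC.
    - by move=> F mF; rewrite preimage_bigcup; exact: sigma_algebra_bigcup.
  move=> _ [a [b ->]]; apply: sub_sigma_algebra.
  apply: open_comp; last exact: interval_open.
  by move=> x _; exact: coord_continuous.
apply: smallest_sub; first exact: sigma_algebra_measurable.
move=> U oU.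
pose c (p : 'rV[rat]_n * nat) : 'rV[R]_n := map_mx ratr p.1.
pose D : set ('rV[rat]_n * nat) := [set p | ball (c p) p.2.+1%:R^-1 `<=` U].
have -> : U = \bigcup_(p in D) ball (c p) p.2.+1%:R^-1.
  apply/seteqP; split => [x Ux|x [p Dp]]; last exact: Dp.
  have /nbhs_ballP[e /= e0 xeU] := open_nbhs_nbhs (conj oU Ux).
  have [k ke] : exists k : nat, k.+1%:R^-1 < e / 2 :> R.
    have [k] := ltr_add_invr (divr_gt0 e0 (ltr0Sn R 1) : 0 < e / 2).
    by rewrite add0r; exists k.
  have /choice[q xq] i : exists q : rat, `|x 0 i - ratr q| < k.+1%:R^-1.
    have /rat_in_itvoo[q] : x 0 i - k.+1%:R^-1 < x 0 i + k.+1%:R^-1.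
      by rewrite ltrD2l gtrN.
    by rewrite in_itv/= -ltr_distlC => ?; exists q.
  have xk : ball (c (\row_i q i, k)) k.+1%:R^-1 x.
    by split => // i j; rewrite ord1 /ball/= !mxE distrC.
  exists (\row_i q i, k) => //= y /= cy; apply: xeU.
  apply: le_ball (ball_triangle (ball_sym xk) cy).
  by rewrite [leRHS](splitr e) lerD// ltW.
rewrite bigcup_mkcond; apply: countable_bigcupT_measurable => // p.
case: ifPn => // _.
rewrite (_ : ball _ _ = \bigcap_(i in [set: 'I_n])
     ((fun x : 'rV[R]_n => x 0 i) @^-1` ball (c p 0 i) p.2.+1%:R^-1)).
  apply: fin_bigcap_measurable => // i _.
  rewrite -[X in measurable X]setTI; apply: measurable_entry => //.
  exact: measurable_ball.
apply/seteqP; split => [x [_ px] i _|x px]; first exact: px.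
by split => // i j; rewrite ord1; exact: px.
Qed.

(* C^infty: the partial derivatives of all orders exist and are continuous. *)
Definition iter_partial (R : realType) (n : nat) (s : seq 'I_n)
    (f : 'rV[R]_n -> R) : 'rV[R]_n -> R :=
  foldr (fun i (g : 'rV[R]_n -> R) => 'D_('e_i) g) f s.

Definition smooth (R : realType) (n : nat) (f : 'rV[R]_n -> R) : Prop :=
  forall s : seq 'I_n, continuous (iter_partial s f) /\
    forall i x, derivable (iter_partial s f) x 'e_i.

Definition test_function (R : realType) (n : nat) (D : set 'rV[R]_n)
    (phi : 'rV[R]_n -> R) : Prop :=
  [/\ smooth phi, compact (closure [set x | phi x != 0]) &
      closure [set x | phi x != 0] `<=` D].

Definition grad (R : realType) (n : nat) (f : 'rV[R]_n -> R) (x : 'rV[R]_n) :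
  'rV[R]_n := \row_(i < n) 'D_('e_i) f x.

(* Du is a representative of the distributional gradient of u on the open set
   D: it belongs to L^1_loc(D) and satisfies the integration by parts formula
   against test functions. *)
Definition weak_gradient (R : realType) (n : nat) (D : set 'rV[R]_n)
    (u : 'rV[R]_n -> R) (Du : 'rV[R]_n -> 'rV[R]_n) : Prop :=
  forall i : 'I_n,
    (forall K, compact K -> K `<=` D ->
       (lebesgue_rV n).-integrable K (EFin \o (fun x => Du x 0 i))) /\
    (forall phi, test_function D phi ->
       (\int[lebesgue_rV n]_(x in D) (u x * 'D_('e_i) phi x)%:E =
        - \int[lebesgue_rV n]_(x in D) (Du x 0 i * phi x)%:E)%E).

Definition weakly_div_free (R : realType) (n : nat) (D : set 'rV[R]_n)
    (V : 'rV[R]_n -> 'rV[R]_n) : Prop :=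
  forall phi, test_function D phi ->
    (\int[lebesgue_rV n]_(x in D) (dotv (V x) (grad phi x))%:E = 0)%E.

(* The intersection of all closed sets F with f(x) \in F for a.e. x \in D; as
   'rV[R]_n is second countable it is itself such a set, hence the smallest. *)
Definition ess_range (R : realType) (n : nat) (D : set 'rV[R]_n)
    (f : 'rV[R]_n -> 'rV[R]_n) : set 'rV[R]_n :=
  \bigcap_(F in [set F | closed F /\
    {ae lebesgue_rV n, forall x, D x -> F (f x)}]) F.

Definition avgv (R : realType) (n : nat) (B : set 'rV[R]_n)
    (f : 'rV[R]_n -> 'rV[R]_n) : 'rV[R]_n :=
  \row_(i < n) ((fine (lebesgue_rV n B))^-1 *
                \int[lebesgue_rV n]_(x in B) (f x 0 i)).

Definition mean_oscillation (R : realType) (n : nat) (sigma : R -> R)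
    (f : 'rV[R]_n -> 'rV[R]_n) (B : set 'rV[R]_n) : \bar R :=
  (((fine (lebesgue_rV n B))^-1)%:E *
   \int[lebesgue_rV n]_(y in B) (sigma (enorm (f y - avgv B f)))%:E)%E.

Definition ediam (R : realType) (n : nat) (A : set 'rV[R]_n) : \bar R :=
  ereal_sup ([set 0%E] `|`
    [set z | exists x y, [/\ A x, A y & z = (enorm (x - y))%:E]]).

(* The s-dimensional Hausdorff measure, without the factor that normalizes it
   against the Lebesgue measure when s = n. The empty set contributes 0 to a
   covering also when s = 0, while nonempty sets contribute diam^0 = 1. *)
Definition hausdorff_pre (R : realType) (n : nat) (s : nat) (delta : R)
    (A : set 'rV[R]_n) : \bar R :=
  ereal_inf [set (\sum_(0 <= k <oo)
                    (if C k == set0 then 0 else ediam (C k) ^+ s))%E |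
    C in [set C : (set 'rV[R]_n)^nat | A `<=` \bigcup_k C k /\
            forall k, (ediam (C k) <= delta%:E)%E]].

Definition hausdorff (R : realType) (n : nat) (s : nat)
    (A : set 'rV[R]_n) : \bar R :=
  ereal_sup [set hausdorff_pre s delta A | delta in [set delta | 0 < delta]].

(* Main.v *)
Require Import Defs.
From HB Require Import structures.
From mathcomp Require Import all_boot all_order all_algebra.
From mathcomp Require Import all_classical all_reals all_analysis.
From mathcomp Require Import measurable_realfun.
From mathcomp Require Import ring lra.

Set Implicit Arguments.
Unset Strict Implicit.
Unset Printing Implicit Defensive.

Import Order.TTheory GRing.Theory Num.Theory.
Import numFieldNormedType.Exports.

Local Open Scope classical_set_scope.
Local Open Scope ring_scope.

(** Let [Du] be the gradient of a Lipschitz solution and [V = G(Du)]. Increments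
    satisfy the same equation: for small [h] the field [V(x+h) - V(x)] is
    divergence free in a smaller ball. Testing this with [u(x+h) - u(x)] times a
    cutoff [eta], and using the monotonicity of [G], one gets

      int eta sigma(|Du(x+h) - Du(x)|)
        <= C sup |u(x+h) - u(x)| * int |V(x+h) - V(x)| <= C L |h| omega(h).

    Since [Du] is bounded by the Lipschitz constant, its essential range is compact
    and [V] is bounded; hence [omega(h)] tends to 0 with [h], by the continuity of
    translations in L1. So the left-hand side is [o(|h|)]
    ([translation_estimate], [oscillation_estimate]).

    By the convexity of [sigma] ([jensen_avgv]), the mean oscillation of [Du] in a
    ball of radius [r] is at most the mean over that ball of the mean of
    [sigma(|Du(x+h) - Du(x)|)] over the increments [|h| < 2r]
    ([mean_oscillation_le]). If it is at least [t > 0] in each of [N] disjoint balls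
    of radius [r], then summing over the balls and exchanging the integrals gives
    [N r^n t <= o(r)] ([packing_bound]). Applied to a maximal [2r]-separated subset
    of the set [A] of the points of a smaller ball where the oscillation is at least
    [t] at all scales below some [rho], this covers [A] by [N] balls of radius [2r]
    with [N r^(n-1)] tending to 0, so that the (n-1)-dimensional measure of [A] is 0
    ([bad_set_small_cover]). The set in the theorem is a countable union of such
    sets.

    The test function [eta (u(x+h) - u(x))] is only Lipschitz, while the weak
    formulations speak of smooth ones. This is repaired by mollification
    ([weak_product_rule]), which also yields the bound for [Du]
    ([weak_partial_bounded]). *)

(** * Euclidean norm and balls *)

Section euclid.
Context {R : realType} {n : nat}.
Implicit Types (x y z v : 'rV[R]_n) (r s t c : R).

Lemma dotvC x y : dotv x y = dotv y x.
Proof. by apply: eq_bigr => i _; rewrite mulrC. Qed.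

Lemma dotvDl x y z : dotv (x + y) z = dotv x z + dotv y z.
Proof. by rewrite -big_split; apply: eq_bigr => i _; rewrite mxE mulrDl. Qed.

Lemma dotvZl c x y : dotv (c *: x) y = c * dotv x y.
Proof. by rewrite /dotv mulr_sumr; apply: eq_bigr => i _; rewrite mxE mulrA. Qed.

Lemma dotvBl x y z : dotv (x - y) z = dotv x z - dotv y z.
Proof. by rewrite dotvDl -scaleN1r dotvZl mulN1r. Qed.

Lemma dotvDr x y z : dotv z (x + y) = dotv z x + dotv z y.
Proof. by rewrite ![dotv z _]dotvC dotvDl. Qed.

Lemma dotvBr x y z : dotv z (x - y) = dotv z x - dotv z y.
Proof. by rewrite ![dotv z _]dotvC dotvBl. Qed.

Lemma dotvZr c x y : dotv y (c *: x) = c * dotv y x.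
Proof. by rewrite ![dotv y _]dotvC dotvZl. Qed.

Lemma dotv_ge0 x : 0 <= dotv x x.
Proof. by apply: sumr_ge0 => i _; rewrite -expr2 sqr_ge0. Qed.

Lemma enorm_ge0 x : 0 <= enorm x.
Proof. exact: sqrtr_ge0. Qed.

Lemma enorm_sqr x : enorm x ^+ 2 = dotv x x.
Proof. by rewrite sqr_sqrtr// dotv_ge0. Qed.

Lemma enormN x : enorm (- x) = enorm x.
Proof.
by rewrite /enorm -scaleN1r dotvZl dotvZr mulrA mulrNN !mulr1 mul1r.
Qed.

Lemma enormC x y : enorm (x - y) = enorm (y - x).
Proof. by rewrite -enormN opprB. Qed.

Lemma enormZ c x : enorm (c *: x) = `|c| * enorm x.
Proof.
by rewrite /enorm dotvZl dotvZr mulrA -expr2 sqrtrM ?sqr_ge0// sqrtr_sqr.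
Qed.

Lemma enorm0 : enorm (0 : 'rV[R]_n) = 0.
Proof. by rewrite -(scale0r 0) enormZ normr0 mul0r. Qed.

Lemma ler_dotv_enorm x y : dotv x y <= enorm x * enorm y.
Proof.
(* Expand 0 <= |s x - t y|^2 with s = |y|, t = |x|. *)
have [x0|x0] := eqVneq (enorm x) 0.
  have : dotv x x = 0 by rewrite -enorm_sqr x0 expr0n.
  move/eqP; rewrite psumr_eq0 => [/allP xi0|i _]; last by rewrite -expr2 sqr_ge0.
  rewrite x0 mul0r [leLHS]big1// => i _.
  have := xi0 i (mem_index_enum i); rewrite /= -expr2 sqrf_eq0 => /eqP ->.
  by rewrite mul0r.
have [y0|y0] := eqVneq (enorm y) 0.
  have : dotv y y = 0 by rewrite -enorm_sqr y0 expr0n.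
  move/eqP; rewrite psumr_eq0 => [/allP xi0|i _]; last by rewrite -expr2 sqr_ge0.
  rewrite y0 mulr0 [leLHS]big1// => i _.
  have := xi0 i (mem_index_enum i); rewrite /= -expr2 sqrf_eq0 => /eqP ->.
  by rewrite mulr0.
have xy : 0 < enorm x * enorm y by rewrite mulr_gt0// lt0r ?x0 ?y0 enorm_ge0.
have := dotv_ge0 (enorm y *: x - enorm x *: y).
rewrite dotvBl !dotvBr !dotvZl !dotvZr -!enorm_sqr [dotv y x]dotvC => h.
rewrite -subr_ge0 -(pmulr_rge0 _ xy).
move: h; set a := enorm x; set b := enorm y; set d := dotv x y => h.
nra.
Qed.

Lemma ler_enormD x y : enorm (x + y) <= enorm x + enorm y.
Proof.
rewrite -(@ler_pXn2r _ 2)// ?nnegrE ?addr_ge0 ?enorm_ge0//.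
rewrite enorm_sqr dotvDl !dotvDr -!enorm_sqr [dotv y x]dotvC.
have := ler_dotv_enorm x y.
set a := enorm x; set b := enorm y; set d := dotv x y => h; nra.
Qed.

Lemma ler_enormB x y : enorm (x - y) <= enorm x + enorm y.
Proof. by rewrite -(enormN y) ler_enormD. Qed.

Lemma ler_enorm_dist x y z : enorm (x - z) <= enorm (x - y) + enorm (y - z).
Proof. by rewrite (le_trans _ (ler_enormD _ _))// addrA subrK. Qed.

Lemma ler_coord_enorm x i : `|x 0 i| <= enorm x.
Proof.
rewrite -sqrtr_sqr ler_wsqrtr// expr2 /dotv (bigD1 i)//= lerDl.
by apply: sumr_ge0 => j _; rewrite -expr2 sqr_ge0.
Qed.

Lemma enorm_coord_le (M : R) x : (forall i, `|x 0 i| <= M) ->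
  enorm x <= n%:R * M.
Proof.
move=> xM; have [n0|n0] := posnP n.
  have -> : enorm x = 0.
    rewrite /enorm /dotv big1 ?sqrtr0// => i _.
    by exfalso; move: (ltn_ord i); rewrite [X in (_ < X)%N]n0.
  by rewrite n0 mul0r.
have M0 : 0 <= M by apply: le_trans (xM (Ordinal n0)).
rewrite -(@ler_pXn2r _ 2)// ?nnegrE ?enorm_ge0 ?mulr_ge0//.
rewrite enorm_sqr exprMn (@le_trans _ _ (n%:R * M ^+ 2))//.
  rewrite -[leRHS](_ : \sum_(i < n) M ^+ 2 = _); last first.
    by rewrite sumr_const card_ord mulr_natl.
  apply: ler_sum => i _.
  by rewrite -expr2 -real_normK ?num_real// ler_pXn2r// ?nnegrE.
rewrite ler_wpM2r ?sqr_ge0// -natrX ler_nat expnS expn1.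
by rewrite leq_pmull.
Qed.

Lemma sup_norm_le_enorm x : `|x| <= enorm x.
Proof.
rewrite [leLHS]mx_normrE; apply/bigmax_leP; split; first exact: enorm_ge0.
by move=> [i j] _ /=; rewrite ord1 ler_coord_enorm.
Qed.

Lemma ler_coord_sup x i : `|x 0 i| <= `|x|.
Proof. by rewrite [leRHS]mx_normrE; exact: (le_bigmax _ _ (0, i)). Qed.

Lemma ler_enorm_sup x : enorm x <= n%:R * `|x|.
Proof. by apply: enorm_coord_le => i; exact: ler_coord_sup. Qed.

Lemma continuous_coord i : continuous (fun x => x 0 i).
Proof. exact: coord_continuous. Qed.

Lemma continuous_sum (I : Type) (s : seq I) (T : topologicalType)
    (F : I -> T -> R) :
  (forall i, continuous (F i)) -> continuous (fun p => \sum_(i <- s) F i p).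
Proof.
move=> cF; elim: s => [|i s IH] p.
  by under eq_fun do rewrite big_nil; exact: cvg_cst.
under eq_fun do rewrite big_cons.
by apply: cvgD; [exact: cF|exact: IH].
Qed.

Lemma continuous_dotv (T : topologicalType) (f g : T -> 'rV[R]_n) :
  continuous f -> continuous g -> continuous (fun p => dotv (f p) (g p)).
Proof.
move=> cf cg; apply: continuous_sum => i p; apply: cvgM.
  apply: (@continuous_comp _ _ _ f (fun v : 'rV[R]_n => v 0 i)).
    exact: cf.
  exact: continuous_coord.
apply: (@continuous_comp _ _ _ g (fun v : 'rV[R]_n => v 0 i)).
    exact: cg.
  exact: continuous_coord.
Qed.

Lemma continuous_enorm : continuous (@enorm R n).
Proof.
move=> x; apply: (@continuous_comp _ _ _ (fun x => dotv x x) Num.sqrt).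
  by apply: continuous_dotv => y; exact: cvg_id.
exact: sqrt_continuous.
Qed.

Lemma continuous_addr x : continuous (fun y => y + x).
Proof.
move=> y; apply: (@cvgD R 'rV[R]_n _ (nbhs y) _ id (cst x)); first exact: cvg_id.
exact: cvg_cst.
Qed.

Lemma eball_open x r : open (eball x r).
Proof.
rewrite /eball (_ : [set y | _] = (fun y => enorm (y - x)) @^-1` [set t | t < r])//.
apply: open_comp; last exact: open_lt.
move=> y _; apply: (@continuous_comp _ _ _ (fun y => y - x) (@enorm R n)).
  exact: (@continuous_addr (- x)).
exact: continuous_enorm.
Qed.

Lemma closed_enorm_le r : closed [set x : 'rV[R]_n | enorm x <= r].
Proof.
apply: (@preimage_closed _ _ (@enorm R n) [set t | t <= r]); last exact: closed_le.
by move=> x _; exact: continuous_enorm.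
Qed.

Lemma compact_enorm_le r : compact [set x : 'rV[R]_n | enorm x <= r].
Proof.
apply: bounded_closed_compact; last exact: closed_enorm_le.
exists r; split; first exact: num_real.
move=> s rs x /= xr; apply: le_trans (sup_norm_le_enorm _) _.
exact: le_trans xr (ltW rs).
Qed.

Lemma nbhs_eball x (A : set 'rV[R]_n) : nbhs x A ->
  exists2 r : R, 0 < r & eball x r `<=` A.
Proof.
move=> /nbhs_ballP[e /= e0 xeA]; exists e => // y; rewrite /eball/= => yx.
apply: xeA; rewrite -ball_normE /= -normrN opprB.
exact: le_lt_trans (sup_norm_le_enorm _) yx.
Qed.

Lemma eball_center x r : 0 < r -> eball x r x.
Proof. by rewrite /eball/= subrr enorm0. Qed.

Lemma nbhs_eball_center x r : 0 < r -> nbhs x (eball x r).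
Proof.
by move=> r0; apply: open_nbhs_nbhs; split; [exact: eball_open|exact: eball_center].
Qed.

Lemma measurable_open (A : set 'rV[R]_n) : open A -> measurable A.
Proof. by move=> oA; rewrite measurable_rVE; apply: sub_sigma_algebra. Qed.

Lemma measurable_closed (A : set 'rV[R]_n) : closed A -> measurable A.
Proof.
move=> cA; rewrite -(setCK A); apply: measurableC; apply: measurable_open.
exact: closed_openC.
Qed.

Lemma measurable_eball x r : measurable (eball x r).
Proof. by apply: measurable_open; exact: eball_open. Qed.

End euclid.

(** * Lebesgue measure of translates, cubes and balls *)

Section lebesgue_rV_theory.
Context {R : realType}.
Notation leb := (@lebesgue_measure R).

Lemma measurable_shift1 (c : R) : measurable_fun [set: measurableTypeR R]
  ((fun t => t + c) : measurableTypeR R -> measurableTypeR R).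
Proof. by apply: measurable_funD. Qed.

Lemma lebesgue_measure_shift (c : R) (A : set (measurableTypeR R)) :
  measurable A -> leb ((fun t => t + c) @^-1` A) = leb A.
Proof.
move=> mA.
have mT := measurable_shift1 c.
rewrite [RHS](@lebesgue_measure_unique _
  (measure_function_pushforward__canonical__measure_function_Measure leb mT))//.
move=> _ [[a b]] _ <-; rewrite /= /pushforward.
rewrite (_ : _ @^-1` _ = `]a - c, b - c]%classic); last first.
  by apply/seteqP; split => t /=; rewrite !in_itv/= ltrBlDr lerBrDr.
by rewrite !lebesgue_measure_itv/= !lte_fin ltrD2r -!EFinB (_ : b - c - (a - c) = b - a)//; ring.
Qed.

Lemma measurable_shift n (h : 'rV[R]_n) :
  measurable_fun setT (fun x : 'rV[R]_n => x + h).
Proof.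
apply: measurable_fun_matrix => i j; under eq_fun do rewrite mxE.
by apply: measurable_funD => //; exact: measurable_entry.
Qed.

(** A translation of R^(n+1) acts separately on the first coordinate and on the
    other ones, and a measure on a product is determined by its values on the
    rectangles. *)
Lemma lebesgue_rV_shift n (h : 'rV[R]_n) (A : set 'rV[R]_n) :
  measurable A ->
  lebesgue_rV n ((fun x => x + h) @^-1` A) = lebesgue_rV n A.
Proof.
elim: n h A => [|n IH] h A mA.
  rewrite /= !diracE; congr (_%:R%:E); apply/congr1.
  by apply/idP/idP; rewrite !inE/= (_ : 0 + h = 0)//; apply/rowP => -[].
rewrite /= /lebesgue_rV_step /pushforward.
set h' : 'rV[R]_n := \row_i h 0 (lift ord0 i).
pose T (p : measurableTypeR R * 'rV[R]_n) : measurableTypeR R * 'rV[R]_n :=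
  (p.1 + h 0 ord0, p.2 + h').
have mT : measurable_fun setT T.
  apply/measurable_fun_pair => /=.
    by apply: measurable_funD => //; exact: measurable_fst.
  apply: (@measurableT_comp _ _ _ _ _ _ (fun v : 'rV[R]_n => v + h')).
    exact: measurable_shift.
  exact: measurable_snd.
have -> : (@consv R n) @^-1` ((fun x => x + h) @^-1` A) =
    T @^-1` ((@consv R n) @^-1` A).
  apply/seteqP; rewrite /preimage /=; split => p /=; rewrite (_ : consv p + h = consv (T p))//;
    apply/rowP => i; rewrite mxE;
    (case: (unliftP ord0 i) => [k ->|->]; rewrite ?consvES ?consvE0 ?mxE//).
rewrite [RHS](@product_measure_unique _ _ _ _ _ leb (lebesgue_rV n)
  (measure_function_pushforward__canonical__measure_function_Measure
     (leb \x lebesgue_rV n)%E mT))//.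
- move=> X Y mX mY /=; rewrite /pushforward.
  have -> : T @^-1` (X `*` Y) = ((fun t => t + h 0 ord0) @^-1` X) `*`
      ((fun v : 'rV[R]_n => v + h') @^-1` Y) by [].
  rewrite product_measure1E; first by congr (_ * _)%E;
      [exact: lebesgue_measure_shift|exact: IH].
    rewrite -[X in measurable X]setTI.
    exact: (measurable_shift1 (h 0 ord0) measurableT).
  by rewrite -[X in measurable X]setTI; exact: (measurable_shift h' measurableT).
- rewrite -[X in measurable X]setTI.
  by apply: measurable_consv.
Qed.

Lemma measurable_cube n (c : 'rV[R]_n) (d : R) : measurable
  [set x : 'rV[R]_n | forall i, `[c 0 i - d, c 0 i + d]%classic (x 0 i)].
Proof.
rewrite (_ : [set _ | _] = \bigcap_(i in [set: 'I_n])
   ((fun y : 'rV[R]_n => y 0 i) @^-1` `[c 0 i - d, c 0 i + d]%classic)).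
  apply: fin_bigcap_measurable => // i _.
  by rewrite -[X in measurable X]setTI; exact: measurable_entry.
by apply/seteqP; split => y /= H i => [_|]; exact: H.
Qed.

Lemma lebesgue_rV_cube n (c : 'rV[R]_n) (d : R) : 0 <= d ->
  lebesgue_rV n [set x | forall i, `[c 0 i - d, c 0 i + d]%classic (x 0 i)] =
  ((2 * d) ^+ n)%:E.
Proof.
move=> d0; rewrite (@lebesgue_rV_box _ _ (fun i => `[c 0 i - d, c 0 i + d]%classic))//.
under eq_bigr => i _.
  rewrite lebesgue_measure_itv/= lte_fin.
  rewrite (_ : (if _ then _ else _) = (2 * d)%:E).
    over.
  case: ifPn => [_|]; first by rewrite -EFinB; congr EFin; ring.
  by rewrite -leNgt => ?; congr EFin; lra.
by rewrite prodEFin prodr_const card_ord.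
Qed.

Lemma lebesgue_rV_eball_le n (x : 'rV[R]_n) (r : R) : 0 <= r ->
  (lebesgue_rV n (eball x r) <= ((2 * r) ^+ n)%:E)%E.
Proof.
move=> r0; rewrite -(lebesgue_rV_cube x r0); apply: le_measure; rewrite ?inE.
- exact: measurable_eball.
- exact: measurable_cube.
- move=> y yx i; rewrite /= in_itv/= -ler_distl.
  have := ler_coord_enorm (y - x) i; rewrite !mxE => /le_trans; apply.
  exact: ltW.
Qed.

(** The ball contains the cube of side [r / n] with the same centre: the Euclidean
    norm is at most [n] times the sup norm. *)
Lemma lebesgue_rV_eball_ge n (x : 'rV[R]_n) (r : R) : (0 < n)%N -> 0 < r ->
  (((r / n%:R) ^+ n)%:E <= lebesgue_rV n (eball x r))%E.
Proof.
move=> n0 r0; pose d := r / (2 * n%:R).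
have nR : 0 < n%:R :> R by rewrite ltr0n.
have d0 : 0 < d by rewrite divr_gt0// mulr_gt0.
have -> : r / n%:R = 2 * d by rewrite /d; field; rewrite gt_eqF.
rewrite -(lebesgue_rV_cube x (ltW d0)); apply: le_measure; rewrite ?inE.
- exact: measurable_cube.
- exact: measurable_eball.
- move=> y yx; rewrite /eball/=.
  apply: (@le_lt_trans _ _ (n%:R * d)).
    apply: enorm_coord_le => i; have := yx i.
    by rewrite /= in_itv/= -ler_distl !mxE.
  have -> : n%:R * d = r / 2 by rewrite /d; field; rewrite gt_eqF.
  lra.
Qed.

Lemma lebesgue_rV_eball_fin n (x : 'rV[R]_n) (r : R) :
  (lebesgue_rV n (eball x r) < +oo)%E.
Proof.
have [r0|r0] := leP 0 r.
  by apply: le_lt_trans (lebesgue_rV_eball_le x r0) _; rewrite ltry.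
rewrite (_ : eball x r = set0) ?measure0//; apply/seteqP; split => // y.
by rewrite /eball/= => /lt_trans/(_ r0); rewrite ltNge enorm_ge0.
Qed.

Lemma ge0_integral_shift n (h : 'rV[R]_n) (f : 'rV[R]_n -> \bar R) :
  measurable_fun setT f -> (forall x, (0 <= f x)%E) ->
  (\int[lebesgue_rV n]_x f (x + h)%R = \int[lebesgue_rV n]_x f x)%E.
Proof.
move=> mf f0.
pose T (x : 'rV[R]_n) : 'rV[R]_n := (x + h)%R.
transitivity (\int[lebesgue_rV n]_(x in T @^-1` setT) (f \o T) x)%E.
  by rewrite preimage_setT.
rewrite -(ge0_integral_pushforward (measurable_shift h))//.
apply: eq_measure_integral => [|? A mA _]; first exact: measurable_shift.
exact: lebesgue_rV_shift.
Qed.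

Lemma integral_shift n (h : 'rV[R]_n) (f : 'rV[R]_n -> \bar R) :
  measurable_fun setT f ->
  (\int[lebesgue_rV n]_x f (x + h)%R = \int[lebesgue_rV n]_x f x)%E.
Proof.
move=> mf; rewrite integralE [RHS]integralE; congr (_ - _)%E.
  rewrite -[RHS](ge0_integral_shift h); last by move=> x; exact: funepos_ge0.
    by rewrite unlock.
  exact: measurable_funepos.
rewrite -[RHS](ge0_integral_shift h); last by move=> x; exact: funeneg_ge0.
  by rewrite unlock.
exact: measurable_funeneg.
Qed.

Lemma integrable_shift n (h : 'rV[R]_n) (f : 'rV[R]_n -> \bar R) :
  (lebesgue_rV n).-integrable setT f ->
  (lebesgue_rV n).-integrable setT (fun x => f (x + h)).
Proof.
move=> /integrableP[mf fi]; apply/integrableP; split.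
  by apply: (measurableT_comp mf); exact: measurable_shift.
rewrite (@ge0_integral_shift _ h (fun x => `|f x|)%E)//.
exact: measurableT_comp.
Qed.

Lemma Rintegral_shift n (h : 'rV[R]_n) (f : 'rV[R]_n -> R) :
  measurable_fun setT f ->
  \int[lebesgue_rV n]_x f (x + h) = \int[lebesgue_rV n]_x f x.
Proof.
move=> mf; rewrite /Rintegral (@integral_shift _ h (EFin \o f))//.
exact/measurable_EFinP.
Qed.

End lebesgue_rV_theory.

(** * Continuity of translations in L1 *)

Import HBSimple.

Section L1_translation.
Context {R : realType} {n : nat}.
Notation mu := (lebesgue_rV n).
Implicit Types (x y h : 'rV[R]_n) (f g : 'rV[R]_n -> R) (A U : set 'rV[R]_n).

(** Extended-valued, so that the triangle inequality carries no integrability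
    conditions. *)
Definition L1 f : \bar R := (\int[mu]_x `|f x|%:E)%E.

Lemma measurable_EFin_norm f : measurable_fun setT f ->
  measurable_fun setT (fun x => `|f x|%:E).
Proof. by move=> mf; apply/measurable_EFinP; exact: measurableT_comp. Qed.

Lemma L1_le f g : measurable_fun setT f -> measurable_fun setT g ->
  (forall x, `|f x| <= `|g x|) -> (L1 f <= L1 g)%E.
Proof.
move=> mf mg fg; apply: ge0_le_integral => //.
- exact: measurable_EFin_norm.
- exact: measurable_EFin_norm.
- by move=> x _; rewrite lee_fin.
Qed.

Lemma L1D f g : measurable_fun setT f -> measurable_fun setT g ->
  (L1 (fun x => f x + g x)%R <= L1 f + L1 g)%E.
Proof.
move=> mf mg; rewrite /L1 -ge0_integralD//; last 2 first.
- exact: measurable_EFin_norm.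
- exact: measurable_EFin_norm.
apply: ge0_le_integral => //.
- by apply: measurable_EFin_norm; exact: measurable_funD.
- by apply: emeasurable_funD; exact: measurable_EFin_norm.
- by move=> x _; rewrite -EFinD lee_fin ler_normD.
Qed.

Lemma L1N f : L1 (fun x => - f x) = L1 f.
Proof. by apply: eq_integral => x _; rewrite normrN. Qed.

Lemma L1B f g : measurable_fun setT f -> measurable_fun setT g ->
  (L1 (fun x => f x - g x)%R <= L1 f + L1 g)%E.
Proof.
move=> mf mg; rewrite -(L1N g); apply: L1D => //.
exact: measurableT_comp.
Qed.

Lemma L1Z c f : measurable_fun setT f ->
  L1 (fun x => c * f x) = (`|c|%:E * L1 f)%E.
Proof.
move=> mf; rewrite /L1 -ge0_integralZl//; last exact: measurable_EFin_norm.
by apply: eq_integral => x _; rewrite normrM.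
Qed.

Lemma measurable_comp_shift f h : measurable_fun setT f ->
  measurable_fun setT (fun x => f (x + h)).
Proof. by move=> mf; apply: (measurableT_comp mf); exact: measurable_shift. Qed.

Lemma L1_shift f h : measurable_fun setT f ->
  L1 (fun x => f (x + h)) = L1 f.
Proof.
move=> mf; exact: (ge0_integral_shift h (measurable_EFin_norm mf)).
Qed.

Lemma L1_indic A : measurable A -> L1 \1_A = mu A.
Proof.
move=> mA; rewrite -[in RHS](setIT A) -integral_indic//.
by apply: eq_integral => x _; rewrite indicE ger0_norm.
Qed.

Lemma lebesgue_rV_setD A U : measurable A -> measurable U -> U `<=` A ->
  (mu A < +oo)%E -> mu (A `\` U) = (fine (mu A) - fine (mu U))%:E.
Proof.
move=> mA mU UA Aoo; rewrite EFinB !fineK ?ge0_fin_numE//; last first.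
  by apply: le_lt_trans Aoo; apply: le_measure; rewrite ?inE.
transitivity (mu A - mu (A `&` U))%E; first exact: measureD.
by have -> : A `&` U = U by exact/setIidPr.
Qed.

(** Continuity at the origin of the map that sends [h] to the translate of [f] by
    [h], for the L1 distance. *)
Definition L1_shift_cont f : Prop := forall e : R, 0 < e ->
  exists2 d : R, 0 < d &
    forall h, enorm h < d -> (L1 (fun x => f (x + h) - f x)%R <= e%:E)%E.

Lemma L1_shift_contD f g : measurable_fun setT f -> measurable_fun setT g ->
  L1_shift_cont f -> L1_shift_cont g -> L1_shift_cont (fun x => f x + g x).
Proof.
move=> mf mg cf cg e e0; have e2 : 0 < e / 2 by rewrite divr_gt0.
have [d1 d10 fd] := cf _ e2; have [d2 d20 gd] := cg _ e2.
exists (Num.min d1 d2); first by rewrite lt_min d10.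
move=> h; rewrite lt_min => /andP[h1 h2].
rewrite (splitr e) EFinD; apply: le_trans (leeD (fd h h1) (gd h h2)).
apply: le_trans (L1D _ _); last 2 first.
- by apply: measurable_funB => //; exact: measurable_comp_shift.
- by apply: measurable_funB => //; exact: measurable_comp_shift.
by under [in leLHS]eq_fun do rewrite opprD addrACA.
Qed.

Lemma L1_shift_contZ c f : measurable_fun setT f ->
  L1_shift_cont f -> L1_shift_cont (fun x => c * f x).
Proof.
move=> mf cf e e0; have c1 : 0 < `|c| + 1 by rewrite ltr_wpDl.
have [d d0 fd] := cf _ (divr_gt0 e0 c1).
exists d => // h /fd le; under [in leLHS]eq_fun do rewrite -mulrBr.
rewrite L1Z; last by apply: measurable_funB => //; exact: measurable_comp_shift.
apply: le_trans (lee_wpmul2l _ le) _ => //.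
rewrite -EFinM lee_fin mulrCA ler_piMr// ?ltW// ltr_pdivrMr// mul1r.
by rewrite ltrDl.
Qed.

Lemma L1_shift_contB f g : measurable_fun setT f -> measurable_fun setT g ->
  L1_shift_cont f -> L1_shift_cont g -> L1_shift_cont (fun x => f x - g x).
Proof.
move=> mf mg cf cg.
rewrite (_ : (fun x => f x - g x) = (fun x => f x + -1 * g x)).
  apply: L1_shift_contD => //; last exact: L1_shift_contZ.
  exact: measurable_funM.
by apply/funext => x; rewrite mulN1r.
Qed.

Lemma L1_shift_cont_shift f h : measurable_fun setT f ->
  L1_shift_cont f -> L1_shift_cont (fun x => f (x + h)).
Proof.
move=> mf cf e e0; have [d d0 fd] := cf _ e0.
exists d => // k kd; apply: le_trans (fd k kd).
pose g x := f (x + k) - f x.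
have mg : measurable_fun setT g.
  by apply: measurable_funB => //; exact: measurable_comp_shift.
rewrite -[leRHS](L1_shift h mg).
by under [in leLHS]eq_fun do rewrite addrAC.
Qed.

Lemma L1_shift_cont_sum (I : Type) (s : seq I) (F : I -> 'rV[R]_n -> R) :
  (forall i, measurable_fun setT (F i)) -> (forall i, L1_shift_cont (F i)) ->
  L1_shift_cont (fun x => \sum_(i <- s) F i x).
Proof.
move=> mF cF; elim: s => [|i s IH].
  move=> e e0; exists 1 => // h _.
  under [in leLHS]eq_fun do rewrite !big_nil subrr.
  rewrite /L1; under eq_integral do rewrite normr0.
  by rewrite integral0 lee_fin ltW.
rewrite (_ : (fun x => _) = (fun x => F i x + \sum_(j <- s) F j x)).
  by apply: L1_shift_contD => //; exact: measurable_sum.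
by apply/funext => x; rewrite big_cons.
Qed.

(** A translation preserves the L1 norm, so that the approximation error is the
    same for all translates. *)
Lemma L1_shift_cont_approx f : measurable_fun setT f ->
  (forall e : R, 0 < e -> exists g, [/\ measurable_fun setT g, L1_shift_cont g &
    (L1 (fun x => f x - g x)%R <= e%:E)%E]) ->
  L1_shift_cont f.
Proof.
move=> mf fg e e0; have e3 : 0 < e / 3 by rewrite divr_gt0.
have [g [mg cg fge]] := fg _ e3.
have [d d0 gd] := cg _ e3.
exists d => // h hd.
have -> : e = e / 3 + e / 3 + e / 3 by lra.
pose k x := f x - g x.
have mk : measurable_fun setT k by exact: measurable_funB.
have -> : (fun x => f (x + h) - f x) =
    (fun x => ((k (x + h)) + (g (x + h) - g x)) - k x).
  by apply/funext => x; rewrite /k; ring.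
rewrite !EFinD; apply: le_trans (L1B _ _) _ => //.
  apply: measurable_funD; first exact: measurable_comp_shift.
  by apply: measurable_funB => //; exact: measurable_comp_shift.
apply: leeD => //; apply: le_trans (L1D _ _) _.
- exact: measurable_comp_shift.
- by apply: measurable_funB => //; exact: measurable_comp_shift.
- by apply: leeD; [rewrite L1_shift|exact: gd].
Qed.

(** A translation by less than the distance from [x] to the complement of [U]
    keeps [x] in [U], so that only a boundary layer of [U] of small measure
    matters. *)
Lemma L1_shift_cont_open U : open U -> (mu U < +oo)%E -> L1_shift_cont \1_U.
Proof.
move=> oU Uoo e e0.
pose V (k : nat) := [set x | eball x k.+1%:R^-1 `<=` U].
have VU k : V k `<=` U.
  by move=> x; apply; apply: eball_center; rewrite invr_gt0.
have mU : measurable U by exact: measurable_open.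
have mV k : measurable (V k).
  apply: measurable_closed; rewrite -openC.
  have -> : ~` V k = \bigcup_(y in ~` U) eball y k.+1%:R^-1.
    apply/seteqP; split=> [x|x [y Uy] xy Vx].
      move=> /existsNP[y /not_implyP[xy Uy]]; exists y => //.
      by move: xy; rewrite /eball/= enormC.
    by apply: Uy; apply: Vx; move: xy; rewrite /eball/= enormC.
  by apply: bigcup_open => y _; exact: eball_open.
have UV : U = \bigcup_k V k.
  apply/seteqP; split=> [x Ux|x [k _]]; last exact: VU.
  have [r r0 xr] := nbhs_eball (open_nbhs_nbhs (conj oU Ux)).
  have [k] := ltr_add_invr r0; rewrite add0r => kr.
  by exists k => // y yx; apply: xr; exact: lt_trans yx kr.
have ndV : nondecreasing_seq V.
  move=> k l kl; apply/subsetPset => x Vx y yx; apply: Vx.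
  by apply: lt_le_trans yx _; rewrite lef_pV2 ?posrE// ler_nat.
have Vcvg : mu (V k) @[k --> \oo] --> mu U.
  by rewrite [in X in _ --> X]UV; apply: nondecreasing_cvg_mu => //;
    rewrite -UV.
have /fine_cvgP[_ /cvgrPdist_le] : mu (V k) @[k --> \oo] --> (fine (mu U))%:E.
  by rewrite fineK// ge0_fin_numE.
move=> /(_ _ (divr_gt0 e0 (ltr0Sn _ 1)))[k _ /(_ k (leqnn _)) /= Uk].
have mW : measurable (U `\` V k) by exact: measurableD.
exists k.+1%:R^-1; first by rewrite invr_gt0.
move=> h hk.
have muW : (mu (U `\` V k) <= (e / 2)%:E)%E.
  rewrite lebesgue_rV_setD// lee_fin.
  exact: le_trans (ler_norm _) Uk.
have mIW := measurable_indic mW : measurable_fun setT (\1_(U `\` V k) : _ -> R).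
have mIU := measurable_indic mU : measurable_fun setT (\1_U : _ -> R).
apply: (@le_trans _ _ (L1 (fun x => \1_(U `\` V k) (x + h) + \1_(U `\` V k) x))).
  apply: L1_le.
  - by apply: measurable_funB => //; exact: measurable_comp_shift.
  - by apply: measurable_funD => //; exact: measurable_comp_shift.
  move=> x; rewrite [leRHS]ger0_norm ?addr_ge0// !indicE.
  have [xhU|xhU] := boolP (x + h \in U); have [xU|xU] := boolP (x \in U);
    rewrite /= ?subrr ?normr0 ?addr_ge0 ?subr0 ?sub0r ?normrN ?normr1//.
  - have -> : x + h \in U `\` V k; last by rewrite lerDl.
    rewrite inE; split; first by rewrite inE in xhU.
    move=> /(_ x) Vx; move: xU; rewrite notin_setE; apply; apply: Vx.
    by rewrite /eball/= opprD addNKr enormN.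
  - have -> : x \in U `\` V k; last by rewrite lerDr.
    rewrite inE; split; first by rewrite inE in xU.
    move=> /(_ (x + h)) Vx; move: xhU; rewrite notin_setE; apply; apply: Vx.
    by rewrite /eball/= addrC addKr.
apply: le_trans (L1D _ _) _ => //; first exact: measurable_comp_shift.
rewrite (splitr e) EFinD L1_shift// L1_indic//; exact: leeD.
Qed.

(** Open sets generate the Borel sets and are stable under intersection, and the
    sets for which the conclusion holds form a Dynkin system. Intersecting with a
    ball keeps the measures finite, so that a countable disjoint union is
    approximated in measure by its finite parts. *)
Lemma L1_shift_cont_indic A (K : R) : measurable A ->
  L1_shift_cont \1_(A `&` eball 0 K).
Proof.
set Q := eball 0 K => mA.
have oQ : open Q by exact: eball_open.
have mQ : measurable Q by exact: measurable_open.
have Qoo : (mu Q < +oo)%E by exact: lebesgue_rV_eball_fin.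
have mI B : measurable B -> measurable_fun setT (\1_(B `&` Q) : _ -> R).
  by move=> mB; apply: measurable_indic; exact: measurableI.
have cQ : L1_shift_cont \1_Q by exact: L1_shift_cont_open.
pose P (B : set 'rV[R]_n) := L1_shift_cont (\1_(B `&` Q)).
suff : P A by [].
apply: (@dynkin_induction _ 'rV[R]_n open P); rewrite /P => //.
- exact: measurable_rVE.
- by move=> B C; exact: openI.
- by rewrite setTI.
- move=> B oB; apply: L1_shift_cont_open; first exact: openI.
  apply: le_lt_trans Qoo; apply: le_measure; rewrite ?inE//.
  by apply: measurableI => //; exact: measurable_open.
- move=> B mB cB.
  rewrite (_ : \1_(~` B `&` Q) = fun x => \1_Q x - \1_(B `&` Q) x).
    by apply: L1_shift_contB; [exact: measurable_indic|exact: mI| |].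
  apply/funext => x; rewrite !indicE !in_setI in_setC.
  by case: (x \in B); case: (x \in Q); rewrite /= ?subrr ?subr0.
- move=> F mF tF cF.
  pose A_ N := \bigcup_(k < N) F k.
  have mA_ N : measurable (A_ N) by apply: bigcup_measurable.
  have mA' : measurable (\bigcup_k F k) by apply: bigcup_measurable.
  have cA_ N : L1_shift_cont \1_(A_ N `&` Q).
    elim: N => [|N IH].
      rewrite /A_ (_ : \bigcup_(k < 0) F k = set0); last first.
        by apply/seteqP; split => // x [].
      rewrite set0I => e e0; exists 1 => // h _.
      under [in leLHS]eq_fun do rewrite !indic0 /= subrr.
      rewrite /L1; under eq_integral do rewrite normr0.
      by rewrite integral0 lee_fin ltW.
    rewrite (_ : \1_(A_ N.+1 `&` Q) = fun x => \1_(A_ N `&` Q) x + \1_(F N `&` Q) x).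
      by apply: L1_shift_contD; [exact: mI|exact: mI| |].
    rewrite /A_ bigcup_mkord big_ord_recr -bigcup_mkord/=.
    apply/funext => x; rewrite !indicE !in_setI in_setU.
    have [xQ|xQ] := boolP (x \in Q); rewrite ?andbF ?andbT/= ?addr0//.
    have [xN|xN] := boolP (x \in F N); last by rewrite orbF addr0.
    rewrite orbT (_ : (x \in _) = false) ?add0r//.
    apply/negbTE; rewrite notin_setE => -[k /= kN Fk].
    have := tF k N Logic.I Logic.I; move: xN; rewrite inE => FN.
    by move/(_ (ex_intro _ x (conj Fk FN))) => kNE; move: kN; rewrite kNE ltnn.
  apply: L1_shift_cont_approx; first exact: mI.
  move=> e e0.
  have AE : (\bigcup_k F k) `&` Q = \bigcup_N (A_ N `&` Q).
    apply/seteqP; split => x.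
      by move=> [[k _ Fk] Qx]; exists k.+1 => //; split => //; exists k => /=.
    by move=> [N _ [[k _ Fk] Qx]]; split => //; exists k.
  have AQfin B : measurable B -> mu (B `&` Q) \is a fin_num.
    move=> mB; rewrite ge0_fin_numE//; apply: le_lt_trans Qoo.
    by apply: le_measure; rewrite ?inE//; exact: measurableI.
  have Acvg : mu (A_ N `&` Q) @[N --> \oo] --> (fine (mu ((\bigcup_k F k) `&` Q)))%:E.
    rewrite fineK ?AQfin//.
    rewrite [in X in _ --> X]AE; apply: nondecreasing_cvg_mu => //.
    - by move=> N; exact: measurableI.
    - by rewrite -AE; exact: measurableI.
    - move=> N M NM; apply/subsetPset => x [[k /= kN Fk] Qx]; split => //.
      by exists k => //=; exact: leq_trans NM.
  move: Acvg => /fine_cvgP[_ /cvgrPdist_le].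
  move=> /(_ _ e0)[N _ /(_ N (leqnn _)) /= AN].
  exists (\1_(A_ N `&` Q)); split => //; first exact: mI.
  rewrite (_ : (fun x => _) = \1_(((\bigcup_k F k) `&` Q) `\` (A_ N `&` Q))).
    rewrite L1_indic; last by apply: measurableD; exact: measurableI.
    rewrite lebesgue_rV_setD ?lee_fin; [|exact: measurableI|exact: measurableI| |].
    - exact: le_trans (ler_norm _) AN.
    - by rewrite AE => x Ax; exists N.
    - by have := AQfin _ mA'; rewrite ge0_fin_numE.
  apply/funext => x; rewrite !indicE in_setD.
  have [xAN|xAN] := boolP (x \in A_ N `&` Q); last by rewrite subr0 andbT.
  rewrite (_ : x \in _) ?subrr//= inE AE; exists N => //.
  by rewrite inE in xAN.
- by rewrite -measurable_rVE.
Qed.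

(** Simple functions are dense in L1, and those that approximate [f] may be
    multiplied by the indicator of the ball that carries [f]. *)
Lemma L1_shift_cont_integrable f (K : R) :
  mu.-integrable setT (EFin \o f) -> (forall x, ~ eball 0 K x -> f x = 0) ->
  L1_shift_cont f.
Proof.
set Q := eball 0 K => intf fK.
have [/measurable_EFinP mf _] := integrableP _ _ _ intf.
have mQ : measurable Q by exact: measurable_eball.
apply: L1_shift_cont_approx => // e e0.
have [g_ [intg _ /fine_cvgP[gfin /cvgrPdist_le]]] :=
  approximation_sfun_integrable measurableT intf.
move: gfin => [N1 _ N1fin] /(_ _ e0)[N2 _].
move=> /(_ (maxn N1 N2) (leq_maxr _ _)); set N := maxn N1 N2 => /= gN.
have gf := N1fin N (leq_maxl _ _).
pose G : 'rV[R]_n -> R := HBSimple.SimpleFun.sort (g_ N).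
pose g x := G x * \1_Q x.
have mgN : measurable_fun setT G.
  by have [/measurable_EFinP] := integrableP _ _ _ (intg N).
have mG (t : R) : measurable (G @^-1` [set t]) 
  by rewrite -[X in measurable X]setTI; apply: mgN => //; exact: measurable_set1.
have mg : measurable_fun setT g.
  by apply: measurable_funM => //; exact: measurable_indic.
exists g; split => //.
  have [s ->] : exists s : seq R,
      g = fun x => \sum_(t <- s) t * \1_((G @^-1` [set t]) `&` Q) x.
    eexists; apply/funext => x; rewrite /g /G [X in X * _ = _]fimfunE fsbig_finite//= mulr_suml.
    by apply: eq_bigr => i _; rewrite -mulrA indicI.
  have mIQ t : measurable_fun setT (\1_((G @^-1` [set t]) `&` Q) : _ -> R).
    by apply: measurable_indic; exact: measurableI.
  apply: L1_shift_cont_sum => t; first exact: measurable_funM.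
  by apply: L1_shift_contZ => //; exact: L1_shift_cont_indic.
pose k x := f x - G x.
apply: (@le_trans _ _ (L1 k)).
  apply: L1_le; [exact: measurable_funB|exact: measurable_funB|move=> x].
  rewrite /g indicE; case: (boolP (x \in Q)) => xQ; first by rewrite mulr1.
  by rewrite mulr0 subr0 fK ?normr0//; rewrite notin_setE in xQ.
move: gN; rewrite sub0r normrN => gN.
rewrite -[leLHS]fineK; last exact: gf.
by rewrite lee_fin; exact: le_trans (ler_norm _) gN.
Qed.

End L1_translation.

(** * The flat exponential *)

Section flat_exponential.
Context {R : realType}.
Implicit Types (p q : {poly R}) (t s : R).

(** The functions [p(1/t) exp(-1/t)], extended by 0 to [t <= 0]: a family that
    contains the standard flat function and is closed under derivation. *)
Definition flatexp p t : R := if 0 < t then p.[t^-1] * expR (- t^-1) else 0.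

(** With [s = 1/t], the bound [s ^+ i.+1 <= (i.+1)`! * expR s] of each monomial
    shows that the whole family is [O(t)] at 0. *)
Lemma flatexp_bound p : exists2 C : R, 0 <= C &
  forall t, `|flatexp p t| <= C * `|t|.
Proof.
pose C := \sum_(i < size p) `|p`_i| * (i.+1)`!%:R.
have C0 : 0 <= C by apply: sumr_ge0 => i _; rewrite mulr_ge0.
exists C => // t; rewrite /flatexp; case: ifPn => [t0|_]; last first.
  by rewrite normr0 mulr_ge0.
set s := t^-1; have s0 : 0 < s by rewrite invr_gt0.
rewrite normrM (gtr0_norm t0) (gtr0_norm (expR_gt0 _)) horner_coef.
apply: (@le_trans _ _ (\sum_(i < size p) `|p`_i| * s ^+ i * expR (- s))).
  rewrite -mulr_suml ler_wpM2r ?expR_ge0//.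
  apply: le_trans (ler_norm_sum _ _ _) _; apply: ler_sum => i _.
  by rewrite normrM normrX (gtr0_norm s0).
rewrite /C mulr_suml; apply: ler_sum => i _; rewrite -!mulrA ler_wpM2l//.
rewrite expRN ler_pdivrMr ?expR_gt0//.
have -> : s ^+ i = s ^+ i.+1 * t by rewrite exprSr mulfVK// gt_eqF.
rewrite mulrAC ler_wpM2r//; first exact: ltW.
rewrite mulrC -ler_pdivrMr ?ltr0n ?fact_gt0//.
by apply: le_trans (expR_ge1Dxn i (ltW s0)); rewrite lerDr.
Qed.

(** Away from 0 this is the chain rule. At 0 the difference quotient of
    [flatexp p] is [flatexp ('X * p)], again a member of the family, and tends to
    0. *)
Lemma is_derive_flatexp p t :
  is_derive t 1 (flatexp p) (flatexp ('X^2 * (p - p^`())) t).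
Proof.
have [t0|t0|->] := ltrgtP t 0.
- have -> : flatexp ('X^2 * (p - p^`())) t = 0 by rewrite /flatexp ltNge (ltW t0).
  apply: (@near_eq_is_derive _ _ _ (cst 0)).
    near=> s; rewrite /flatexp ltNge.
    by have /ltW -> : s < 0 by near: s; exact: lt_nbhsl.
- have -> : flatexp ('X^2 * (p - p^`())) t =
      p^`().[t^-1] * (- t ^- 2) * expR (- t^-1) +
      p.[t^-1] * (expR (- t^-1) * t ^- 2).
    rewrite /flatexp t0 hornerM hornerXn hornerD hornerN exprVn; ring.
  apply: (@near_eq_is_derive _ _ _ (fun s => p.[s^-1] * expR (- s^-1))).
    near=> s; rewrite /flatexp.
    by have -> : 0 < s by near: s; exact: lt_nbhsr.
  have dV : is_derive t 1 (fun s : R => s^-1) (- t ^- 2 *: 1).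
    by apply: (@is_deriveV _ id); rewrite ?gt_eqF//; exact: is_derive_id.
  have dp := is_derive1_comp (is_derive_poly p t^-1) dV.
  have de := @is_derive1_comp _ expR (fun s => - s^-1) t _ _ (is_derive_expR (- t^-1)) (is_deriveN dV).
  apply: is_derive_eq (is_deriveM dp de) _.
  rewrite /= /GRing.scale/= !mulr1; ring.
- have -> : flatexp ('X^2 * (p - p^`())) 0 = 0 by rewrite /flatexp ltxx.
  have [C C0 fC] := flatexp_bound ('X * p).
  have cvg0 : h^-1 *: (flatexp p (h *: 1 + 0) - flatexp p 0) @[h --> 0^'] --> (0 : R).
    apply/cvgrPdist_lt => e e0; near=> h.
    have h0 : h != 0 by near: h; exact: nbhs_dnbhs_neq.
    rewrite sub0r normrN {2}/flatexp ltxx subr0 addr0 [_ *: 1]mulr1.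
    have -> : h^-1 *: flatexp p h = flatexp ('X * p) h.
      rewrite /flatexp; case: ifPn => _; last by rewrite scaler0.
      by rewrite hornerM hornerX -mulrA.
    apply: le_lt_trans (fC h) _.
    rewrite (@le_lt_trans _ _ ((C + 1) * `|h|))// ?ler_wpM2r// ?lerDl//.
    rewrite mulrC -ltr_pdivlMr ?ltr_wpDl//; near: h.
    by apply: dnbhs0_lt; rewrite divr_gt0// ltr_wpDl.
  apply: DeriveDef; last exact: (cvg_lim _ cvg0).
  by apply/cvg_ex; exists 0.
Unshelve. all: by end_near. Qed.

End flat_exponential.

(** * Smooth functions *)

Section smooth_functions.
Context {R : realType} {n : nat}.
Implicit Types (f g phi : 'rV[R]_n -> R) (x y v h : 'rV[R]_n) (D : set 'rV[R]_n).

(** Reduces directional derivatives to derivatives on the line, where the chain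
    rule applies. *)
Lemma is_derive_line f x v (df : R) :
  is_derive x v f df <-> is_derive (0 : R) 1 (fun t => f (t *: v + x)) df.
Proof.
have E : (fun h : R => h^-1 *: ((f \o shift x) (h *: v) - f x)) =
    (fun h : R => h^-1 *: (((fun t : R => f (t *: v + x)) \o shift 0) (h *: 1) -
      (fun t : R => f (t *: v + x)) 0)).
  by apply/funext => t; rewrite /= addr0 scale0r add0r [t *: 1]mulr1.
split => -[d1 d2]; apply: DeriveDef.
- by rewrite /derivable -E.
- by rewrite /derive -E.
- by rewrite /derivable E.
- by rewrite /derive E.
Qed.

Lemma is_derive_coord i x v : is_derive x v (fun y => y 0 i) (v 0 i).
Proof.
apply/is_derive_line.
under [X in is_derive _ _ X _]eq_fun do rewrite !mxE.
have H := is_deriveD (is_deriveM (is_derive_id (0 : R) (1 : R))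
  (is_derive_cst (v 0 i) (0 : R) (1 : R))) (is_derive_cst (x 0 i) (0 : R) (1 : R)).
by apply: is_derive_eq H _; rewrite scaler0 add0r addr0 [_ *: _]mulr1.
Qed.

Lemma is_derive_dotvv x v : is_derive x v (fun y => dotv y y) (2 * dotv x v).
Proof.
rewrite (_ : (fun y => dotv y y) = \sum_(i < n) (fun y => y 0 i * y 0 i)); last first.
  by apply/funext => y; rewrite fct_sumE.
rewrite (_ : 2 * dotv x v = \sum_(i < n) (x 0 i *: v 0 i + x 0 i *: v 0 i)).
  apply: is_derive_sum => i.
  by apply: is_deriveM; exact: is_derive_coord.
rewrite /dotv mulr_sumr; apply: eq_bigr => i _; rewrite /GRing.scale/=; ring.
Qed.

(** Composing with [c - |x|^2] makes the flat function a function supported in the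
    ball of square radius [c]. *)
Definition bump (p : {poly R}) (c : R) x : R := flatexp p (c - dotv x x).

Lemma is_derive_bump p c x v :
  is_derive x v (bump p c) (bump ('X^2 * (p - p^`())) c x * (- (2 * dotv x v))).
Proof.
apply/is_derive_line; rewrite /bump.
apply: (@is_derive1_comp _ (flatexp p) (fun t => c - dotv (t *: v + x) (t *: v + x))).
  rewrite /= scale0r add0r; have H := is_derive_flatexp p (c - dotv x x).
  exact: H.
have H := is_deriveB (is_derive_cst c (0 : R) (1 : R))
  ((is_derive_line _ _ _ _).1 (is_derive_dotvv x v)).
by apply: is_derive_eq H _; rewrite sub0r.
Qed.

Lemma continuous_bump p c : continuous (bump p c).
Proof.
move=> x; apply: (@continuous_comp _ _ _ (fun y => c - dotv y y) (flatexp p)).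
  apply: (@cvgB _ R^o _ (nbhs x) _ (cst c) (fun y => dotv y y)).
    exact: cvg_cst.
  by apply: continuous_dotv => y; exact: cvg_id.
apply: differentiable_continuous; apply/derivable1_diffP.
by have [] := is_derive_flatexp p (c - dotv x x).
Qed.

(** Smoothness is the largest class of continuous functions that have partial
    derivatives in the class. To prove it of a function, exhibit such a class. *)
Lemma smooth_coinduction (C : set ('rV[R]_n -> R)) :
  (forall f, C f -> continuous f /\ forall i,
     (forall x, derivable f x 'e_i) /\ C ('D_('e_i) f)) ->
  forall f, C f -> smooth f.
Proof.
move=> CP f Cf s; have : C (iter_partial s f).
  by elim: s => // i s IH; have [_ /(_ i)[]] := CP _ IH.
by move=> /CP[cf df]; split => // i x; have [] := df i.
Qed.

Lemma smooth_continuous f : smooth f -> continuous f.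
Proof. by move=> /(_ [::])[]. Qed.

Lemma smooth_derivable f i x : smooth f -> derivable f x 'e_i.
Proof. by move=> /(_ [::])[_]; exact. Qed.

Lemma smooth_derive f i : smooth f -> smooth ('D_('e_i) f).
Proof. by move=> sf s; have := sf (rcons s i); rewrite /iter_partial foldr_rcons. Qed.

(** By the Leibniz rule the algebra generated by the bumps, the coordinates and
    the smooth functions is stable under partial derivatives, hence consists of
    smooth functions. *)
Inductive smooth_alg : ('rV[R]_n -> R) -> Prop :=
| SA_cst c : smooth_alg (cst c)
| SA_coord i : smooth_alg (fun x => x 0 i)
| SA_bump p c : smooth_alg (bump p c)
| SA_smooth f : smooth f -> smooth_alg f
| SA_add f g : smooth_alg f -> smooth_alg g -> smooth_alg (fun x => f x + g x)
| SA_mul f g : smooth_alg f -> smooth_alg g -> smooth_alg (fun x => f x * g x).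

Lemma derivable_is_derive f x v (df : R) : is_derive x v f df -> derivable f x v.
Proof. by case. Qed.

Lemma is_derive_derive f x v (df : R) : is_derive x v f df -> 'D_v f x = df.
Proof. by case. Qed.

Lemma dotv_delta x i : dotv x 'e_i = x 0 i.
Proof.
rewrite /dotv (bigD1 i)//= big1 ?addr0 => [|j ji]; first by rewrite mxE !eqxx mulr1.
by rewrite mxE (negbTE ji) andbF mulr0.
Qed.

Lemma smooth_algP f : smooth_alg f -> smooth f.
Proof.
apply: smooth_coinduction => {}f.
elim=> {f} [c|j|p c|f sf|f g sf [cf df] sg [cg dg]|f g sf [cf df] sg [cg dg]].
- split; first exact: cst_continuous.
  move=> i; split => [x|]; first exact: derivable_cst.
  rewrite (_ : 'D_('e_i) (cst c) = cst 0); first exact: SA_cst.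
  by apply/funext => x; exact: derive_cst.
- split; first exact: continuous_coord.
  move=> i; split => [x|]; first exact: derivable_is_derive (is_derive_coord _ _ _).
  rewrite (_ : 'D_('e_i) _ = cst (('e_i : 'rV[R]_n) 0 j)); first exact: SA_cst.
  by apply/funext => x; apply: is_derive_derive; exact: is_derive_coord.
- split; first exact: continuous_bump.
  move=> i; split => [x|]; first exact: derivable_is_derive (is_derive_bump _ _ _ _).
  rewrite (_ : 'D_('e_i) _ = fun x =>
      bump ('X^2 * (p - p^`())) c x * (cst (-2) x * x 0 i)).
    by apply: SA_mul; [exact: SA_bump|apply: SA_mul; [exact: SA_cst|exact: SA_coord]].
  apply/funext => x; rewrite (is_derive_derive (is_derive_bump _ _ _ _)).
  by rewrite dotv_delta mulNr.
- split; first exact: smooth_continuous.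
  move=> i; split => [x|]; first exact: smooth_derivable.
  by apply: SA_smooth; exact: smooth_derive.
- split; first by move=> x; apply: (@cvgD _ R^o _ (nbhs x) _ f g); [exact: cf|exact: cg].
  move=> i; have [dfi Dfi] := df i; have [dgi Dgi] := dg i; split => [x|].
    exact: derivableD.
  rewrite (_ : 'D_('e_i) _ = fun x => 'D_('e_i) f x + 'D_('e_i) g x).
    exact: SA_add.
  by apply/funext => x; exact: deriveD.
- split; first by move=> x; apply: (@cvgM _ _ (nbhs x) _ f g); [exact: cf|exact: cg].
  move=> i; have [dfi Dfi] := df i; have [dgi Dgi] := dg i; split => [x|].
    exact: derivableM.
  rewrite (_ : 'D_('e_i) _ = fun x => f x * 'D_('e_i) g x + g x * 'D_('e_i) f x).
    by apply: SA_add; apply: SA_mul.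
  by apply/funext => x; exact: deriveM.
Qed.

Lemma smooth_bump p c : smooth (bump p c).
Proof. by apply: smooth_algP; exact: SA_bump. Qed.

Lemma smoothM f g : smooth f -> smooth g -> smooth (fun x => f x * g x).
Proof. by move=> sf sg; apply: smooth_algP; apply: SA_mul; exact: SA_smooth. Qed.

Lemma is_derive_shift_rV f x v h (df : R) :
  is_derive (x + h) v f df -> is_derive x v (fun y => f (y + h)) df.
Proof.
move=> /is_derive_line H; apply/is_derive_line.
by under [X in is_derive _ _ X _]eq_fun do rewrite -addrA.
Qed.

Lemma derivable_shift_rV f x v h :
  derivable f (x + h) v -> derivable (fun y => f (y + h)) x v.
Proof. by move=> /derivableP/is_derive_shift_rV[]. Qed.

Lemma derive_shift_rV f x v h : derivable f (x + h) v ->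
  'D_v (fun y => f (y + h)) x = 'D_v f (x + h).
Proof. by move=> /derivableP/is_derive_shift_rV[]. Qed.

Lemma smooth_shift f h : smooth f -> smooth (fun x => f (x + h)).
Proof.
move=> sf; apply: (@smooth_coinduction
  [set g | exists2 f, smooth f & g = fun x => f (x + h)]); last by exists f.
move=> _ [{sf}f sf ->]; split.
  move=> x; apply: (@continuous_comp _ _ _ (fun y => y + h) f).
    exact: continuous_addr.
  exact: smooth_continuous.
move=> i; split => [x|]; first by apply: derivable_shift_rV; exact: smooth_derivable.
exists ('D_('e_i) f); first exact: smooth_derive.
apply/funext => x; apply: derive_shift_rV; exact: smooth_derivable.
Qed.

End smooth_functions.

(** * Cutoffs and test functions *)

Section test_functions.
Context {R : realType} {n : nat}.
Implicit Types (f g phi eta : 'rV[R]_n -> R) (x y v h : 'rV[R]_n)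
  (D : set 'rV[R]_n) (r s : R).

Lemma flatexp1_ge0 (t : R) : 0 <= flatexp 1 t.
Proof. by rewrite /flatexp; case: ifP => // _; rewrite hornerC mul1r expR_ge0. Qed.

Lemma flatexp1_homo : {homo @flatexp R 1 : s t / s <= t}.
Proof.
move=> s t st; rewrite /flatexp; case: ifPn => s0; last first.
  by case: ifP => // _; rewrite hornerC mul1r expR_ge0.
rewrite (lt_le_trans s0 st) !hornerC !mul1r ler_expR lerN2 lef_pV2//.
by rewrite posrE (lt_le_trans s0 st).
Qed.

Lemma flatexp1_gt0 (t : R) : (0 < flatexp 1 t) = (0 < t).
Proof.
by rewrite /flatexp; case: ifP => [_|]; rewrite ?ltxx// hornerC mul1r expR_gt0.
Qed.

(** Positive on the open ball of radius [r] and zero outside. *)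
Definition cutoff r x := bump 1 (r ^+ 2) x.

Lemma smooth_cutoff r : smooth (cutoff r).
Proof. exact: smooth_bump. Qed.

Lemma cutoff_ge0 r x : 0 <= cutoff r x.
Proof. exact: flatexp1_ge0. Qed.

Lemma cutoff_gt0 r x : 0 < r -> (0 < cutoff r x) = (enorm x < r).
Proof.
move=> r0; rewrite /cutoff /bump flatexp1_gt0 subr_gt0 -enorm_sqr.
by rewrite ltr_pXn2r// ?nnegrE ?enorm_ge0// ltW.
Qed.

Lemma cutoff_neq0 r x : 0 < r -> cutoff r x != 0 -> enorm x < r.
Proof. by move=> r0 c0; rewrite -cutoff_gt0// lt0r c0 cutoff_ge0. Qed.

Lemma cutoff_ge r s x : enorm x <= s -> flatexp 1 (r ^+ 2 - s ^+ 2) <= cutoff r x.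
Proof.
move=> xs; apply: flatexp1_homo; rewrite lerD2l lerN2 -enorm_sqr.
by rewrite ler_pXn2r// nnegrE ?enorm_ge0// (le_trans _ xs)// enorm_ge0.
Qed.

Lemma compact_support_test f r D : smooth f ->
  (forall x, f x != 0 -> enorm x <= r) ->
  (forall x, enorm x <= r -> D x) -> test_function D f.
Proof.
move=> sf fr rD.
have sub : closure [set x | f x != 0] `<=` [set x | enorm x <= r].
  by rewrite [X in _ `<=` X](closure_id _).1; [exact: closure_subset|exact: closed_enorm_le].
split => //; last by move=> x /sub; exact: rD.
by apply: subclosed_compact sub; [exact: closed_closure|exact: compact_enorm_le].
Qed.

Lemma test_function_neq0 D phi x : test_function D phi -> phi x != 0 -> D x.
Proof. by move=> [_ _ cD] px; apply: cD; exact: subset_closure. Qed.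

Lemma test_function_shift D D' phi h : test_function D phi ->
  (forall x, D x -> D' (x + h)) -> test_function D' (fun x => phi (x - h)).
Proof.
move=> [sphi cK KD] DD'.
set K := closure _ in cK KD.
have sub : closure [set x | phi (x - h) != 0] `<=` (fun x => x - h) @^-1` K.
  have cl : closed ((fun x => x - h) @^-1` K).
    apply: preimage_closed; last exact: closed_closure.
    by move=> x _; exact: (@continuous_addr _ _ (- h)).
  rewrite [X in _ `<=` X](closure_id _).1//.
  by apply: closure_subset => x /= px; exact: subset_closure.
have E : (fun x => x - h) @^-1` K = (fun x => x + h) @` K.
  apply/seteqP; split => [x Kx|_ [x Kx <-]]; last by rewrite /preimage/= addrK.
  by exists (x - h) => //; rewrite subrK.
split.
- exact: smooth_shift.
- apply: subclosed_compact sub; first exact: closed_closure.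
  rewrite E; apply: continuous_compact => //.
  by apply: continuous_subspaceT; exact: continuous_addr.
- by move=> x /sub /KD /DD'; rewrite subrK.
Qed.

(** Off the closed support the function vanishes in a neighbourhood. *)
Lemma closure_derive_support f i :
  [set x | 'D_('e_i) f x != 0] `<=` closure [set x | f x != 0].
Proof.
move=> x /= dfx; apply: contrapT => xK; move: dfx; apply/negP; rewrite negbK.
have : nbhs x (~` closure [set x | f x != 0]).
  by apply: open_nbhs_nbhs; split => //; apply: closed_openC; exact: closed_closure.
move=> nK; rewrite (@near_eq_derive _ _ _ f (cst 0)) ?derive_cst//.
apply: filterS nK => y yK; apply/eqP; apply: contrapT => fy.
by apply: yK; apply: subset_closure; apply/negP.
Qed.

Lemma test_function_derive D phi i :
  test_function D phi -> test_function D ('D_('e_i) phi).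
Proof.
move=> [sphi cK KD].
have sub : closure [set x | 'D_('e_i) phi x != 0] `<=` closure [set x | phi x != 0].
  rewrite [X in _ `<=` X](closure_id _).1; last exact: closed_closure.
  by apply: closure_subset; exact: closure_derive_support.
split; first exact: smooth_derive.
- by apply: subclosed_compact sub => //; exact: closed_closure.
- exact: subset_trans KD.
Qed.

Lemma test_functionM D eta f : test_function D eta -> smooth f ->
  test_function D (fun x => eta x * f x).
Proof.
move=> [seta cK KD] sf.
have sub : closure [set x | eta x * f x != 0] `<=` closure [set x | eta x != 0].
  by apply: closure_subset => x /=; rewrite mulf_eq0 negb_or => /andP[].
split; first exact: smoothM.
- by apply: subclosed_compact sub => //; exact: closed_closure.
- exact: subset_trans KD.
Qed.

Lemma test_function_subset D D' phi :
  D `<=` D' -> test_function D phi -> test_function D' phi.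
Proof. by move=> DD' [? ? KD]; split => //; exact: subset_trans DD'. Qed.

Lemma test_function_bounded D phi : test_function D phi ->
  exists2 M : R, 0 <= M & forall x, `|phi x| <= M.
Proof.
move=> [sphi cK KD]; set K := closure _ in cK.
have cphi : continuous (fun x => `|phi x|).
  move=> x; apply: (@continuous_comp _ _ _ phi Num.norm).
    exact: smooth_continuous.
  exact: norm_continuous.
have [K0|/set0P K0] := eqVneq K set0.
  exists 0 => // x; have [->|px] := eqVneq (phi x) 0; first by rewrite normr0.
  have : K x by exact: subset_closure.
  by rewrite K0.
have [c _ cmax] := EVT_max_rV K0 cK (continuous_subspaceT cphi).
exists `|phi c| => // x; have [->|px] := eqVneq (phi x) 0; first by rewrite normr0.
by apply: cmax; rewrite inE; exact: subset_closure.
Qed.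

Lemma measurable_continuous f : continuous f -> measurable_fun setT f.
Proof.
move=> cf; apply: (measurability _ (RGenOpens.measurableE R)).
move=> _ [_ [a [b ->]] <-]; rewrite setTI; apply: measurable_open.
apply: open_comp; last exact: interval_open.
by move=> x _; exact: cf.
Qed.

Lemma measurable_smooth f : smooth f -> measurable_fun setT f.
Proof. by move=> sf; apply: measurable_continuous; exact: smooth_continuous. Qed.

End test_functions.

(** * Convolution with a test function *)

Section convolution.
Context {R : realType} {n : nat}.
Notation mu := (lebesgue_rV n).
Implicit Types (f g rho phi psi : 'rV[R]_n -> R) (x y z v h : 'rV[R]_n)
  (D : set 'rV[R]_n).

Definition itg f := mu.-integrable setT (EFin \o f).

Lemma itg_measurable f : itg f -> measurable_fun setT f.
Proof. by move=> /integrableP[/measurable_EFinP]. Qed.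

Lemma itg_L1 f : itg f <-> measurable_fun setT f /\ (L1 f < +oo)%E.
Proof.
split=> [/integrableP[/measurable_EFinP mf foo]|[mf foo]]; first by split.
by apply/integrableP; split => //; exact/measurable_EFinP.
Qed.

Lemma itg_le f g : measurable_fun setT f -> (forall x, `|f x| <= g x) ->
  itg g -> itg f.
Proof.
move=> mf fg; apply: le_integrable => //; first exact/measurable_EFinP.
by move=> x _; rewrite lee_fin (le_trans (fg x))// ler_norm.
Qed.

Lemma itgD f g : itg f -> itg g -> itg (fun x => f x + g x).
Proof. by move=> itf itg; exact: (integrableD measurableT itf itg). Qed.

Lemma itgB f g : itg f -> itg g -> itg (fun x => f x - g x).
Proof. by move=> itf itg; exact: (integrableB measurableT itf itg). Qed.

Lemma itg_norm f : itg f -> itg (fun x => `|f x|).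
Proof. exact: integrable_norm. Qed.

Lemma itgZ (c : R) f : itg f -> itg (fun x => c * f x).
Proof.
move=> itf; rewrite /itg (_ : _ \o _ = (fun x => c%:E * (f x)%:E)%E).
  exact: integrableZl.
by apply/funext => x; rewrite /= EFinM.
Qed.

Lemma itgMb psi f (M : R) : measurable_fun setT psi -> (forall x, `|psi x| <= M) ->
  itg f -> itg (fun x => psi x * f x).
Proof.
move=> mp pM itf; apply: (@itg_le _ (fun x => M * `|f x|)).
- by apply: measurable_funM => //; exact: itg_measurable.
- by move=> x; rewrite normrM ler_wpM2r.
- by apply: itgZ; exact: itg_norm.
Qed.

Lemma itg_shift f h : itg f -> itg (fun x => f (x + h)).
Proof. exact: integrable_shift. Qed.

Lemma itg_bounded_support f (M K : R) : measurable_fun setT f ->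
  (forall x, `|f x| <= M) -> (forall x, ~ eball 0 K x -> f x = 0) -> itg f.
Proof.
move=> mf fM fK.
have mQ : measurable (eball (0 : 'rV[R]_n) K) by exact: measurable_eball.
have M0 : 0 <= M by apply: le_trans (fM 0).
apply: (@itg_le _ (fun x => M * \1_(eball 0 K) x)) => //.
  move=> x; rewrite indicE; case: (boolP (x \in _)) => xK; first by rewrite mulr1.
  by rewrite mulr0 fK ?normr0//; rewrite notin_setE in xK.
apply: itgZ; apply/itg_L1; split; first exact: measurable_indic.
by rewrite L1_indic//; exact: lebesgue_rV_eball_fin.
Qed.

Lemma test_function_itg D phi : test_function D phi -> itg phi.
Proof.
move=> tphi; have [M M0 pM] := test_function_bounded tphi.
have [sphi cK _] := tphi.
have [K [_ /(_ (K + 1))]] := compact_bounded cK; rewrite ltrDl => /(_ ltr01) pK.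
apply: (@itg_bounded_support _ M (n%:R * (K + 1) + 1)) => //.
  exact: measurable_smooth.
move=> x xK; apply/eqP; apply: contrapT => /negP px; apply: xK.
have /pK xK : closure [set x | phi x != 0] x by exact: subset_closure.
rewrite /eball/= subr0; apply: le_lt_trans (ler_enorm_sup x) _.
by rewrite ltr_pwDr// ler_wpM2l.
Qed.

(** With the argument [y - x] of the kernel this is the average, weighted by
    [rho], of the translates [f (y + x)]; see [convE]. *)
Definition conv f rho x : R := \int[mu]_y (f y * rho (y - x)).

Lemma conv_itg f rho D x : itg f -> test_function D rho ->
  itg (fun y => f y * rho (y - x)).
Proof.
move=> itf trho; have [M _ rM] := test_function_bounded trho.
under eq_fun do rewrite mulrC.
apply: itgMb itf => [|y]; last exact: rM.
apply: measurable_comp_shift; apply: measurable_smooth.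
by case: trho.
Qed.

Lemma convE f rho D x : itg f -> test_function D rho ->
  conv f rho x = \int[mu]_y (f (y + x) * rho y).
Proof.
move=> itf trho; rewrite /conv -(Rintegral_shift x); last first.
  by apply: itg_measurable; exact: conv_itg trho.
by apply: eq_Rintegral => y _ /=; rewrite addrK.
Qed.

Lemma conv_itgE f rho D x : itg f -> test_function D rho ->
  itg (fun y => f (y + x) * rho y).
Proof.
move=> itf trho; have := itg_shift x (conv_itg x itf trho).
by under eq_fun do rewrite addrK.
Qed.

Lemma Rintegral_le_L1 f (e : R) : measurable_fun setT f ->
  (L1 f <= e%:E)%E -> `|\int[mu]_x f x| <= e.
Proof.
move=> mf fe.
have itf : itg f by apply/itg_L1; split => //; rewrite (le_lt_trans fe)// ltry.
rewrite -lee_fin EFin_normr_Rintegral//; apply: le_trans fe.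
by apply: le_abse_integral => //; exact/measurable_EFinP.
Qed.

(** Moving [x] translates [f], and translations are continuous in L1. *)
Lemma continuous_conv f rho D : itg f -> L1_shift_cont f ->
  test_function D rho -> continuous (conv f rho).
Proof.
move=> itf cf trho; have [M M0 rM] := test_function_bounded trho.
have M1 : 0 < M + 1 by rewrite ltr_wpDl.
have mr : measurable_fun setT rho by apply: measurable_smooth; case: trho.
move=> x; apply/(@cvgrPdist_le _ R^o _ (nbhs x) _ (conv f rho)) => e e0.
have [d d0 fd] := cf _ (divr_gt0 e0 M1).
near=> z; have : eball x d z by near: z; exact: nbhs_eball_center.
rewrite /eball/= => zx.
have itfs y : itg (fun y' => f (y' + y) * rho y') by exact: conv_itgE trho.
rewrite distrC !(convE _ itf trho) -RintegralB; [|by []|exact: itfs|exact: itfs].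
apply: Rintegral_le_L1.
  by apply: measurable_funB; apply: itg_measurable; exact: itfs.
have {}fd := fd _ zx.
pose k y := f (y + (z - x)) - f y.
have mk : measurable_fun setT k.
  by apply: measurable_funB; [apply: measurable_comp_shift|]; exact: itg_measurable.
apply: (@le_trans _ _ (L1 (fun y => (M + 1) * k (y + x)))).
  apply: L1_le.
  - by apply: measurable_funB; apply: itg_measurable; exact: itfs.
  - by apply: measurable_funM => //; exact: measurable_comp_shift.
  move=> y; rewrite -mulrBl mulrC !normrM (gtr0_norm M1).
  rewrite /k -addrA (addrC x) subrK ler_wpM2r//.
  by rewrite (le_trans (rM y))// lerDl.
rewrite L1Z; last exact: measurable_comp_shift.
rewrite L1_shift// (gtr0_norm M1); apply: le_trans (lee_wpmul2l _ fd) _.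
  by rewrite lee_fin ltW.
by rewrite -EFinM mulrC divfK// gt_eqF.
Unshelve. all: by end_near. Qed.

Lemma is_derive_line_at f x v (t df : R) :
  is_derive (t *: v + x) v f df -> is_derive t 1 (fun s : R => f (s *: v + x)) df.
Proof.
move=> /is_derive_line.
rewrite -[X in is_derive X](subrr t) => H.
have H1 := is_deriveB (is_derive_id t (1 : R)) (is_derive_cst t t (1 : R)).
have H2 := @is_derive1_comp _ _ (fun s => s - t) t _ _ H H1.
rewrite (_ : (fun s : R => _) =
  (fun s : R => f (s *: v + (t *: v + x))) \o (fun s => s - t)); last first.
  by apply/funext => s /=; rewrite addrA -scalerDl subrK.
by apply: is_derive_eq H2 _; rewrite subr0 mulr1.
Qed.

(** Differentiation under the integral sign; the kernel and its derivatives are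
    bounded, so that a multiple of [|f|] dominates. The factor [-1] comes from the
    argument [y - x] of the kernel. *)
Lemma is_derive_conv f rho D x i : itg f -> test_function D rho ->
  is_derive x 'e_i (conv f rho) (conv f (fun y => 'D_('e_i) rho y * -1) x).
Proof.
move=> itf trho.
have tD := test_function_derive i trho.
have [M M0 rM] := test_function_bounded tD.
have srho : smooth rho by case: trho.
apply/is_derive_line.
pose F (t : R) (y : 'rV[R]_n) : R := f y * rho (y - (t *: 'e_i + x)).
have dF (t : R) y : is_derive t 1 (F ^~ y) (f y * ('D_('e_i) rho (y - (t *: 'e_i + x)) * -1)).
  have H0 : is_derive (- t) 1 (fun s : R => rho (s *: 'e_i + (y - x)))
      ('D_('e_i) rho (y - (t *: 'e_i + x))).
    apply: is_derive_line_at.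
    have -> : - t *: 'e_i + (y - x) = y - (t *: 'e_i + x).
      by rewrite scaleNr addrCA -opprD.
    by apply: derivableP; exact: smooth_derivable.
  have H1 := @is_derive1_comp _ _ -%R t _ _ H0 (is_deriveNid t 1).
  have H2 := is_deriveZ (f y) H1.
  rewrite (_ : F ^~ y = f y \*: ((fun s : R => rho (s *: 'e_i + (y - x))) \o -%R)) //.
  apply/funext => s; rewrite /F /=; congr (_ * rho _).
  by rewrite scaleNr addrCA -opprD.
have dFE (t : R) y : partial1of2 F t y = f y * ('D_('e_i) rho (y - (t *: 'e_i + x)) * -1).
  by rewrite partial1of2E; case: (dF t y).
have iF (t : R) : mu.-integrable setT (EFin \o F t) by exact: (conv_itg _ itf trho).
pose G y := M * `|f y|.
have G0 y : 0 <= G y by rewrite mulr_ge0.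
have iG : mu.-integrable setT (EFin \o G) by apply: itgZ; exact: itg_norm.
have I0 : `](-1), 1[%classic (0 : R) by rewrite /= in_itv/= ltrN10 ltr01.
have derF (t : R) y : `](-1), 1[%classic t -> setT y -> derivable (F ^~ y) t 1.
  by move=> _ _; case: (dF t y).
have FG (t : R) y : `](-1), 1[%classic t -> setT y -> `|partial1of2 F t y| <= G y.
  move=> _ _; rewrite dFE mulrN1 normrM normrN mulrC ler_wpM2r//.
have H1 := derivable_under_integral measurableT I0 (fun t _ => iF t) derF G0 iG FG.
have H2 := differentiation_under_integral measurableT I0 (fun t _ => iF t) derF G0 iG FG.
apply: DeriveDef; first exact: H1.
rewrite -derive1E H2; apply: eq_Rintegral => y _.
by rewrite dFE scale0r add0r.
Qed.

Lemma smooth_cst (c : R) : smooth (cst c : 'rV[R]_n -> R).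
Proof. by apply: smooth_algP; exact: SA_cst. Qed.

Lemma smooth_conv f rho D : itg f -> L1_shift_cont f ->
  test_function D rho -> smooth (conv f rho).
Proof.
move=> itf cf trho; apply: (@smooth_coinduction _ _
  [set g | exists2 rho, test_function D rho & g = conv f rho]); last by exists rho.
move=> _ [{trho}rho trho ->]; split; first exact: continuous_conv trho.
move=> i; split => [x|]; first exact: derivable_is_derive (is_derive_conv x i itf trho).
exists (fun y => 'D_('e_i) rho y * -1).
  apply: test_functionM; first exact: test_function_derive.
  exact: smooth_cst.
by apply/funext => x; apply: is_derive_derive; exact: is_derive_conv trho.
Qed.

(** The functions are defined on the whole space, so that they can be translated.
    Compare [weak_gradient]. *)
Definition weak_partial D i f g : Prop := forall phi, test_function D phi ->
  \int[mu]_x (f x * 'D_('e_i) phi x) = - \int[mu]_x (g x * phi x).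

(** The kernel translated by [x] is a test function on [D], on which the
    derivative can be moved from the kernel to [f]. *)
Lemma derive_conv_weak D D' i f g rho x : itg f -> itg g ->
  weak_partial D i f g -> test_function D' rho ->
  (forall y, D' y -> D (y + x)) ->
  'D_('e_i) (conv f rho) x = conv g rho x.
Proof.
move=> itf ig fg trho D'D.
rewrite (is_derive_derive (is_derive_conv x i itf trho)) /conv.
have srho : smooth rho by case: trho.
have tx := test_function_shift trho D'D.
under eq_Rintegral do rewrite mulrA.
rewrite RintegralZr//; last first.
  by apply: (conv_itg x itf (test_function_derive i trho)).
rewrite mulrN1; have := fg _ tx.
under eq_Rintegral => y _.
  rewrite derive_shift_rV; last exact: smooth_derivable.
  over.
by move=> ->; rewrite opprK.
Qed.

Lemma measurable_subT : measurable_fun setT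
  (fun p : 'rV[R]_n * 'rV[R]_n => p.1 + p.2).
Proof.
apply: measurable_fun_matrix => i j; under eq_fun do rewrite mxE.
apply: measurable_funD.
  apply: (@measurableT_comp _ _ _ _ _ _ (fun v : 'rV[R]_n => v i j)).
    exact: measurable_entry.
  exact: measurable_fst.
apply: (@measurableT_comp _ _ _ _ _ _ (fun v : 'rV[R]_n => v i j)).
  exact: measurable_entry.
exact: measurable_snd.
Qed.

(** By Fubini, [conv g rho - g] is an average of differences [g (. + z) - g], with
    [z] in the support of the probability density [rho]; these are small in L1. *)
Lemma conv_weak_close psi g rho D (M e : R) : 0 <= M ->
  measurable_fun setT psi -> (forall x, `|psi x| <= M) ->
  itg g -> L1_shift_cont g -> test_function D rho -> (forall x, 0 <= rho x) ->
  \int[mu]_x rho x = 1 ->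
  (forall z, rho z != 0 -> (L1 (fun x => g (x + z) - g x)%R <= e%:E)%E) ->
  itg (fun x => psi x * conv g rho x) /\
  `|\int[mu]_x (psi x * conv g rho x) - \int[mu]_x (psi x * g x)| <= M * e.
Proof.
move=> M0 mpsi psiM ig cg trho rho0 rho1 ge.
have irho := test_function_itg trho.
have mrho := itg_measurable irho.
have mg := itg_measurable ig.
have mconv : measurable_fun setT (conv g rho).
  by apply: measurable_continuous; exact: continuous_conv trho.
pose k x := psi x * (conv g rho x - g x).
have mk : measurable_fun setT k.
  by apply: measurable_funM => //; exact: measurable_funB.
have convB x : conv g rho x - g x = \int[mu]_y ((g (y + x) - g x) * rho y).
  rewrite (convE x ig trho) -[X in _ - X]mulr1 -rho1 -RintegralZl// -RintegralB//.
  - by apply: eq_Rintegral => y _; rewrite mulrBl.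
  - exact: conv_itgE trho.
  - exact: itgZ.
pose F (p : 'rV[R]_n * 'rV[R]_n) : \bar R :=
  (M * `|g (p.1 + p.2) - g p.1| * rho p.2)%:E.
have mF : measurable_fun setT F.
  apply/measurable_EFinP; apply: measurable_funM; last first.
    exact: (measurableT_comp mrho measurable_snd).
  apply: measurable_funM => //; apply: measurableT_comp => //.
  apply: measurable_funB; first exact: (measurableT_comp mg measurable_subT).
  exact: (measurableT_comp mg measurable_fst).
have F0 p : (0 <= F p)%E by rewrite lee_fin !mulr_ge0.
have kF x : (`|k x|%:E <= \int[mu]_y F (x, y))%E.
  rewrite /k convB normrM EFinM.
  have ikx : itg (fun y => (g (y + x) - g x) * rho y).
    under eq_fun do rewrite mulrBl.
    by apply: itgB; [exact: conv_itgE trho|exact: itgZ].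
  rewrite EFin_normr_Rintegral//.
  apply: (@le_trans _ _ (M%:E * `|\int[mu]_y ((g (y + x) - g x) * rho y)%:E|)%E).
    by apply: lee_wpmul2r => //; rewrite lee_fin.
  have mI : measurable_fun setT (fun y => ((g (y + x) - g x) * rho y)%R).
    exact: itg_measurable.
  apply: (@le_trans _ _ (M%:E * \int[mu]_y `|((g (y + x) - g x) * rho y)%:E|)%E).
    apply: lee_wpmul2l; first by rewrite lee_fin.
    by apply: le_abse_integral => //; exact/measurable_EFinP.
  rewrite -ge0_integralZl//; last first.
    by do 2 apply: measurableT_comp => //; exact/measurable_EFinP.
  apply: ge0_le_integral => //.
  - by move=> y _; rewrite mule_ge0 // lee_fin.
  - by apply: measurable_funeM; do 2 apply: measurableT_comp => //; exact/measurable_EFinP.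
  - exact: (measurableT_comp mF (measurable_pair1 x)).
  - move=> y _; rewrite /F /= -EFinM lee_fin normrM mulrA (ger0_norm (rho0 y)).
    by rewrite (addrC x).
have L1k : (L1 k <= (M * e)%:E)%E.
  apply: (@le_trans _ _ (\int[mu]_x \int[mu]_y F (x, y))%E).
    apply: ge0_le_integral => //.
    - exact: measurable_EFin_norm.
    - exact: measurable_fun_fubini_tonelli_F.
  have -> : (\int[mu]_x \int[mu]_y F (x, y) = \int[mu]_y \int[mu]_x F (x, y))%E.
    exact: fubini_tonelli.
  apply: (@le_trans _ _ (\int[mu]_y (M * e * rho y)%:E)%E).
    apply: ge0_le_integral => //.
    - by move=> y _; exact: integral_ge0.
    - exact: measurable_fun_fubini_tonelli_G.
    - by apply/measurable_EFinP; exact: measurable_funM.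
    - move=> z _; have [rz|rz] := eqVneq (rho z) 0.
        rewrite rz mulr0 integral0_eq// => x _.
        by rewrite /F /= rz mulr0.
      have := ge z rz.
      have mgz : measurable_fun setT (fun x => g (x + z) - g x).
        by apply: measurable_funB => //; exact: measurable_comp_shift.
      move=> le; rewrite /F/=.
      under eq_integral do rewrite mulrC mulrA EFinM.
      rewrite ge0_integralZl//; last 2 first.
      - exact: measurable_EFin_norm.
      - by rewrite lee_fin mulr_ge0.
      apply: le_trans (lee_wpmul2l _ le) _; first by rewrite lee_fin mulr_ge0.
      by rewrite -EFinM lee_fin [leRHS]mulrC mulrA.
  under eq_integral do rewrite EFinM.
  rewrite integralZl//.
  have -> : (\int[mu]_x (rho x)%:E = 1)%E.
    rewrite -[LHS]fineK; last exact: integrable_fin_num.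
    by rewrite -[fine _]/(\int[mu]_x rho x) rho1.
  by rewrite mule1.
have ik : itg k by apply/itg_L1; split => //; apply: le_lt_trans L1k _; rewrite ltry.
have ipg : itg (fun x => psi x * g x) by exact: itgMb psiM ig.
have ipc : itg (fun x => psi x * conv g rho x).
  rewrite (_ : (fun x => _) = (fun x => k x + psi x * g x)); first exact: itgD.
  by apply/funext => x; rewrite /k mulrBr subrK.
split => //; rewrite -RintegralB//.
under eq_Rintegral do rewrite -mulrBr.
exact: Rintegral_le_L1.
Qed.

End convolution.

(** * Mollification of weakly differentiable functions *)

Section mollification.
Context {R : realType} {n : nat}.
Notation mu := (lebesgue_rV n).
Implicit Types (f g rho phi psi u : 'rV[R]_n -> R) (x y z v h : 'rV[R]_n)
  (D : set 'rV[R]_n).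

Lemma itg_indic (A : set 'rV[R]_n) : measurable A -> (mu A < +oo)%E -> itg \1_A.
Proof.
move=> mA Aoo; apply/itg_L1; split; first exact: measurable_indic.
by rewrite L1_indic.
Qed.

Lemma mollifier (r : R) : (0 < n)%N -> 0 < r ->
  exists rho, [/\ test_function [set y | enorm y <= r] rho, forall x, 0 <= rho x,
    \int[mu]_x rho x = 1 & forall z, rho z != 0 -> enorm z < r].
Proof.
move=> n0 r0; pose I := \int[mu]_x cutoff r x.
have tc : test_function [set y : 'rV[R]_n | enorm y <= r] (cutoff r).
  apply: (@compact_support_test _ _ (cutoff r) r [set y | enorm y <= r]).
  - exact: smooth_cutoff.
  - by move=> x cx; apply: ltW; exact: cutoff_neq0.
  - by [].
have ic := test_function_itg tc.
have I0 : 0 < I.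
  (* A lower bound of the cutoff on the ball of radius [r / 2]. *)
  pose c := flatexp 1 (r ^+ 2 - (r / 2) ^+ 2).
  have c0 : 0 < c by rewrite flatexp1_gt0; nra.
  have mB : measurable (eball (0 : 'rV[R]_n) (r / 2)) by exact: measurable_eball.
  have r2 : 0 < r / 2 by rewrite divr_gt0.
  have mu0 : 0 < fine (mu (eball 0 (r / 2))).
    have := lebesgue_rV_eball_ge (0 : 'rV[R]_n) n0 r2.
    have bfin : mu (eball (0 : 'rV[R]_n) (r / 2)) \is a fin_num.
      by rewrite ge0_fin_numE//; exact: lebesgue_rV_eball_fin.
    rewrite -[X in (_ <= X)%E](fineK bfin) lee_fin; apply: lt_le_trans.
    by rewrite exprn_gt0// divr_gt0// ltr0n.
  apply: (@lt_le_trans _ _ (\int[mu]_x (c * \1_(eball 0 (r / 2)) x))).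
    rewrite RintegralZl//; last first.
      by apply: itg_indic => //; exact: lebesgue_rV_eball_fin.
    rewrite mulr_gt0// /Rintegral integral_indic// setIT.
    exact: mu0.
  apply: le_Rintegral => //.
    by apply: itgZ; apply: itg_indic => //; exact: lebesgue_rV_eball_fin.
  move=> x _; rewrite indicE; case: (boolP (x \in _)) => [|_]; last first.
    by rewrite mulr0 cutoff_ge0.
  by rewrite inE /eball/= subr0 mulr1 => /ltW xr; exact: cutoff_ge.
exists (fun x => cutoff r x * I^-1); split.
- by apply: test_functionM => //; exact: smooth_cst.
- by move=> x; rewrite mulr_ge0 ?cutoff_ge0// invr_ge0 ltW.
- by rewrite RintegralZr// divff// gt_eqF.
- by move=> z; rewrite mulf_eq0 negb_or => /andP[cz _]; exact: cutoff_neq0.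
Qed.

Lemma uniform_L1_shift_cont (I : finType) (g_ : I -> 'rV[R]_n -> R) (e : R) :
  (forall i, L1_shift_cont (g_ i)) -> 0 < e ->
  exists2 d : R, 0 < d & forall h, enorm h < d ->
    forall i, (L1 (fun x => g_ i (x + h) - g_ i x)%R <= e%:E)%E.
Proof.
move=> cg e0.
have /choice[d_ d_P] i : exists d : R, 0 < d /\ forall h, enorm h < d ->
    (L1 (fun x => g_ i (x + h) - g_ i x)%R <= e%:E)%E.
  by have [d d0 dP] := cg i _ e0; exists d.
exists (\big[Num.min/1]_i d_ i).
  by apply/bigmin_gtP; split => [|i _]; [exact: ltr01|have [] := d_P i].
move=> h /bigmin_gtP[_ hd] i; have [_] := d_P i; apply; exact: hd.
Qed.

Lemma eq0_le_eps (a C : R) : (forall e : R, 0 < e -> `|a| <= C * e) -> a = 0.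
Proof.
move=> aC; apply/eqP; rewrite -normr_le0; apply/ler_addgt0Pr => e e0; rewrite add0r.
have C1 : 0 < `|C| + 1 by rewrite ltr_wpDl.
apply: le_trans (aC _ (divr_gt0 e0 C1)) _.
rewrite mulrCA ler_piMr// ?ltW// ltr_pdivrMr// mul1r.
by rewrite (le_lt_trans (ler_norm _))// ltrDl.
Qed.

(** The integration by parts of a divergence-free field [V] against [eta * u],
    where [u] is only weakly differentiable. Mollify [u]: then [eta * conv u rho]
    is a test function, and each of the two terms of its gradient converges when
    integrated against the bounded field [V]. *)
Lemma weak_product_rule (s t M : R) (V : 'rV[R]_n -> 'rV[R]_n) u
    (g_ : 'I_n -> 'rV[R]_n -> R) eta :
  (0 < n)%N -> t < s ->
  (forall i, measurable_fun setT (fun x => V x 0 i)) ->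
  (forall i x, `|V x 0 i| <= M) ->
  (forall phi, test_function (eball 0 s) phi ->
    \sum_(i < n) \int[mu]_x (V x 0 i * 'D_('e_i) phi x) = 0) ->
  itg u -> L1_shift_cont u ->
  (forall i, itg (g_ i)) -> (forall i, L1_shift_cont (g_ i)) ->
  (forall i, weak_partial (eball 0 s) i u (g_ i)) ->
  test_function [set x | enorm x <= t] eta ->
  \sum_(i < n) (\int[mu]_x (V x 0 i * eta x * g_ i x) +
                \int[mu]_x (V x 0 i * 'D_('e_i) eta x * u x)) = 0.
Proof.
move=> n0 ts mV VM divV iu cu ig cg wg teta.
have M0 : 0 <= M by apply: le_trans (VM (Ordinal n0) 0).
have [A A0 etaA] := test_function_bounded teta.
have tD i := test_function_derive i teta.
have /choice[B_ B_P] i : exists B : R, 0 <= B /\ forall x, `|'D_('e_i) eta x| <= B.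
  by have [B B0 BP] := test_function_bounded (tD i); exists B.
have seta : smooth eta by case: teta.
apply: (@eq0_le_eps _ (\sum_(i < n) (M * A + M * B_ i))) => e e0.
have [d1 d10 d1P] := cu _ e0.
have [d2 d20 d2P] := uniform_L1_shift_cont cg e0.
pose r := Num.min (Num.min d1 d2) ((s - t) / 2).
have st : 0 < s - t by rewrite subr_gt0.
have r0 : 0 < r by rewrite !lt_min d10 d20 divr_gt0.
have [rho [trho rho0 rho1 rhor]] := mollifier n0 r0.
have r1 z : rho z != 0 -> enorm z < d1.
  by move=> /rhor; rewrite !lt_min => /andP[/andP[]].
have r2 z : rho z != 0 -> enorm z < d2.
  by move=> /rhor; rewrite !lt_min => /andP[/andP[]].
have rst : r <= (s - t) / 2 by rewrite ge_min lexx orbT.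
have Vsm f i : smooth f -> measurable_fun setT (fun x => V x 0 i * f x).
  by move=> sf; apply: measurable_funM => //; exact: measurable_smooth.
have VAb i x : `|V x 0 i * eta x| <= M * A by rewrite normrM ler_pM.
have VBb i x : `|V x 0 i * 'D_('e_i) eta x| <= M * B_ i.
  by have [B0 BP] := B_P i; rewrite normrM ler_pM.
have H1 i := conv_weak_close (mulr_ge0 M0 A0) (Vsm _ i seta) (VAb i) (ig i) (cg i)
  trho rho0 rho1 (fun z rz => d2P z (r2 z rz) i).
have H2 i : itg (fun x => V x 0 i * 'D_('e_i) eta x * conv u rho x) /\
    `|\int[mu]_x (V x 0 i * 'D_('e_i) eta x * conv u rho x) -
      \int[mu]_x (V x 0 i * 'D_('e_i) eta x * u x)| <= M * B_ i * e.
  have [B0 BP] := B_P i.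
  apply: (conv_weak_close (mulr_ge0 M0 B0) (Vsm _ i (smooth_derive i seta)) (VBb i)
    iu cu trho rho0 rho1) => z /r1; exact: d1P.
have sconv : smooth (conv u rho) by exact: smooth_conv trho.
have tphi : test_function (eball 0 s) (fun x => eta x * conv u rho x).
  apply: test_functionM => //; apply: test_function_subset teta => x /= xt.
  by rewrite /eball/= subr0 (le_lt_trans xt).
have Dphi i x : 'D_('e_i) (fun x => eta x * conv u rho x) x =
    eta x * conv (g_ i) rho x + 'D_('e_i) eta x * conv u rho x.
  rewrite (@deriveM _ _ eta (conv u rho)); [|exact: smooth_derivable..].
  rewrite /GRing.scale/= [X in _ + X]mulrC; congr (_ + _).
  have [->|ex] := eqVneq (eta x) 0; first by rewrite !mul0r.
  congr (_ * _); apply: (derive_conv_weak iu (ig i) (wg i) trho) => y /= yr.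
  rewrite /eball/= subr0; apply: le_lt_trans (ler_enormD _ _) _.
  have := test_function_neq0 teta ex => /= xt.
  apply: le_lt_trans (lerD yr xt) _; lra.
have := divV _ tphi.
under eq_bigr => i _.
  under eq_Rintegral do rewrite Dphi mulrDr !mulrA.
  rewrite RintegralD//; last 2 first.
  - by case: (H1 i).
  - by case: (H2 i).
  over.
move=> sum0.
rewrite -normrN -[X in `|X|]add0r -[X in X - _]sum0 -sumrB.
apply: le_trans (ler_norm_sum _ _ _) _.
rewrite mulr_suml; apply: ler_sum => i _.
rewrite opprD addrACA mulrDl; apply: le_trans (ler_normD _ _) _.
have [_ h1] := H1 i; have [_ h2] := H2 i.
exact: lerD.
Qed.

(** An average of translates of [u] has the Lipschitz constant of [u]. *)
Lemma derive_conv_lipschitz (s r L : R) i u rho x :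
  itg u -> (forall y z, eball 0 s y -> eball 0 s z ->
    `|u y - u z| <= L * enorm (y - z)) ->
  test_function [set y | enorm y <= r] rho -> (forall x, 0 <= rho x) ->
  \int[mu]_x rho x = 1 -> enorm x + r < s ->
  'D_('e_i) (conv u rho) x <= L.
Proof.
move=> iu uL trho rho0 rho1 xrs.
have [dconv _] := is_derive_conv x i iu trho.
have irho := test_function_itg trho.
have ei1 : enorm ('e_i : 'rV[R]_n) = 1.
  by rewrite /enorm dotv_delta mxE !eqxx sqrtr1.
have xs : 0 < s - (enorm x + r) by rewrite subr_gt0.
suff H : \forall t \near (0 : R)^',
    t^-1 *: ((conv u rho \o shift x) (t *: 'e_i) - conv u rho x) <= L.
  exact: limr_le dconv H.
near=> t.
have t0 : t != 0 by near: t; exact: nbhs_dnbhs_neq.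
have ts : `|t| < s - (enorm x + r) by near: t; exact: dnbhs0_lt.
apply: le_trans (ler_norm _) _.
rewrite /= normrM normfV ler_pdivrMl ?normr_gt0//.
rewrite !(convE _ iu trho).
rewrite -RintegralB//; [|exact: conv_itgE trho|exact: conv_itgE trho].
have iL : itg (fun y => (L * `|t|) * rho y) by exact: itgZ.
apply: (@le_trans _ _ (\int[mu]_y ((L * `|t|) * rho y))); last first.
  by rewrite RintegralZl// rho1 mulr1 mulrC.
have iB : itg (fun y => u (y + (t *: 'e_i + x)) * rho y - u (y + x) * rho y).
  by apply: itgB; exact: conv_itgE trho.
apply: le_trans (le_normr_Rintegral _ _) _ => //.
apply: le_Rintegral => //; first exact: itg_norm.
move=> y _; rewrite -mulrBl normrM (ger0_norm (rho0 y)).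
have [->|ry] := eqVneq (rho y) 0; first by rewrite !mulr0.
rewrite ler_wpM2r//.
have yr : enorm y <= r by exact: test_function_neq0 trho ry.
apply: le_trans (uL _ _ _ _) _; last first.
- rewrite (_ : _ - _ = t *: 'e_i); first by rewrite enormZ ei1 mulr1.
  by rewrite opprD addrACA subrr add0r addrK.
- rewrite /eball/= subr0; apply: le_lt_trans (ler_enormD _ _) _; lra.
- rewrite /eball/= subr0; apply: le_lt_trans (ler_enormD _ _) _.
  apply: le_lt_trans (lerD (lexx _) (ler_enormD _ _)) _.
  rewrite enormZ ei1 mulr1; lra.
Unshelve. all: by end_near. Qed.

Lemma measurable_superlevel f (t c : R) : measurable_fun setT f ->
  measurable [set x : 'rV[R]_n | eball 0 t x /\ c < f x].
Proof.
move=> mf; have -> : [set x : 'rV[R]_n | eball 0 t x /\ c < f x] =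
    eball 0 t `&` (setT `&` f @^-1` `]c, +oo[%classic).
  by apply/seteqP; split => x /=; rewrite in_itv/= andbT => -[] // ? [].
apply: measurableI; first exact: measurable_eball.
by apply: mf => //; exact: measurable_itv.
Qed.

(** Let [A] be the set in question. The mollifications of [g] are derivatives of
    mollifications of [u], hence at most [L]; integrating them over [A] and
    passing to the limit gives [(L + 1) |A| <= L |A|]. *)
Lemma weak_partial_ub (s t L : R) i u g : (0 < n)%N -> t < s ->
  itg u -> itg g -> L1_shift_cont g ->
  (forall y z, eball 0 s y -> eball 0 s z -> `|u y - u z| <= L * enorm (y - z)) ->
  weak_partial (eball 0 s) i u g ->
  mu [set x | eball 0 t x /\ L + 1 < g x] = 0.
Proof.
move=> n0 ts iu ig cg uL wg.
have mg := itg_measurable ig.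
pose A := [set x | eball 0 t x /\ L + 1 < g x].
have mA : measurable A by exact: measurable_superlevel.
have Aoo : (mu A < +oo)%E.
  apply: le_lt_trans (lebesgue_rV_eball_fin 0 t).
  by apply: le_measure; rewrite ?inE//; [exact: measurable_eball|move=> x []].
have iA : itg \1_A by exact: itg_indic.
have mIA : measurable_fun setT (\1_A : _ -> R) by exact: measurable_indic.
have A1 x : `|\1_A x : R| <= 1 by rewrite indicE; case: (_ \in _); rewrite ?normr1 ?normr0.
have ipg : itg (fun x => \1_A x * g x) by exact: itgMb A1 ig.
have AL : fine (mu A) = \int[mu]_x (\1_A x).
  by rewrite /Rintegral integral_indic// setIT.
have le0 : fine (mu A) <= 0.
  apply/ler_addgt0Pr => e e0; rewrite add0r.
  have [d d0 dP] := cg _ e0.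
  pose r := Num.min d ((s - t) / 2).
  have st : 0 < s - t by rewrite subr_gt0.
  have r0 : 0 < r by rewrite !lt_min d0 divr_gt0.
  have rst : r <= (s - t) / 2 by rewrite ge_min lexx orbT.
  have [rho [trho rho0 rho1 rhor]] := mollifier n0 r0.
  have rd z : rho z != 0 -> enorm z < d by move=> /rhor; rewrite !lt_min => /andP[].
  have [ipc] := conv_weak_close ler01 mIA A1 ig cg trho rho0 rho1
    (fun z rz => dP z (rd z rz)).
  rewrite mul1r => close.
  have c1 : \int[mu]_x (\1_A x * conv g rho x) <= \int[mu]_x (L * \1_A x).
    apply: le_Rintegral => //; first exact: itgZ.
    move=> x _; rewrite indicE; case: (boolP (x \in A)) => [|_]; last first.
      by rewrite mul0r mulr0.
    rewrite inE mul1r mulr1 => -[]; rewrite /eball/= subr0 => xt _.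
    rewrite -(derive_conv_weak iu ig wg trho); last first.
      move=> y /= yr; rewrite /eball/= subr0; apply: le_lt_trans (ler_enormD _ _) _; lra.
    apply: (derive_conv_lipschitz i iu uL trho) => //; lra.
  have c2 : \int[mu]_x ((L + 1) * \1_A x) <= \int[mu]_x (\1_A x * g x).
    apply: le_Rintegral => //; first exact: itgZ.
    move=> x _; rewrite indicE; case: (boolP (x \in A)) => [|_]; last first.
      by rewrite mul0r mulr0.
    by rewrite inE mul1r mulr1 => -[_ /ltW].
  move: c1 c2; rewrite !RintegralZl// -AL.
  move: close; rewrite ler_norml => /andP[close _]; lra.
have Afin : mu A \is a fin_num by rewrite ge0_fin_numE.
have H : (mu A <= 0)%E by rewrite -(fineK Afin) lee_fin.
by apply/eqP; rewrite -measure_le0; exact: H.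
Qed.

(** Apply the upper bound to [u] and to [- u]. *)
Lemma weak_partial_bounded (s t L : R) i u g : (0 < n)%N -> t < s ->
  itg u -> itg g -> L1_shift_cont g ->
  (forall y z, eball 0 s y -> eball 0 s z -> `|u y - u z| <= L * enorm (y - z)) ->
  weak_partial (eball 0 s) i u g ->
  mu.-negligible [set x | eball 0 t x /\ L + 1 < `|g x|].
Proof.
move=> n0 ts iu ig cg uL wg.
have H1 := weak_partial_ub n0 ts iu ig cg uL wg.
have mg := itg_measurable ig.
have iNg : itg (fun x => -1 * g x) by exact: itgZ.
have iNu : itg (fun x => -1 * u x) by exact: itgZ.
have H2 : mu [set x | eball 0 t x /\ L + 1 < -1 * g x] = 0.
  apply: (weak_partial_ub (u := fun x => -1 * u x) (i := i) n0 ts iNu iNg).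
  - exact: L1_shift_contZ.
  - by move=> y z ys zs; rewrite -mulrBr normrM normrN1 mul1r uL.
  - move=> phi tphi.
    have tD := test_function_derive i tphi.
    have itM f psi : itg f -> test_function (eball 0 s) psi ->
        itg (fun x => f x * psi x).
      move=> itf tpsi; have [M _ psiM] := test_function_bounded tpsi.
      under eq_fun do rewrite mulrC.
      by apply: itgMb psiM itf; apply: measurable_smooth; case: tpsi.
    under eq_Rintegral do rewrite -mulrA.
    under [in RHS]eq_Rintegral do rewrite -mulrA.
    rewrite !RintegralZl//; [|exact: itM|exact: itM].
    by rewrite wg// !mulN1r.
apply: (@negligibleS _ _ _ _ ([set x | eball 0 t x /\ L + 1 < g x] `|`
    [set x | eball 0 t x /\ L + 1 < -1 * g x])).
  move=> x [xt]; rewrite lter_normr => /orP[gx|gx]; first by left.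
  by right; split => //; rewrite mulN1r.
by apply: negligibleU; apply/negligibleP => //; apply: measurable_superlevel => //;
  exact: measurable_funM.
Qed.

End mollification.

(** * Increments of a solution *)

Section translation_estimate.
Context {R : realType} {n : nat}.
Notation mu := (lebesgue_rV n).
Implicit Types (f g rho phi psi u : 'rV[R]_n -> R) (x y z v h : 'rV[R]_n)
  (D : set 'rV[R]_n).

Lemma itgM_test D f phi : itg f -> test_function D phi ->
  itg (fun x => f x * phi x).
Proof.
move=> itf tphi; have [M _ phiM] := test_function_bounded tphi.
under eq_fun do rewrite mulrC.
by apply: itgMb phiM itf; apply: measurable_smooth; case: tphi.
Qed.

Lemma Rintegral_shift_test D f phi h : itg f -> test_function D phi ->
  \int[mu]_x (f (x + h) * phi x) = \int[mu]_x (f x * phi (x - h)).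
Proof.
move=> itf tphi; rewrite -[LHS](Rintegral_shift (- h)).
  by apply: eq_Rintegral => x _ /=; rewrite subrK.
by apply: itg_measurable; apply: itgM_test tphi; exact: itg_shift.
Qed.

(** Translating a function amounts to translating the test function backwards,
    which remains a test function on [D]. *)
Lemma weak_partial_shiftB D D' i u g h : itg u -> itg g ->
  weak_partial D i u g -> D' `<=` D -> (forall x, D' x -> D (x + h)) ->
  weak_partial D' i (fun x => u (x + h) - u x) (fun x => g (x + h) - g x).
Proof.
move=> iu ig w D'D D'h phi tphi.
have tD := test_function_derive i tphi.
have sphi : smooth phi by case: tphi.
have tphih := test_function_shift tphi D'h.
have itu := itgM_test iu tD; have ith := itgM_test (itg_shift h iu) tD.
have igu := itgM_test ig tphi; have igh := itgM_test (itg_shift h ig) tphi.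
under eq_Rintegral do rewrite mulrBl.
under [in RHS]eq_Rintegral do rewrite mulrBl.
rewrite !RintegralB// (Rintegral_shift_test h iu tD) (Rintegral_shift_test h ig tphi).
rewrite (w _ (test_function_subset D'D tphi)) opprB opprK addrC; congr (_ + _).
rewrite -(w _ tphih); apply: eq_Rintegral => x _.
by rewrite derive_shift_rV//; exact: smooth_derivable.
Qed.

Lemma bounded_itgM_test D psi phi (M : R) : measurable_fun setT psi ->
  (forall x, `|psi x| <= M) -> test_function D phi -> itg (fun x => psi x * phi x).
Proof. by move=> mp pM tphi; apply: itgMb pM _ => //; exact: test_function_itg tphi. Qed.

Lemma RintegralBl_mul f g phi : itg (fun x => f x * phi x) ->
  itg (fun x => g x * phi x) ->
  \int[mu]_x ((f x - g x) * phi x) =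
  \int[mu]_x (f x * phi x) - \int[mu]_x (g x * phi x).
Proof.
by move=> if_ ig; under eq_Rintegral do rewrite mulrBl; rewrite RintegralB.
Qed.

Lemma div_free_shiftB D D' (V : 'rV[R]_n -> 'rV[R]_n) (M : R) h :
  (forall i, measurable_fun setT (fun x => V x 0 i)) ->
  (forall i x, `|V x 0 i| <= M) ->
  (forall phi, test_function D phi ->
    \sum_(i < n) \int[mu]_x (V x 0 i * 'D_('e_i) phi x) = 0) ->
  D' `<=` D -> (forall x, D' x -> D (x + h)) ->
  forall phi, test_function D' phi ->
    \sum_(i < n) \int[mu]_x ((V (x + h) - V x) 0 i * 'D_('e_i) phi x) = 0.
Proof.
move=> mV VM divV D'D D'h phi tphi.
have tphih := test_function_shift tphi D'h.
have sphi : smooth phi by case: tphi.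
have tD i := test_function_derive i tphi.
rewrite -[RHS]subr0 -[X in X - _](divV _ tphih).
rewrite -[X in _ - X](divV _ (test_function_subset D'D tphi)) -sumrB.
apply: eq_bigr => i _.
have mVh : measurable_fun setT (fun x => V (x + h) 0 i).
  exact: (measurable_comp_shift h (mV i)).
have iV := bounded_itgM_test (mV i) (VM i) (tD i).
have iVh := bounded_itgM_test mVh (fun x => VM i (x + h)) (tD i).
transitivity (\int[mu]_x (V (x + h) 0 i * 'D_('e_i) phi x) -
    \int[mu]_x (V x 0 i * 'D_('e_i) phi x)).
  rewrite -(RintegralBl_mul iVh iV).
  by apply: eq_Rintegral => x _; rewrite !mxE.
suff -> : \int[mu]_x (V (x + h) 0 i * 'D_('e_i) phi x) =
    \int[mu]_x (V x 0 i * 'D_('e_i) (fun x => phi (x - h)) x) by [].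
rewrite -[LHS](Rintegral_shift (- h)); last exact: itg_measurable.
apply: eq_Rintegral => x _ /=; rewrite subrK.
by rewrite derive_shift_rV//; exact: smooth_derivable.
Qed.

Lemma Rintegral_sum (I : Type) (r : seq I) (F : I -> 'rV[R]_n -> R) :
  (forall i, itg (F i)) -> itg (fun x => \sum_(i <- r) F i x) /\
  \int[mu]_x (\sum_(i <- r) F i x) = \sum_(i <- r) \int[mu]_x F i x.
Proof.
move=> iF; elim: r => [|i r [IH1 IH2]].
  split; first by under eq_fun do rewrite big_nil; exact: integrable0.
  under eq_Rintegral do rewrite big_nil.
  by rewrite big_nil /Rintegral integral0.
split; first by under eq_fun do rewrite big_cons; exact: itgD.
under eq_Rintegral do rewrite big_cons.
rewrite big_cons -IH2; exact: (RintegralD measurableT (iF i) IH1).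
Qed.

(** Near the ball of radius [s] the function coincides with its product with the
    indicator of the ball of radius [s + 1], which is integrable. *)
Lemma bounded_shift_cont psi (M s e : R) : measurable_fun setT psi ->
  (forall x, `|psi x| <= M) -> 0 < e ->
  exists2 d : R, 0 < d & forall h, enorm h < d ->
    (L1 (fun x => (psi (x + h) - psi x) * \1_(eball 0 s) x)%R <= e%:E)%E.
Proof.
move=> mp pM e0.
pose f x := psi x * \1_(eball 0 (s + 1)) x.
have mI r : measurable_fun setT (\1_(eball (0 : 'rV[R]_n) r) : _ -> R).
  by apply: measurable_indic; exact: measurable_eball.
have mf : measurable_fun setT f by exact: measurable_funM.
have f0 x : ~ eball 0 (s + 1) x -> f x = 0.
  by move=> xs; rewrite /f indicE memNset// mulr0.
have itf : itg f.
  apply: (@itg_bounded_support _ _ _ M (s + 1)) => // x.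
  rewrite /f indicE; case: (_ \in _); rewrite ?mulr1// mulr0 normr0.
  exact: le_trans (pM 0).
have [d d0 dP] := L1_shift_cont_integrable itf f0 e0.
exists (Num.min d 1); first by rewrite lt_min d0 ltr01.
move=> h; rewrite lt_min => /andP[hd h1]; apply: le_trans (dP h hd).
apply: L1_le.
- apply: measurable_funM => //; apply: measurable_funB => //.
  exact: measurable_comp_shift.
- by apply: measurable_funB => //; exact: measurable_comp_shift.
move=> x; rewrite [X in X <= _]normrM [\1__ x]indicE.
case: (boolP (x \in _)) => [|_]; last by rewrite normr0 mulr0.
rewrite inE /eball/= subr0 normr1 mulr1 => xs.
rewrite /f !indicE !mem_set ?mulr1//; rewrite /eball/= subr0.
  by rewrite (lt_trans xs)// ltrDl.
by rewrite (le_lt_trans (ler_enormD _ _))// ltrD.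
Qed.

(** The increments [u (x + h) - u x] and [V (x + h) - V x] again solve the equation
    in a smaller ball. Testing it with the increment of [u] times a cutoff [eta]
    bounds the integral of [eta * sigma (|Dt (x + h) - Dt x|)] by that of
    [|V (x + h) - V x| * |u (x + h) - u x|] times the gradient of [eta]. The second
    factor is at most [L |h|] and the first tends to 0 in mean with [h]: this
    makes the bound [o(|h|)] instead of [O(|h|)], and is the heart of the proof. *)
Lemma translation_estimate (sigma : R -> R) (Dt V : 'rV[R]_n -> 'rV[R]_n) u
    (L M s e : R) : (0 < n)%N -> 0 <= L -> 0 < s -> s < 1 -> 0 < e ->
  (forall i, measurable_fun setT (fun x => Dt x 0 i)) ->
  (forall i x, `|Dt x 0 i| <= M) ->
  (forall i, measurable_fun setT (fun x => V x 0 i)) ->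
  (forall i x, `|V x 0 i| <= M) ->
  (forall phi, test_function (eball 0 1) phi ->
    \sum_(i < n) \int[mu]_x (V x 0 i * 'D_('e_i) phi x) = 0) ->
  itg u -> L1_shift_cont u ->
  (forall y z, eball 0 1 y -> eball 0 1 z -> `|u y - u z| <= L * enorm (y - z)) ->
  (forall i, weak_partial (eball 0 1) i u (fun x => Dt x 0 i * \1_(eball 0 1) x)) ->
  (forall x y, 0 <= sigma (enorm (x - y))) ->
  (forall x y, sigma (enorm (Dt x - Dt y)) <= dotv (V x - V y) (Dt x - Dt y)) ->
  (forall h, measurable_fun setT (fun x => sigma (enorm (Dt (x + h) - Dt x)))) ->
  exists2 d : R, 0 < d & forall h, enorm h < d ->
    (\int[mu]_(x in eball 0 s) (sigma (enorm (Dt (x + h) - Dt x)))%:E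
      <= (e * enorm h)%:E)%E.
Proof.
move=> n0 L0 s0 s1 e0 mDt DtM mV VM divV iu cu uL wu sg0 sgV msg.
(* The cutoff lives in the ball of radius [t]; translations by less than [d0]
   map the ball of radius [t + d0] into the unit ball. *)
pose t := (1 + s) / 2; pose d0 := (1 - t) / 2.
have st : s < t by rewrite /t; lra.
have t1 : t < 1 by rewrite /t; lra.
have d00 : 0 < d0 by rewrite /d0; lra.
have t0 : 0 < t by exact: lt_trans st.
pose eta : 'rV[R]_n -> R := cutoff t.
have teta : test_function [set x | enorm x <= t] eta.
  apply: (@compact_support_test _ _ eta t).
  - exact: smooth_cutoff.
  - by move=> x cx; apply: ltW; exact: cutoff_neq0.
  - by [].
have [A A0 etaA] := test_function_bounded teta.
have tD i := test_function_derive i teta.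
have /choice[B_ B_P] i : exists B : R, 0 <= B /\ forall x, `|'D_('e_i) eta x| <= B.
  by have [B B0 BP] := test_function_bounded (tD i); exists B.
(* A lower bound of the cutoff on the ball of radius [s]. *)
pose c := flatexp 1 (t ^+ 2 - s ^+ 2).
have c0 : 0 < c by rewrite flatexp1_gt0; nra.
pose C := (\sum_(i < n) B_ i) * L.
have C0 : 0 <= C by rewrite mulr_ge0// sumr_ge0// => i _; case: (B_P i).
have C1 : 0 < C + 1 by rewrite ltr_wpDl.
have ec : 0 < c * e / (C + 1) by rewrite divr_gt0// mulr_gt0.
have /choice[d_ d_P] i : exists d : R, 0 < d /\ forall h, enorm h < d ->
    (L1 (fun x => (V (x + h) 0 i - V x 0 i) * \1_(eball 0 1) x)%R
      <= (c * e / (C + 1))%:E)%E.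
  by have [d ? ?] := bounded_shift_cont 1 (mV i) (VM i) ec; exists d.
pose d := Num.min d0 (\big[Num.min/1]_i d_ i).
exists d.
  rewrite lt_min d00; apply/bigmin_gtP; split => [|i _]; first exact: ltr01.
  by have [] := d_P i.
move=> h; rewrite lt_min => /andP[hd0 /bigmin_gtP[_ hd]].
have {}d_P i : (L1 (fun x => (V (x + h) 0 i - V x 0 i) * \1_(eball 0 1) x)%R
      <= (c * e / (C + 1))%:E)%E.
  by have [_] := d_P i; apply; exact: hd.
pose D' : set 'rV[R]_n := eball 0 (t + d0).
have D'D : D' `<=` eball 0 1.
  by move=> x; rewrite /D' /eball/= subr0 => xd; apply: lt_trans xd _; rewrite /d0; lra.
have D'h x : D' x -> eball 0 1 (x + h).
  rewrite /D' /eball/= !subr0 => xd; apply: le_lt_trans (ler_enormD _ _) _.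
  apply: lt_le_trans (ltrD xd hd0) _; rewrite /d0; lra.
pose g_ i x := Dt x 0 i * \1_(eball 0 1) x.
have mI : measurable_fun setT (\1_(eball (0 : 'rV[R]_n) 1) : _ -> R).
  by apply: measurable_indic; exact: measurable_eball.
have g_0 i x : ~ eball 0 1 x -> g_ i x = 0.
  by move=> xs; rewrite /g_ indicE memNset// mulr0.
have ig i : itg (g_ i).
  apply: (@itg_bounded_support _ _ _ M 1) => [|x|x]; last exact: g_0.
    exact: measurable_funM.
  rewrite /g_ indicE; case: (_ \in _); rewrite ?mulr1// mulr0 normr0.
  exact: le_trans (DtM i 0).
have cg i : L1_shift_cont (g_ i).
  exact: L1_shift_cont_integrable (ig i) (g_0 i).
pose Vh x := V (x + h) - V x.
pose uh x := u (x + h) - u x.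
pose gh i x := g_ i (x + h) - g_ i x.
have mVh i : measurable_fun setT (fun x => Vh x 0 i).
  under eq_fun do rewrite !mxE.
  apply: measurable_funB => //.
  exact: (measurable_comp_shift h (mV i)).
have VhM i x : `|Vh x 0 i| <= M + M.
  by rewrite !mxE; apply: le_trans (ler_normB _ _) _; exact: lerD.
have mu_ := itg_measurable iu.
have iuh : itg uh by apply: itgB => //; exact: itg_shift.
have cuh : L1_shift_cont uh.
  apply: L1_shift_contB => //; first exact: measurable_comp_shift.
  exact: L1_shift_cont_shift.
have igh i : itg (gh i) by apply: itgB => //; exact: itg_shift.
have cgh i : L1_shift_cont (gh i).
  have mg := itg_measurable (ig i).
  apply: L1_shift_contB => //; first exact: measurable_comp_shift.
  exact: L1_shift_cont_shift.
have td : t < t + d0 by rewrite ltrDl.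
have divVh := div_free_shiftB mV VM divV D'D D'h.
have wuh i := weak_partial_shiftB iu (ig i) (wu i) D'D D'h.
have rule := weak_product_rule n0 td mVh VhM divVh iuh cuh igh cgh wuh teta.
have B_0 i : 0 <= B_ i by case: (B_P i).
have iVe i : itg (fun x => Vh x 0 i * eta x * gh i x).
  apply: (@itgMb _ _ (fun x => Vh x 0 i * eta x) (gh i) ((M + M) * A)) => // [|x].
    by apply: measurable_funM => //; apply: measurable_smooth; case: teta.
  by rewrite normrM ler_pM.
have second i : `|\int[mu]_x (Vh x 0 i * 'D_('e_i) eta x * uh x)| <=
    B_ i * L * enorm h * (c * e / (C + 1)).
  apply: Rintegral_le_L1.
    apply: measurable_funM; last exact: itg_measurable.
    by apply: measurable_funM => //; apply: measurable_smooth; case: (tD i).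
  pose k x := (B_ i * L * enorm h) * ((V (x + h) 0 i - V x 0 i) * \1_(eball 0 1) x).
  have mk : measurable_fun setT
      (fun x => (V (x + h) 0 i - V x 0 i) * \1_(eball 0 1) x).
    apply: measurable_funM => //.
    by apply: measurable_funB => //; exact: (measurable_comp_shift h (mV i)).
  have BLh : 0 <= B_ i * L * enorm h by rewrite !mulr_ge0// enorm_ge0.
  apply: (@le_trans _ _ (L1 k)).
    apply: L1_le.
    - apply: measurable_funM; last exact: itg_measurable.
      by apply: measurable_funM => //; apply: measurable_smooth; case: (tD i).
    - exact: measurable_funM.
    move=> x; rewrite /k [in leRHS]normrM (ger0_norm BLh).
    have [->|dx] := eqVneq ('D_('e_i) eta x) 0.
      by rewrite mulr0 mul0r normr0 mulr_ge0.
    have xt : enorm x <= t by have := test_function_neq0 (tD i) dx.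
    have xD' : D' x by rewrite /D' /eball/= subr0 (le_lt_trans xt).
    rewrite indicE mem_set ?mulr1; last exact: D'D.
    rewrite !mxE !normrM -mulrA mulrC ler_wpM2r// -mulrA.
    apply: ler_pM => //; first by case: (B_P i).
    have := uL _ _ (D'h _ xD') (D'D _ xD').
    by rewrite addrAC subrr add0r.
  rewrite /k L1Z// (ger0_norm BLh).
  by apply: le_trans (lee_wpmul2l _ (d_P i)) _; rewrite ?lee_fin.
have first_le : \sum_(i < n) \int[mu]_x (Vh x 0 i * eta x * gh i x) <=
    c * (e * enorm h).
  move: rule; rewrite big_split/= => /eqP; rewrite addr_eq0 => /eqP ->.
  apply: le_trans (ler_norm _) _; rewrite normrN.
  apply: le_trans (ler_norm_sum _ _ _) _.
  apply: le_trans (ler_sum _ (fun i _ => second i)) _.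
  rewrite -!mulr_suml -/C.
  rewrite [leLHS](_ : _ = (C / (C + 1)) * (c * (e * enorm h))); last by ring.
  rewrite ler_piMl ?mulr_ge0 ?enorm_ge0 ?ltW//.
  by rewrite ltr_pdivrMr// mul1r ltrDl.
have etas x : eball 0 s x -> c <= eta x.
  by rewrite /eball/= subr0 => /ltW xs; exact: cutoff_ge.
pose S x := sigma (enorm (Dt (x + h) - Dt x)).
have point x : c * (S x * \1_(eball 0 s) x) <= \sum_(i < n) Vh x 0 i * eta x * gh i x.
  have [ex|ex] := eqVneq (eta x) 0.
    rewrite [leRHS]big1 => [|i _]; last by rewrite ex mulr0 mul0r.
    rewrite indicE; case: (boolP (x \in _)) => [|_]; last by rewrite !mulr0.
    by rewrite inE => /etas; rewrite ex leNgt c0.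
  have xt : enorm x <= t by exact: test_function_neq0 teta ex.
  have xD' : D' x by rewrite /D' /eball/= subr0 (le_lt_trans xt).
  rewrite (_ : \sum_(i < n) _ = eta x * dotv (Vh x) (Dt (x + h) - Dt x)); last first.
    rewrite /dotv mulr_sumr; apply: eq_bigr => i _.
    rewrite /gh /g_ !indicE !mem_set ?mulr1; [|exact: D'D|exact: D'h].
    by rewrite !mxE; ring.
  apply: (@le_trans _ _ (eta x * S x)); last first.
    by rewrite ler_wpM2l// ?cutoff_ge0//; exact: sgV.
  have S0 : 0 <= S x by exact: sg0.
  rewrite indicE; case: (boolP (x \in _)) => [|_].
    by rewrite inE mulr1 => /etas ce; rewrite ler_wpM2r.
  by rewrite !mulr0 mulr_ge0// cutoff_ge0.
have [isum sumE] := Rintegral_sum (index_enum 'I_n) iVe.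
have S1_ge0 x : 0 <= S x * \1_(eball 0 s) x by rewrite mulr_ge0//; exact: sg0.
have mS1 : measurable_fun setT (fun x => S x * \1_(eball 0 s) x).
  apply: measurable_funM; first exact: msg.
  by apply: measurable_indic; exact: measurable_eball.
rewrite integral_mkcond.
have -> : (\int[mu]_x ((fun x => (S x)%:E) \_ (eball 0 s)) x =
    \int[mu]_x (S x * \1_(eball 0 s) x)%:E)%E.
  apply: eq_integral => x _; rewrite patchE indicE.
  by case: (_ \in _); rewrite ?mulr1 ?mulr0.
rewrite -(@lee_pmul2l _ c%:E) ?lte_fin// -EFinM.
have mES1 : measurable_fun setT (fun x => (S x * \1_(eball 0 s) x)%:E).
  exact/measurable_EFinP.
have cE : (0 <= c%:E)%E by rewrite lee_fin ltW.
rewrite -ge0_integralZl//; last by move=> x _; rewrite lee_fin.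
apply: (@le_trans _ _ (\int[mu]_x (\sum_(i < n) Vh x 0 i * eta x * gh i x)%:E)%E).
  apply: ge0_le_integral => //.
  - by move=> x _; rewrite -EFinM lee_fin mulr_ge0// ltW.
  - by apply: measurable_funeM; exact/measurable_EFinP.
  - by apply/measurable_EFinP; exact: itg_measurable.
  - by move=> x _; rewrite -EFinM lee_fin; exact: point.
rewrite -[leLHS]fineK; last exact: integrable_fin_num.
by rewrite lee_fin -[fine _]/(\int[mu]_x _) sumE.
Qed.

End translation_estimate.

(** * Integrals and null sets *)

Section null_sets.
Context d (T : measurableType d) (R : realType) (mu : {measure set T -> \bar R}).
Import HBNNSimple.

(** The integral of a nonnegative function, measurable or not, is the supremum of
    the integrals of the simple functions below it, and these can be cut to 0 on
    a null set. This matters for [G \o Du]: on the null set where [Du] leaves its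
    essential range, [G] is arbitrary. *)
Lemma ge0_le_integral_off_null (N : set T) (f g : T -> \bar R) :
  measurable N -> mu N = 0%E -> (forall x, 0 <= f x)%E -> (forall x, 0 <= g x)%E ->
  (forall x, ~ N x -> f x <= g x)%E ->
  (\int[mu]_x f x <= \int[mu]_x g x)%E.
Proof.
move=> mN N0 f0 g0 fg; rewrite !ge0_integralTE//.
apply: ge_ereal_sup => _ [h /= hf <-]; apply: ereal_sup_ubound.
have mC : measurable (~` N) by exact: measurableC.
exists (proj_nnsfun h mC) => /=.
  move=> x; rewrite mindicE; have [Nx|Nx] := boolP (x \in ~` N).
    rewrite mulr1; apply: le_trans (hf x) _; apply: fg.
    by rewrite inE in Nx.
  by rewrite mulr0.
have mh : measurable_fun setT (fun x => (h x)%:E) by exact/measurable_EFinP.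
have h0 x : setT x -> (0 <= (h x)%:E)%E by rewrite lee_fin.
have := ge0_negligible_integral mN measurableT mh h0 N0.
rewrite setTD !integral_nnsfun// patch_setT => ->.
by rewrite mrestrict.
Qed.

Lemma ge0_integral_off_null (N : set T) (f g : T -> \bar R) :
  measurable N -> mu N = 0%E -> (forall x, 0 <= f x)%E -> (forall x, 0 <= g x)%E ->
  (forall x, ~ N x -> f x = g x)%E ->
  (\int[mu]_x f x = \int[mu]_x g x)%E.
Proof.
move=> mN N0 f0 g0 fg; apply/eqP; rewrite eq_le; apply/andP.
by split; apply: (ge0_le_integral_off_null mN N0) => // x /fg ->.
Qed.

Lemma integral_off_null (N : set T) (f g : T -> \bar R) :
  mu.-negligible N -> (forall x, ~ N x -> f x = g x)%E ->
  (\int[mu]_x f x = \int[mu]_x g x)%E.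
Proof.
move=> [N' [mN N0 NN']] fg; rewrite integralE [RHS]integralE; congr (_ - _)%E.
  apply: (ge0_integral_off_null mN N0) => // x N'x.
  by rewrite unlock fg// => /NN'.
apply: (ge0_integral_off_null mN N0) => // x N'x.
by rewrite unlock fg// => /NN'.
Qed.

End null_sets.

(** * The essential range *)

Section essential_range.
Context {R : realType} {n : nat}.
Notation mu := (lebesgue_rV n).
Implicit Types (f : 'rV[R]_n -> 'rV[R]_n) (D : set 'rV[R]_n).

(** The balls with a rational centre and radius [1/(k+1)] form a countable
    basis. *)
Let rball (p : 'rV[rat]_n * nat) : set 'rV[R]_n :=
  ball (map_mx ratr p.1 : 'rV[R]_n) p.2.+1%:R^-1.

Let rball_open (U : set 'rV[R]_n) x : open U -> U x ->
  exists p, rball p x /\ rball p `<=` U.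
Proof.
move=> oU Ux.
have /nbhs_ballP[e /= e0 xeU] := open_nbhs_nbhs (conj oU Ux).
have [k ke] : exists k : nat, k.+1%:R^-1 < e / 2 :> R.
  have [k] := ltr_add_invr (divr_gt0 e0 (ltr0Sn R 1) : 0 < e / 2).
  by rewrite add0r; exists k.
have /choice[q xq] i : exists q : rat, `|x 0 i - ratr q| < k.+1%:R^-1.
  have /rat_in_itvoo[q] : x 0 i - k.+1%:R^-1 < x 0 i + k.+1%:R^-1.
    by rewrite ltrD2l gtrN.
  by rewrite in_itv/= -ltr_distlC => ?; exists q.
have xk : rball (\row_i q i, k) x.
  by split => // i j; rewrite ord1 /ball/= !mxE distrC.
exists (\row_i q i, k); split => // y cy; apply: xeU.
apply: le_ball (ball_triangle (ball_sym xk) cy).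
by rewrite [leRHS](splitr e) lerD// ltW.
Qed.

(** Every point outside the essential range lies in a rational ball that [f] avoids
    almost everywhere, and there are countably many of these. *)
Lemma ess_range_ae D f :
  mu.-negligible [set x | D x /\ ~ ess_range D f (f x)].
Proof.
pose F (k : nat) : set 'rV[R]_n := if unpickle k is Some p then
    if `[< mu.-negligible [set x | D x /\ rball p (f x)] >]
    then [set x | D x /\ rball p (f x)] else set0
  else set0.
apply: (@negligibleS _ _ _ _ (\bigcup_k F k)); last first.
  apply: negligible_bigcup => k; rewrite /F.
  case: (unpickle k) => [p|]; last exact: negligible_set0.
  by case: asboolP => // _; exact: negligible_set0.
move=> x [Dx /existsNP[C /not_implyP[[cC aeC] Cfx]]].
have [p [pf pC]] := rball_open (closed_openC cC) Cfx.
exists (pickle p) => //; rewrite /F pickleK; case: asboolP => // -[].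
apply: negligibleS aeC => y [Dy py] /= H.
exact: pC py (H Dy).
Qed.

Lemma closed_ess_range D f : closed (ess_range D f).
Proof. by apply: closed_bigI => C [cC _]. Qed.

Lemma ess_range_sub D f C : closed C ->
  mu.-negligible [set x | D x /\ ~ C (f x)] -> ess_range D f `<=` C.
Proof.
move=> cC nC y; apply; split => //.
by apply: negligibleS nC => x /= /not_implyP.
Qed.

End essential_range.

(** * Bounds for the weak gradient *)

Section representative.
Context {R : realType} {n : nat}.
Notation mu := (lebesgue_rV n).
Notation B1 := (eball (0 : 'rV[R]_n) 1).
Implicit Types (f g phi psi u : 'rV[R]_n -> R) (x y z v h : 'rV[R]_n)
  (D : set 'rV[R]_n).

Lemma test_function_eq0 D phi x : test_function D phi -> ~ D x -> phi x = 0.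
Proof.
move=> tphi Dx; apply/eqP; apply: contrapT => /negP px.
by apply: Dx; exact: test_function_neq0 tphi px.
Qed.

Lemma weak_gradient_partial D D' u (Du : 'rV[R]_n -> 'rV[R]_n) i f g N :
  weak_gradient D u Du -> D' `<=` D -> (forall x, D x -> f x = u x) ->
  mu.-negligible N -> (forall x, D' x -> ~ N x -> g x = Du x 0 i) ->
  weak_partial D' i f g.
Proof.
move=> wg D'D fu N0 gDu phi tphi.
have tphiD := test_function_subset D'D tphi.
have tD := test_function_derive i tphiD.
have [_ /(_ _ tphiD)] := wg i.
rewrite integral_mkcond [X in _ = (- X)%E -> _]integral_mkcond.
have -> : (\int[mu]_x ((fun x => (u x * 'D_('e_i) phi x)%:E) \_ D) x =
    \int[mu]_x (f x * 'D_('e_i) phi x)%:E)%E.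
  apply: eq_integral => x _; rewrite patchE; case: ifPn => xD.
    by rewrite fu//; rewrite inE in xD.
  by rewrite (test_function_eq0 tD) ?mulr0//; rewrite notin_setE in xD.
have -> : (\int[mu]_x ((fun x => (Du x 0 i * phi x)%:E) \_ D) x =
    \int[mu]_x (g x * phi x)%:E)%E.
  apply: (integral_off_null N0) => x Nx; rewrite patchE.
  have [xD'|xD'] := pselect (D' x).
    by rewrite gDu// mem_set//; exact: D'D.
  by rewrite (test_function_eq0 tphi xD') !mulr0; case: ifP.
by rewrite /Rintegral => ->; rewrite fineN.
Qed.

Lemma weakly_div_free_sum D (F V : 'rV[R]_n -> 'rV[R]_n) (M : R) N :
  weakly_div_free D F -> mu.-negligible N ->
  (forall x, D x -> ~ N x -> V x = F x) ->
  (forall i, measurable_fun setT (fun x => V x 0 i)) ->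
  (forall i x, `|V x 0 i| <= M) ->
  forall phi, test_function D phi ->
    \sum_(i < n) \int[mu]_x (V x 0 i * 'D_('e_i) phi x) = 0.
Proof.
move=> dF N0 VF mV VM phi tphi.
have tD i := test_function_derive i tphi.
have iV i := bounded_itgM_test (mV i) (VM i) (tD i).
have [_ <-] := Rintegral_sum (index_enum 'I_n) iV.
have := dF _ tphi; rewrite integral_mkcond.
have -> : (\int[mu]_x ((fun x => (dotv (F x) (grad phi x))%:E) \_ D) x =
    \int[mu]_x (\sum_(i < n) V x 0 i * 'D_('e_i) phi x)%:E)%E.
  apply: (integral_off_null N0) => x Nx; rewrite patchE; case: ifPn => xD.
    rewrite inE in xD; rewrite -VF//; congr EFin; apply: eq_bigr => i _.
    by rewrite mxE.
  rewrite notin_setE in xD; rewrite big1// => i _.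
  by rewrite (test_function_eq0 (tD i) xD) mulr0.
by rewrite /Rintegral => ->.
Qed.

Lemma eball_bigcup : B1 = \bigcup_k [set x : 'rV[R]_n | enorm x <= 1 - k.+1%:R^-1].
Proof.
apply/seteqP; split => [x|x [k _] /= xk]; rewrite /eball/= subr0.
  rewrite -subr_gt0 => /ltr_add_invr[k]; rewrite add0r => kx.
  by exists k => //=; move: kx; rewrite ltrBrDl -ltrBrDr => /ltW.
by apply: le_lt_trans xk _; rewrite ltrBlDr ltrDl.
Qed.

Lemma measurable_weak_gradient u (Du : 'rV[R]_n -> 'rV[R]_n) i :
  weak_gradient B1 u Du -> measurable_fun B1 (fun x => Du x 0 i).
Proof.
move=> /(_ i)[iK _]; rewrite eball_bigcup; apply/measurable_fun_bigcup.
  by move=> k; apply: measurable_closed; exact: closed_enorm_le.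
move=> k; pose K := [set x : 'rV[R]_n | enorm x <= 1 - k.+1%:R^-1].
have KB : K `<=` B1 by rewrite eball_bigcup => x xK; exists k.
by have /integrableP[/measurable_EFinP] := iK K (@compact_enorm_le R n _) KB.
Qed.

Lemma measurable_lipschitz u (L : R) : 0 <= L ->
  (forall y z, B1 y -> B1 z -> `|u y - u z| <= L * enorm (y - z)) ->
  measurable_fun B1 u.
Proof.
move=> L0 uL; apply: (measurability _ (RGenOpens.measurableE R)).
move=> _ [_ [a [b ->]] <-]; apply: measurable_open.
rewrite openE => x [xB ux].
have /nbhs_ballP[e /= e0 eab] : nbhs (u x) (`]a, b[%classic : set R).
  by apply: open_nbhs_nbhs; split => //; exact: interval_open.
have L1 : 0 < L + 1 by rewrite ltr_wpDl.
have nB : nbhs x (B1 `&` eball x (e / (L + 1))).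
  apply: filterI; last by apply: nbhs_eball_center; rewrite divr_gt0.
  by apply: open_nbhs_nbhs; split => //; exact: eball_open.
apply: filterS nB => y [yB yx]; split => //; apply: eab.
rewrite /ball/=; apply: le_lt_trans (uL _ _ xB yB) _.
move: yx; rewrite /eball/= enormC ltr_pdivlMr// => yx.
apply: le_lt_trans yx; rewrite mulrC ler_wpM2l ?enorm_ge0//.
by rewrite lerDl.
Qed.

Lemma itg_lipschitz u (L : R) : (0 < n)%N -> 0 <= L ->
  (forall y z, B1 y -> B1 z -> `|u y - u z| <= L * enorm (y - z)) ->
  itg (fun x => u x * \1_B1 x).
Proof.
move=> n0 L0 uL.
apply: (@itg_bounded_support _ _ _ (`|u 0| + L) 1).
- rewrite (_ : (fun x => _) = u \_ B1).
    apply/(measurable_restrictT _ _).1; first exact: measurable_eball.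
    exact: measurable_lipschitz L0 uL.
  by apply/funext => x; rewrite patchE indicE; case: ifP; rewrite ?mulr1 ?mulr0.
- move=> x; rewrite indicE; case: (boolP (x \in _)) => [|_]; last first.
    by rewrite mulr0 normr0 addr_ge0.
  rewrite inE mulr1 => xB; rewrite -[u x](subrK (u 0)) addrC.
  apply: le_trans (ler_normD _ _) _; rewrite lerD2l.
  apply: le_trans (uL _ _ xB (eball_center _ ltr01)) _.
  by move: xB; rewrite /eball/= !subr0 => /ltW x1; rewrite ler_piMr.
- by move=> x xB; rewrite indicE memNset// mulr0.
Qed.

(** On each smaller ball the gradient is integrable, so that it can be cut off and
    compared with the mollifications of [u]; the balls of radius [1 - 1/(k+1)]
    exhaust the unit ball. *)
Lemma weak_gradient_bounded u (Du : 'rV[R]_n -> 'rV[R]_n) (L : R) : (0 < n)%N ->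
  0 <= L -> (forall y z, B1 y -> B1 z -> `|u y - u z| <= L * enorm (y - z)) ->
  weak_gradient B1 u Du ->
  forall i v, ess_range B1 Du v -> `|v 0 i| <= L + 1.
Proof.
move=> n0 L0 uL wg i.
apply: (@ess_range_sub _ _ B1 Du [set v | `|v 0 i| <= L + 1]).
  apply: (@preimage_closed _ _ (fun v : 'rV[R]_n => `|v 0 i|) [set t | t <= L + 1]).
    move=> x _; apply: (@continuous_comp _ _ _ (fun v : 'rV[R]_n => v 0 i) Num.norm).
      exact: continuous_coord.
    exact: norm_continuous.
  exact: closed_le.
pose t_ (k : nat) : R := 1 - k.+1%:R^-1.
apply: (@negligibleS _ _ _ _ (\bigcup_k [set x | eball 0 (t_ k) x /\
    L + 1 < `|Du x 0 i|])).
  move=> x [xB /= /negP]; rewrite -ltNge => Lx.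
  move: xB; rewrite /eball/= subr0 -subr_gt0 => /ltr_add_invr[k]; rewrite add0r => kx.
  exists k => //; split => //; rewrite /eball/= subr0.
  by move: kx; rewrite ltrBrDl -ltrBrDr.
apply: negligible_bigcup => k.
pose s := (1 + t_ k) / 2.
have t1 : t_ k < 1 by rewrite /t_ ltrBlDr ltrDl.
have ts : t_ k < s by rewrite /s; lra.
have s1 : s < 1 by rewrite /s; lra.
pose K := [set x : 'rV[R]_n | enorm x <= s].
have mK : measurable K by apply: measurable_closed; exact: closed_enorm_le.
have KB : K `<=` B1 by move=> x /= xs; rewrite /eball/= subr0 (le_lt_trans xs).
have [iK _] := wg i.
pose g x := Du x 0 i * \1_K x.
have ig : itg g.
  have /(integrable_mkcond _ mK).1 := iK _ (@compact_enorm_le R n _) KB.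
  rewrite (_ : _ \_ K = EFin \o g)//; apply/funext => x.
  by rewrite patchE /g /= indicE; case: ifP; rewrite ?mulr1 ?mulr0.
have g0 x : ~ eball 0 1 x -> g x = 0.
  by move=> xB; rewrite /g indicE memNset ?mulr0// => /KB.
have cg := L1_shift_cont_integrable ig g0.
have iu := itg_lipschitz n0 L0 uL.
have sB : eball (0 : 'rV[R]_n) s `<=` B1.
  by move=> x; rewrite /eball/= subr0 => xs; exact: lt_trans xs s1.
have sK x : eball 0 s x -> K x by rewrite /eball/= subr0 => /ltW.
have wp : weak_partial (eball 0 s) i (fun x => u x * \1_B1 x) g.
  apply: (weak_gradient_partial wg sB _ (negligible_set0 _)) => x xs.
    by rewrite indicE mem_set// mulr1.
  by move=> _; rewrite /g indicE mem_set ?mulr1//; exact: sK.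
apply: negligibleS (weak_partial_bounded n0 ts iu ig cg _ wp).
  move=> x [xt Lx]; split => //.
  have Kx : K x by apply: sK; move: xt; rewrite /eball/= => /lt_trans; apply.
  by rewrite /g indicE (mem_set Kx) mulr1; exact: Lx.
move=> y z ys zs; rewrite !indicE !mem_set; [|exact: sB|exact: sB].
by rewrite !mulr1; apply: uL; exact: sB.
Qed.

End representative.

(** * A bounded representative of the gradient *)

Section assembly.
Context {R : realType} {n : nat}.
Notation mu := (lebesgue_rV n).
Notation B1 := (eball (0 : 'rV[R]_n) 1).
Implicit Types (f g phi psi u : 'rV[R]_n -> R) (x y z v h : 'rV[R]_n)
  (D : set 'rV[R]_n).

Lemma measurable_sigma_enorm d (T : measurableType d) (sigma : R -> R)
    (f : T -> 'rV[R]_n) :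
  {within `[0, +oo[, continuous sigma} -> measurable_fun setT f ->
  measurable_fun setT (fun p => sigma (enorm (f p))).
Proof.
move=> cs mf.
apply: (@measurable_comp _ _ _ T (measurableTypeR R) (measurableTypeR R) `[0, +oo[%classic sigma _ (fun p => enorm (f p))).
- exact: measurable_itv.
- by move=> _ [p _ <-]; rewrite /= in_itv/= enorm_ge0.
- by apply: subspace_continuous_measurable_fun => //; exact: measurable_itv.
- apply: (@measurableT_comp _ _ _ _ _ _ (@enorm R n)) => //.
  by apply: measurable_continuous; exact: continuous_enorm.
Qed.

Lemma measurable_coords (f : 'rV[R]_n -> 'rV[R]_n) :
  (forall i, measurable_fun setT (fun x => f x 0 i)) -> measurable_fun setT f.
Proof. by move=> mf; apply: measurable_fun_matrix => i j; rewrite ord1. Qed.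

Lemma ess_range_nonempty (f : 'rV[R]_n -> 'rV[R]_n) : (0 < n)%N ->
  ess_range B1 f !=set0.
Proof.
move=> n0; apply/set0P/eqP => Q0.
have := ess_range_ae B1 f; rewrite Q0 => N0.
have : mu.-negligible B1 by apply: negligibleS N0 => x Bx; split.
have mB : measurable B1 by exact: measurable_eball.
move=> /negligibleP B0; have {}B0 := B0 mB.
have := lebesgue_rV_eball_ge (0 : 'rV[R]_n) n0 ltr01.
rewrite [X in (_ <= X)%E]B0 lee_fin leNgt exprn_gt0//.
by rewrite divr_gt0// ltr0n.
Qed.

(** The preimage of an open set by [G] is the trace on [Q] of an open set, and [f]
    has its values in [Q]. *)
Lemma within_continuous_coord_measurable (Q : set 'rV[R]_n)
    (G f : 'rV[R]_n -> 'rV[R]_n) i : {within Q, continuous G} ->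
  measurable_fun setT f -> (forall x, Q (f x)) ->
  measurable_fun setT (fun x => G (f x) 0 i).
Proof.
move=> cG mf Qf; apply: (measurability _ (RGenOpens.measurableE R)).
move=> _ [_ [a [b ->]] <-]; rewrite setTI.
have cGi : {within Q, continuous (fun v => G v 0 i)}.
  move=> v; apply: (@continuous_comp _ _ _ (G : subspace Q -> _)
    (fun v : 'rV[R]_n => v 0 i)).
    exact: cG.
  exact: continuous_coord.
have oI : open (`]a, b[%classic : set R) by exact: interval_open.
have /open_subspaceP[W oW WQ] : open ((fun v : 'rV[R]_n => G v 0 i) @^-1`
    `]a, b[%classic : set (subspace Q)).
  by move/continuousP : cGi => /(_ _ oI).
rewrite (_ : _ @^-1` _ = f @^-1` W).
  by rewrite -[X in measurable X]setTI; apply: mf => //; exact: measurable_open.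
apply/seteqP; split => x /= Hx.
  have : (W `&` Q) (f x) by rewrite WQ.
  by case.
have : (W `&` Q) (f x) by split.
by rewrite WQ => -[].
Qed.

(** Where [Du] leaves its essential range, a null set, replace it by a fixed point
    of that range. The function [Dt] so obtained is bounded, and [G \o Dt] is
    bounded and measurable because [G] is continuous on the compact essential
    range; the monotonicity of [G] holds between all values of [Dt]. *)
Lemma oscillation_estimate (n_gt0 : (0 < n)%N)
    (u : 'rV[R]_n -> R) (Du : 'rV[R]_n -> 'rV[R]_n)
    (G : 'rV[R]_n -> 'rV[R]_n) (sigma : R -> R) :
  Lip B1 u -> weak_gradient B1 u Du ->
  {within ess_range B1 Du, continuous G} ->
  weakly_div_free B1 (G \o Du) ->
  (forall t : R, 0 <= t -> 0 <= sigma t) ->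
  {within `[0, +oo[, continuous sigma} ->
  (forall a b : 'rV[R]_n, ess_range B1 Du a -> ess_range B1 Du b ->
     sigma (enorm (b - a)) <= dotv (G b - G a) (b - a)) ->
  exists Dt : 'rV[R]_n -> 'rV[R]_n, [/\ measurable_fun setT Dt,
    exists M : R, forall i x, `|Dt x 0 i| <= M,
    mu.-negligible [set x | B1 x /\ Dt x <> Du x] &
    forall s e : R, 0 < s -> s < 1 -> 0 < e ->
    exists2 d : R, 0 < d & forall h, enorm h < d ->
      (\int[mu]_(x in eball 0 s) (sigma (enorm (Dt (x + h)%R - Dt x)))%:E
        <= (e * enorm h)%:E)%E].
Proof.
move=> [L0 uL0] wg cG sol sg0 cs mono.
set Q := ess_range B1 Du in cG mono *.
pose L := `|L0|; have L_ge0 : 0 <= L by exact: normr_ge0.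
have uL y z : B1 y -> B1 z -> `|u y - u z| <= L * enorm (y - z).
  move=> yB zB; apply: le_trans (uL0 _ _ yB zB) _.
  by rewrite ler_wpM2r ?enorm_ge0// ler_norm.
have QM := weak_gradient_bounded n_gt0 L_ge0 uL wg.
have cQ : closed Q by exact: closed_ess_range.
have kQ : compact Q.
  apply: (@subclosed_compact _ _ [set v : 'rV[R]_n | enorm v <= n%:R * (L + 1)]) => //.
    exact: compact_enorm_le.
  by move=> v Qv /=; apply: enorm_coord_le => i; exact: QM.
have [K [_ /(_ (K + 1))]] := compact_bounded (continuous_compact cG kQ).
rewrite ltrDl => /(_ ltr01) GK.
have [p0 Qp0] := ess_range_nonempty Du n_gt0.
have mB : measurable B1 by exact: measurable_eball.
pose Du0 x : 'rV[R]_n := \row_i ((fun x => Du x 0 i) \_ B1) x.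
have mDu0 : measurable_fun setT Du0.
  apply: measurable_coords => i; under eq_fun do rewrite mxE.
  have mDu := @measurable_weak_gradient _ _ u Du i wg.
  exact: ((measurable_restrictT (fun x => Du x 0 i) mB).1 mDu).
have Du0E x : B1 x -> Du0 x = Du x.
  by move=> xB; apply/rowP => i; rewrite mxE patchE mem_set.
pose E := B1 `&` (Du0 @^-1` Q).
have mE : measurable E.
  apply: measurableI => //; rewrite -[X in measurable X]setTI.
  by apply: mDu0 => //; exact: measurable_closed.
pose Dt x := if x \in E then Du0 x else p0.
have QDt x : Q (Dt x).
  by rewrite /Dt; case: ifPn => //; rewrite inE => -[].
have mDti i : measurable_fun setT (fun x => Dt x 0 i).
  rewrite (_ : (fun x => _) =
      (fun x => Du0 x 0 i * \1_E x + p0 0 i * (1 - \1_E x))).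
    have mIE : measurable_fun setT (\1_E : _ -> R) by exact: measurable_indic.
    have mDu0i : measurable_fun setT (fun x => Du0 x 0 i).
      apply: (@measurableT_comp _ _ _ _ _ _ (fun v : 'rV[R]_n => v 0 i)) => //.
      exact: measurable_entry.
    apply: measurable_funD; first exact: measurable_funM.
    by apply: measurable_funM => //; exact: measurable_funB.
  apply/funext => x; rewrite /Dt indicE; case: (x \in E).
    by rewrite subrr mulr0 addr0 mulr1.
  by rewrite mulr0 add0r subr0 mulr1.
have mDt := measurable_coords mDti.
have DtM i x : `|Dt x 0 i| <= L + 1 by exact: QM (QDt x).
have N0 : mu.-negligible [set x | B1 x /\ Dt x <> Du x].
  apply: negligibleS (ess_range_ae B1 Du) => x [xB DtDu]; split => // QDu.
  have xE : x \in E by rewrite inE; split => //=; rewrite Du0E.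
  by apply: DtDu; rewrite /Dt xE Du0E.
have DtDu x : B1 x -> ~ (B1 x /\ Dt x <> Du x) -> Dt x = Du x.
  by move=> xB H; apply: contrapT => H'; apply: H.
pose V x := G (Dt x).
have mV i : measurable_fun setT (fun x => V x 0 i).
  exact: within_continuous_coord_measurable cG mDt QDt.
have VK i x : `|V x 0 i| <= K + 1.
  by apply: le_trans (ler_coord_sup _ _) _; apply: GK; exists (Dt x).
pose M := Num.max (L + 1) (K + 1).
have DtM' i x : `|Dt x 0 i| <= M by rewrite le_max DtM.
have VM i x : `|V x 0 i| <= M by rewrite le_max VK orbT.
have divV := weakly_div_free_sum sol N0
  (fun x xB H => congr1 G (DtDu x xB H)) mV VM.
have iu := itg_lipschitz n_gt0 L_ge0 uL.
have cu : L1_shift_cont (fun x => u x * \1_B1 x).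
  apply: (L1_shift_cont_integrable (K := 1)) => // x xB.
  by rewrite indicE memNset// mulr0.
have uL1 y z : B1 y -> B1 z ->
    `|u y * \1_B1 y - u z * \1_B1 z| <= L * enorm (y - z).
  by move=> yB zB; rewrite !indicE !mem_set// !mulr1; exact: uL.
have wu i : weak_partial B1 i (fun x => u x * \1_B1 x) (fun x => Dt x 0 i * \1_B1 x).
  apply: (weak_gradient_partial wg (@subset_refl _ B1) _ N0) => x xB.
    by rewrite indicE mem_set// mulr1.
  by move=> H; rewrite indicE mem_set// mulr1 DtDu.
exists Dt; split => //; first by exists M.
move=> s e s0 s1 e0.
apply: (@translation_estimate _ _ sigma Dt V (fun x => u x * \1_B1 x) L M) => //.
- by move=> x y; apply: sg0; exact: enorm_ge0.
- by move=> x y; apply: mono.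
- move=> h; apply: (measurable_sigma_enorm cs).
  apply: measurable_coords => i; under eq_fun do rewrite !mxE.
  by apply: measurable_funB => //; exact: (measurable_comp_shift h (mDti i)).
Qed.

End assembly.

(** * Supporting lines *)

Section jensen.
Context {R : realType}.
Variable (sigma : R -> R).
Implicit Types s t v : R.

Lemma convex_function_combination (l t v : R) :
  @convex_function R R^o `[0, +oo[ sigma -> 0 <= l -> l <= 1 -> 0 <= t -> 0 <= v ->
  sigma (l * t + (1 - l) * v) <= l * sigma t + (1 - l) * sigma v.
Proof.
move=> cs l0 l1 t0 v0.
have tI : (t : R^o) \in `[0, +oo[%classic by rewrite inE /= in_itv/= t0.
have vI : (v : R^o) \in `[0, +oo[%classic by rewrite inE /= in_itv/= v0.
by have := cs (Itv01 l0 l1) _ _ tI vI; rewrite !convRE.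
Qed.

(** The right derivative at [s]; it is nonnegative since [sigma] is monotone. *)
Lemma supporting_line s :
  @convex_function R R^o `[0, +oo[ sigma ->
  (forall s t, 0 <= s -> s < t -> sigma s < sigma t) -> 0 <= s ->
  exists2 k : R, 0 <= k & forall t, 0 <= t -> sigma s + k * (t - s) <= sigma t.
Proof.
move=> cs incr s0.
pose slope v := (sigma v - sigma s) / (v - s).
pose S := [set slope v | v in [set v | s < v]].
have slope_ge0 v : s < v -> 0 <= slope v.
  by move=> sv; rewrite divr_ge0 ?subr_ge0 ?ltW// incr.
have S0 : S !=set0 by exists (slope (s + 1)); exists (s + 1) => //=; rewrite ltrDl.
have lbS : has_lbound S by exists 0 => _ [v sv <-]; exact: slope_ge0.
exists (inf S); first by apply: lb_le_inf => // _ [v sv <-]; exact: slope_ge0.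
move=> t t0; have [ts|st|->] := ltgtP t s; last by rewrite subrr mulr0 addr0.
- suff : (sigma s - sigma t) / (s - t) <= inf S.
    rewrite ler_pdivrMr ?subr_gt0//; nra.
  apply: lb_le_inf => // _ [v /= sv <-].
  have tv : 0 < v - t by rewrite subr_gt0 (lt_trans ts).
  rewrite /slope ler_pdivrMr ?subr_gt0// mulrAC ler_pdivlMr ?subr_gt0//.
  pose l := (v - s) / (v - t).
  have l0 : 0 <= l by rewrite divr_ge0 ?subr_ge0 ?ltW// (lt_trans ts).
  have l1 : l <= 1 by rewrite ler_pdivrMr// mul1r lerD2l lerN2 ltW.
  have v0 : 0 <= v by rewrite (le_trans s0)// ltW.
  have := convex_function_combination cs l0 l1 t0 v0.
  have -> : l * t + (1 - l) * v = s by rewrite /l; field; rewrite gt_eqF.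
  have lE : l * (v - t) = v - s by rewrite /l divfK// gt_eqF.
  move=> H; have {}H := ler_wpM2r (ltW tv) H.
  rewrite mulrDl [l * _ * _]mulrAC lE in H.
  have lE' : (1 - l) * (v - t) = s - t by rewrite mulrBl mul1r lE; ring.
  rewrite [(1 - l) * _ * _]mulrAC lE' in H.
  nra.
- have : inf S <= slope t by apply: ge_inf => //; exists t.
  rewrite /slope ler_pdivlMr ?subr_gt0//; lra.
Qed.

End jensen.

(** * Jensen inequality for averages *)

Section mean_oscillation.
Context {R : realType} {n : nat}.
Notation mu := (lebesgue_rV n).
Notation B1 := (eball (0 : 'rV[R]_n) 1).
Implicit Types (x y z v h : 'rV[R]_n) (B D : set 'rV[R]_n)
  (f F : 'rV[R]_n -> 'rV[R]_n).

Lemma integrable_bounded_on B (f : 'rV[R]_n -> R) (M : R) : measurable B ->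
  (mu B < +oo)%E -> measurable_fun setT f -> (forall x, `|f x| <= M) ->
  mu.-integrable B (EFin \o f).
Proof.
move=> mB Boo mf fM; apply: measurable_bounded_integrable => //.
  exact: measurable_funTS.
exists M; split; first exact: num_real.
by move=> K MK x _; apply: le_trans (fM x) (ltW MK).
Qed.

Lemma Rintegral_sum_on (I : Type) (r : seq I) B (G : I -> 'rV[R]_n -> R) :
  measurable B -> (forall i, mu.-integrable B (EFin \o G i)) ->
  mu.-integrable B (EFin \o (fun x => \sum_(i <- r) G i x)) /\
  \int[mu]_(x in B) (\sum_(i <- r) G i x) = \sum_(i <- r) \int[mu]_(x in B) G i x.
Proof.
move=> mB iG; elim: r => [|i r [IH1 IH2]].
  split.
    rewrite (_ : _ \o _ = cst 0%E); first exact: integrable0.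
    by apply/funext => x; rewrite /= big_nil.
  under eq_Rintegral do rewrite big_nil.
  by rewrite big_nil /Rintegral integral0.
split.
  rewrite (_ : _ \o _ = (fun x => (G i x)%:E + (\sum_(j <- r) G j x)%:E)%E).
    exact: (integrableD mB (iG i) IH1).
  by apply/funext => x; rewrite /= big_cons EFinD.
under eq_Rintegral do rewrite big_cons.
rewrite big_cons -IH2; exact: (RintegralD mB (iG i) IH1).
Qed.

(** Pairing with the unit vector in the direction of [a - avgv B F] shows that its
    norm is at most the mean of [|a - F|]. Integrate the supporting line of [sigma]
    at that norm, whose slope is nonnegative. *)
Lemma jensen_avgv (sigma : R -> R) F B a (M : R) :
  {within `[0, +oo[, continuous sigma} ->
  @convex_function R R^o `[0, +oo[ sigma ->
  (forall s t : R, 0 <= s -> s < t -> sigma s < sigma t) ->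
  (forall t : R, 0 <= t -> 0 <= sigma t) ->
  measurable B -> (0 < mu B)%E -> (mu B < +oo)%E ->
  measurable_fun setT F -> (forall i x, `|F x 0 i| <= M) ->
  ((sigma (enorm (a - avgv B F)))%:E <=
   ((fine (mu B))^-1)%:E * \int[mu]_(z in B) (sigma (enorm (a - F z)))%:E)%E.
Proof.
move=> scont scvx sincr sge0 mB B0 Boo mF FM.
set m := fine (mu B).
have m0 : 0 < m by rewrite fine_gt0// B0 Boo.
set A := avgv B F; set e := a - A.
have [k k0 kP] := supporting_line scvx sincr (enorm_ge0 e).
have mFi i : measurable_fun setT (fun x => F x 0 i).
  apply: (@measurableT_comp _ _ _ _ _ _ (fun v : 'rV[R]_n => v 0 i)) => //.
  exact: measurable_entry.
have iF i : mu.-integrable B (EFin \o (fun z => F z 0 i)).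
  exact: integrable_bounded_on (FM i).
pose T z := enorm (a - F z).
have maF : measurable_fun setT (fun z => a - F z).
  apply: measurable_coords => i; under eq_fun do rewrite !mxE.
  by apply: measurable_funB.
have mT : measurable_fun setT T.
  apply: (@measurableT_comp _ _ _ _ _ _ (@enorm R n)) => //.
  by apply: measurable_continuous; exact: continuous_enorm.
have T0 z : 0 <= T z by exact: enorm_ge0.
have TM z : `|T z| <= enorm a + n%:R * M.
  rewrite ger0_norm//; apply: le_trans (ler_enormB _ _) _; rewrite lerD2l.
  exact: enorm_coord_le.
have iT : mu.-integrable B (EFin \o T) by exact: integrable_bounded_on TM.
have icst (c : R) : mu.-integrable B (EFin \o cst c).
  by apply: (@integrable_bounded_on _ (cst c) `|c|) => //; exact: measurable_cst.
have cst_int (c : R) : \int[mu]_(z in B) c = c * m by rewrite Rintegral_cst.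
have avg_le : m * enorm e <= \int[mu]_(z in B) T z.
  have [->|e0] := eqVneq (enorm e) 0.
    by rewrite mulr0; apply: Rintegral_ge0 => z _; exact: T0.
  have e1 : 0 < enorm e by rewrite lt0r e0 enorm_ge0.
  rewrite -(ler_pM2l e1) mulrCA -expr2 enorm_sqr -RintegralZl//.
  have iD i : mu.-integrable B (EFin \o (fun z => a 0 i - F z 0 i)).
    by have := integrableB mB (icst (a 0 i)) (iF i).
  have iE i : mu.-integrable B (EFin \o (fun z => e 0 i * (a 0 i - F z 0 i))).
    by have := integrableZl mB (e 0 i) (iD i).
  have [iS sumE] := Rintegral_sum_on (index_enum 'I_n) mB iE.
  have -> : m * dotv e e = \sum_(i < n) \int[mu]_(z in B) (e 0 i * (a 0 i - F z 0 i)).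
    rewrite /dotv mulr_sumr; apply: eq_bigr => i _.
    rewrite (RintegralZl (e 0 i) mB (iD i)).
    rewrite (RintegralB mB (icst (a 0 i)) (iF i)) cst_int mulrCA.
    suff -> : m * e 0 i = a 0 i * m - \int[mu]_(z in B) F z 0 i by [].
    by rewrite /e /A !mxE mulrBr mulrA divff ?gt_eqF// mul1r mulrC.
  rewrite -sumE; apply: le_Rintegral => //.
    by have := integrableZl mB (enorm e) iT.
  move=> z _; apply: le_trans (ler_dotv_enorm e (a - F z)).
  by apply: ler_sum => i _; rewrite !mxE.
pose S z := sigma (T z).
have mS : measurable_fun setT S by exact: measurable_sigma_enorm.
have S0 z : 0 <= S z by exact: sge0.
have SM z : `|S z| <= sigma (enorm a + n%:R * M + 1).
  rewrite ger0_norm//; apply: ltW; apply: sincr => //.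
  by apply: le_lt_trans (ler_norm _) _; apply: le_lt_trans (TM z) _; rewrite ltrDl.
have iS : mu.-integrable B (EFin \o S) by exact: integrable_bounded_on SM.
have -> : (\int[mu]_(z in B) (sigma (enorm (a - F z)))%:E =
    (\int[mu]_(z in B) S z)%:E)%E.
  by rewrite /Rintegral fineK//; exact: integrable_fin_num.
rewrite -EFinM lee_fin mulrC ler_pdivlMr//.
have iL : mu.-integrable B (EFin \o (fun z => sigma (enorm e) + k * (T z - enorm e))).
  have H := integrableZl mB k (integrableB mB iT (icst (enorm e))).
  by have := integrableD mB (icst (sigma (enorm e))) H.
apply: (@le_trans _ _ (\int[mu]_(z in B) (sigma (enorm e) + k * (T z - enorm e)))).
  have H := integrableB mB iT (icst (enorm e)).
  have H' := integrableZl mB k H.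
  rewrite (RintegralD mB (icst (sigma (enorm e))) H') cst_int lerDl.
  rewrite (RintegralZl k mB H) mulr_ge0// (RintegralB mB iT (icst (enorm e))).
  by rewrite cst_int subr_ge0 mulrC.
by apply: le_Rintegral => // z _; exact: kP.
Qed.

End mean_oscillation.

(** * Mean oscillation and mean increments *)

Section packing.
Context {R : realType} {n : nat}.
Notation mu := (lebesgue_rV n).
Notation B1 := (eball (0 : 'rV[R]_n) 1).
Implicit Types (x y z v h : 'rV[R]_n) (B D : set 'rV[R]_n)
  (Du Dt : 'rV[R]_n -> 'rV[R]_n).

Lemma lebesgue_rV_eball_shift x (r : R) : mu (eball x r) = mu (eball 0 r).
Proof.
rewrite -(lebesgue_rV_shift (- x) (measurable_eball 0 r)).
by congr (mu _); apply/seteqP; split => y; rewrite /eball/= subr0.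
Qed.

Lemma avgv_off_null B Du Dt : measurable B ->
  mu.-negligible [set x | B x /\ Dt x <> Du x] -> avgv B Du = avgv B Dt.
Proof.
move=> mB N0; apply/rowP => i; rewrite !mxE; congr (_ * fine _).
rewrite integral_mkcond [RHS]integral_mkcond; apply: (integral_off_null N0) => x Nx.
rewrite !patchE; case: ifPn => // xB; rewrite inE in xB.
suff -> : Du x = Dt x by [].
by apply: contrapT => H; apply: Nx; split => // /esym.
Qed.

Lemma mean_oscillation_off_null (sigma : R -> R) B Du Dt : measurable B ->
  mu.-negligible [set x | B x /\ Dt x <> Du x] ->
  mean_oscillation sigma Du B = mean_oscillation sigma Dt B.
Proof.
move=> mB N0; rewrite /mean_oscillation (avgv_off_null mB N0).
suff -> : (\int[mu]_(y in B) (sigma (enorm (Du y - avgv B Dt)))%:E =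
    \int[mu]_(y in B) (sigma (enorm (Dt y - avgv B Dt)))%:E)%E by [].
rewrite integral_mkcond [RHS]integral_mkcond; apply: (integral_off_null N0) => x Nx.
rewrite !patchE; case: ifPn => // xB; rewrite inE in xB.
suff -> : Du x = Dt x by [].
by apply: contrapT => H; apply: Nx; split => // /esym.
Qed.

Variables (sigma : R -> R) (Dt : 'rV[R]_n -> 'rV[R]_n).
Hypotheses (scont : {within `[0, +oo[, continuous sigma})
  (scvx : @convex_function R R^o `[0, +oo[ sigma)
  (sincr : forall s t : R, 0 <= s -> s < t -> sigma s < sigma t)
  (sge0 : forall t : R, 0 <= t -> 0 <= sigma t).
Hypotheses (mDt : measurable_fun setT Dt)
  (DtM : exists M : R, forall i x, `|Dt x 0 i| <= M).

Definition increment z h : R := sigma (enorm (Dt (z + h) - Dt z)).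

Lemma increment_ge0 z h : 0 <= increment z h.
Proof. by apply: sge0; exact: enorm_ge0. Qed.

Lemma measurable_increment :
  measurable_fun setT (fun p : 'rV[R]_n * 'rV[R]_n => increment p.1 p.2).
Proof.
apply: (measurable_sigma_enorm scont); apply: measurable_fun_matrix => i j.
under eq_fun do rewrite !mxE.
have mc : measurable_fun setT (fun x => Dt x i j).
  apply: (@measurableT_comp _ _ _ _ _ _ (fun v : 'rV[R]_n => v i j)) => //.
  exact: measurable_entry.
apply: measurable_funB; first exact: (measurableT_comp mc measurable_subT).
exact: (measurableT_comp mc measurable_fst).
Qed.

(** Two points of a ball of radius [r] differ by an increment shorter than
    [2 * r]. *)
Definition increment_near (r : R) z : \bar R :=
  (\int[mu]_h (increment z h * \1_(eball 0 (2 * r)) h)%:E)%E.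

Lemma measurable_increment_cut (r : R) : measurable_fun setT
  (fun p : 'rV[R]_n * 'rV[R]_n =>
    (increment p.1 p.2 * \1_(eball 0 (2 * r)) p.2)%:E).
Proof.
apply/measurable_EFinP; apply: measurable_funM; first exact: measurable_increment.
have mI : measurable_fun setT (\1_(eball (0 : 'rV[R]_n) (2 * r)) : _ -> R).
  by apply: measurable_indic; exact: measurable_eball.
exact: (measurableT_comp mI measurable_snd).
Qed.

Lemma increment_cut_ge0 (r : R) z h :
  (0 <= (increment z h * \1_(eball 0 (2 * r)) h)%:E)%E.
Proof. by rewrite lee_fin mulr_ge0// increment_ge0. Qed.

Lemma measurable_increment_near (r : R) : measurable_fun setT (increment_near r).
Proof.
apply: (@measurable_fun_fubini_tonelli_F _ _ _ _ _ mu
  (fun p : 'rV[R]_n * 'rV[R]_n => (increment p.1 p.2 * \1_(eball 0 (2 * r)) p.2)%:E)).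
  exact: measurable_increment_cut.
by move=> p; exact: increment_cut_ge0.
Qed.

Lemma increment_near_ge0 (r : R) z : (0 <= increment_near r z)%E.
Proof. by apply: integral_ge0 => h _; exact: increment_cut_ge0. Qed.

Lemma integral_ball_le_increment_near x y (r : R) : eball x r y ->
  (\int[mu]_(z in eball x r) (sigma (enorm (Dt y - Dt z)))%:E
    <= increment_near r y)%E.
Proof.
move=> yB; rewrite integral_mkcond.
have -> : (\int[mu]_z ((fun z => (sigma (enorm (Dt y - Dt z)))%:E) \_ (eball x r)) z =
    \int[mu]_z (sigma (enorm (Dt y - Dt z)) * \1_(eball x r) z)%:E)%E.
  apply: eq_integral => z _; rewrite patchE indicE.
  by case: (_ \in _); rewrite ?mulr1 ?mulr0.
pose f z : \bar R := (sigma (enorm (Dt y - Dt z)) * \1_(eball x r) z)%:E.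
have mf : measurable_fun setT f.
  apply/measurable_EFinP; apply: measurable_funM; last first.
    by apply: measurable_indic; exact: measurable_eball.
  apply: (measurable_sigma_enorm scont); apply: measurable_fun_matrix => i j.
  under eq_fun do rewrite !mxE.
  apply: measurable_funB => //.
  apply: (@measurableT_comp _ _ _ _ _ _ (fun v : 'rV[R]_n => v i j)) => //.
  exact: measurable_entry.
have f0 z : (0 <= f z)%E by rewrite lee_fin mulr_ge0// sge0// enorm_ge0.
rewrite -(ge0_integral_shift y mf f0).
apply: ge0_le_integral => //.
- by apply: (measurableT_comp mf); exact: measurable_shift.
- exact: (measurableT_comp (measurable_increment_cut r) (measurable_pair1 y)).
move=> h _; rewrite /f /increment (addrC y) enormC lee_fin.
rewrite ler_wpM2l//; first by apply: sge0; exact: enorm_ge0.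
rewrite !indicE ler_nat; case: (boolP (h + y \in _)) => //.
rewrite inE => hB; rewrite mem_set// /eball/= subr0.
have -> : h = (h + y - x) - (y - x) by rewrite opprB addrA subrK addrK.
apply: le_lt_trans (ler_enormB _ _) _; rewrite mulrC mulr_natr mulr2n.
exact: ltrD.
Qed.

(** Jensen bounds the oscillation by a double average of [sigma (|Dt y - Dt z|)]
    over the ball; writing [z = y + h] and enlarging the domain of [h] makes the
    inner one independent of the ball. *)
Lemma mean_oscillation_le x (r m : R) : (0 < n)%N -> 0 < r ->
  m = fine (mu (eball (0 : 'rV[R]_n) r)) ->
  ((m ^+ 2)%:E * mean_oscillation sigma Dt (eball x r) <=
    \int[mu]_(z in eball x r) increment_near r z)%E.
Proof.
move=> n0 r0 mdef.
have mB : measurable (eball x r) by exact: measurable_eball.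
have Boo : (mu (eball x r) < +oo)%E by exact: lebesgue_rV_eball_fin.
have B0 : (0 < mu (eball x r))%E.
  apply: lt_le_trans (lebesgue_rV_eball_ge x n0 r0).
  by rewrite lte_fin exprn_gt0// divr_gt0// ltr0n.
have mE : fine (mu (eball x r)) = m by rewrite mdef lebesgue_rV_eball_shift.
have m0 : 0 < m by rewrite -mE fine_gt0// B0 Boo.
have [M DM] := DtM.
rewrite /mean_oscillation mE muleA -EFinM expr2 mulfK ?gt_eqF//.
set A := avgv _ _.
have J y : eball x r y ->
    (m%:E * (sigma (enorm (Dt y - A)))%:E <= increment_near r y)%E.
  move=> yB; apply: le_trans (integral_ball_le_increment_near yB).
  have := jensen_avgv (Dt y) scont scvx sincr sge0 mB B0 Boo mDt DM.
  rewrite mE => H; have {}H := lee_wpmul2l (ltW (m0 : (0 < m%:E)%E)) H.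
  apply: le_trans H _; rewrite muleA -EFinM divff ?gt_eqF//.
  by rewrite mul1e.
have mS : measurable_fun (eball x r) (fun y => (sigma (enorm (Dt y - A)))%:E).
  apply: measurable_funTS; apply/measurable_EFinP.
  apply: (measurable_sigma_enorm scont); apply: measurable_fun_matrix => i j.
  under eq_fun do rewrite !mxE.
  apply: measurable_funB => //.
  apply: (@measurableT_comp _ _ _ _ _ _ (fun v : 'rV[R]_n => v i j)) => //.
  exact: measurable_entry.
have S0 y : (0 <= (sigma (enorm (Dt y - A)))%:E)%E by rewrite lee_fin sge0// enorm_ge0.
rewrite -ge0_integralZl//; last by rewrite lee_fin ltW.
apply: ge0_le_integral => //.
- by move=> y _; rewrite mule_ge0// lee_fin ltW.
- exact: measurable_funeM.
- by apply: measurable_funTS; exact: measurable_increment_near.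
Qed.

(** Tonelli: integrate first in [z] with the increment fixed. *)
Lemma integral_increment_near_le (s r e : R) : 0 <= e -> 0 < r ->
  (forall h, enorm h < 2 * r ->
    (\int[mu]_(x in eball 0 s) (increment x h)%:E <= (e * enorm h)%:E)%E) ->
  (\int[mu]_(z in eball 0 s) increment_near r z <=
    (e * (2 * r) * fine (mu (eball (0 : 'rV[R]_n) (2 * r))))%:E)%E.
Proof.
move=> e0 r0 eP.
have ms : measurable (eball (0 : 'rV[R]_n) s) by exact: measurable_eball.
pose F (p : 'rV[R]_n * 'rV[R]_n) : \bar R :=
  (increment p.1 p.2 * \1_(eball 0 (2 * r)) p.2 * \1_(eball 0 s) p.1)%:E.
have mI t : measurable_fun setT (\1_(eball (0 : 'rV[R]_n) t) : _ -> R).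
  by apply: measurable_indic; exact: measurable_eball.
have mF : measurable_fun setT F.
  apply/measurable_EFinP; apply: measurable_funM.
    by apply/measurable_EFinP; exact: measurable_increment_cut.
  exact: (measurableT_comp (mI s) measurable_fst).
have F0 p : (0 <= F p)%E by rewrite lee_fin !mulr_ge0// increment_ge0.
have -> : (\int[mu]_(z in eball 0 s) increment_near r z =
    \int[mu]_z \int[mu]_h F (z, h))%E.
  rewrite integral_mkcond; apply: eq_integral => z _; rewrite patchE.
  case: ifPn => zs.
    by apply: eq_integral => h _; rewrite /F /= [\1__ z]indicE zs mulr1.
  by rewrite integral0_eq// => h _; rewrite /F /= [\1__ z]indicE (negbTE zs) mulr0.
have -> : (\int[mu]_z \int[mu]_h F (z, h) = \int[mu]_h \int[mu]_z F (z, h))%E.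
  exact: fubini_tonelli.
have mS h : measurable_fun setT (fun z => (increment z h)%:E).
  apply/measurable_EFinP.
  exact: (measurableT_comp measurable_increment (measurable_pair2 h)).
apply: (@le_trans _ _ (\int[mu]_h (e * (2 * r) * \1_(eball 0 (2 * r)) h)%:E)%E).
  apply: ge0_le_integral => //.
  - by move=> h _; exact: integral_ge0.
  - exact: measurable_fun_fubini_tonelli_G.
  - by apply/measurable_EFinP; exact: measurable_funM.
  move=> h _; rewrite [X in (_ <= (_ * X)%:E)%E]indicE.
  case: (boolP (h \in _)) => hr; last first.
    rewrite integral0_eq ?mulr0// => z _.
    by rewrite /F /= [\1__ h]indicE (negbTE hr) mulr0 mul0r.
  have {}hr' : enorm h < 2 * r by move: hr; rewrite inE /eball/= subr0.
  apply: (@le_trans _ _ (\int[mu]_(x in eball 0 s) (increment x h)%:E)%E).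
    rewrite [leRHS]integral_mkcond; apply: ge0_le_integral => //.
    - by apply: (measurableT_comp mF); exact: measurable_pair2.
    - exact: ((measurable_restrictT (fun z => (increment z h)%:E) ms).1
        (measurable_funTS (mS h))).
    move=> z _; rewrite /F /= patchE !indicE hr mulr1.
    by case: ifP; rewrite ?mulr1 ?mulr0.
  apply: le_trans (eP _ hr') _; rewrite lee_fin mulr1.
  by rewrite ler_wpM2l// ltW.
under eq_integral do rewrite EFinM.
rewrite ge0_integralZl//; last 2 first.
- by apply/measurable_EFinP; exact: mI.
- by rewrite lee_fin !mulr_ge0// ltW.
rewrite integral_indic // ?setIT; last exact: measurable_eball.
rewrite [leRHS]EFinM fineK//.
by rewrite ge0_fin_numE//; exact: lebesgue_rV_eball_fin.
Qed.

End packing.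

(** * Sets of Hausdorff measure zero *)

Section hausdorff_null.
Context {R : realType} {n : nat}.
Implicit Types (x y : 'rV[R]_n) (A : set 'rV[R]_n) (C : (set 'rV[R]_n)^nat).

Lemma ediam_ge0 A : (0 <= ediam A)%E.
Proof. by apply: ereal_sup_ubound; left. Qed.

Lemma expe_le (a : \bar R) (b : R) k : (0 <= a)%E -> (a <= b%:E)%E ->
  (a ^+ k <= (b ^+ k)%:E)%E.
Proof.
move=> a0 ab; elim: k => [|k IH]; first by rewrite expe0 expr0.
by rewrite expeS exprS EFinM lee_pmul// expe_ge0.
Qed.

Definition cover_weight (s : nat) A : \bar R :=
  (if A == set0 then 0 else ediam A ^+ s)%E.

Lemma cover_weight_ge0 s A : (0 <= cover_weight s A)%E.
Proof. by rewrite /cover_weight; case: ifP => // _; exact/expe_ge0/ediam_ge0. Qed.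

Definition small_cover (s : nat) (delta e : R) A C : Prop :=
  [/\ A `<=` \bigcup_k C k, forall k, (ediam (C k) <= delta%:E)%E &
      (\sum_(0 <= k <oo) cover_weight s (C k) <= e%:E)%E].

Lemma hausdorff0 s A :
  (forall delta e : R, 0 < delta -> 0 < e -> exists C, small_cover s delta e A C) ->
  hausdorff s A = 0%E.
Proof.
move=> cov.
have pre_ge0 delta : (0 <= hausdorff_pre s delta A)%E.
  apply: le_ereal_inf_tmp => _ [C _ <-]; apply: nneseries_ge0 => k _ _.
  exact: cover_weight_ge0.
apply/eqP; rewrite eq_le; apply/andP; split; last first.
  apply: le_trans (pre_ge0 1) _; apply: ereal_sup_ubound.
  by exists 1 => //=; exact: ltr01.
apply: ge_ereal_sup => _ [delta /= d0 <-].
apply/lee_addgt0Pr => e e0; rewrite add0e.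
have [C [AC Cd Ce]] := cov _ _ d0 e0.
by apply: le_trans Ce; apply: ereal_inf_lbound; exists C.
Qed.

(** Cover the [j]-th set with weight [e / 2 ^ j.+1], and enumerate the pairs of
    indices. *)
Lemma small_cover_bigcup s (delta : R) (A : (set 'rV[R]_n)^nat) :
  (forall j (e : R), 0 < e -> exists C, small_cover s delta e (A j) C) ->
  forall e : R, 0 < e -> exists C, small_cover s delta e (\bigcup_j A j) C.
Proof.
move=> cov e e0.
have /choice[G PG] j : exists C, small_cover s delta (e / (2 ^ j.+1)%:R) (A j) C.
  by apply: cov; rewrite divr_gt0.
pose w := cover_weight s \o uncurry G.
have w0 p : (0 <= w p)%E by exact: cover_weight_ge0.
have /card_esym/ppcard_eqP[f] := card_nat2.
exists (uncurry G \o f); split.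
- move=> x [j _ /(let: And3 a _ _ := PG j in a)[k _ Gx]].
  by exists (f^-1%FUN (j, k)) => //=; rewrite invK ?inE.
- by move=> k /=; case: (f k) => j i /=; have [_ H _] := PG j; exact: H.
rewrite -[leLHS]/(\sum_(0 <= k <oo) w (f k))%E.
have -> : (\sum_(0 <= k <oo) w (f k) = \esum_(i in setT) w i)%E.
  rewrite -(esum_pred_image w _ xpredT) ?[fun=> _]set_true//.
  by rewrite image_eq.
have -> : (\esum_(i in setT) w i =
    \sum_(0 <= j <oo) \sum_(0 <= k <oo) w (j, k))%E.
  pose J : nat -> set (nat * nat) := fun i => [set (i, j) | j in setT].
  rewrite (_ : setT = \bigcup_k J k); last first.
    by rewrite predeqE => -[a b]; split => // _; exists a => //; exists b.
  rewrite esum_bigcupT /=; last 2 first.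
    - apply/trivIsetP => i j _ _ ij.
      rewrite predeqE => -[a b] /=; split => //= -[] [_] _ [<-{a} _].
      by move=> [b' _] [] /esym/eqP; rewrite (negbTE ij).
    - by move=> a; exact: w0.
  rewrite -(image_id [set: nat]) -fun_true esum_pred_image//; last first.
    by move=> a _; exact: esum_ge0.
  apply: eq_eseriesr => /= j _.
  rewrite -(esum_pred_image w (pair j) predT)//=; last first.
    by move=> ? ? _ _; exact: (@can_inj _ _ _ snd).
  by congr esum; rewrite predeqE => -[a b]; split; move=> [i _ <-]; exists i.
apply: le_trans (epsilon_trick0 xpredT (ltW e0)).
apply: lee_nneseries => j *; first by apply: nneseries_ge0.
by have [_ _] := PG j.
Qed.

Lemma ediam_eball_le x (r : R) : 0 < r -> (ediam (eball x r) <= (2 * r)%:E)%E.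
Proof.
move=> r0; apply: ge_ereal_sup => _ [->|[y [z [yx zx ->]]]].
  by rewrite lee_fin mulr_ge0// ltW.
rewrite lee_fin mulr_natl mulr2n ltW//.
apply: le_lt_trans (ler_enorm_dist y x z) _; apply: ltrD => //.
by rewrite enormC.
Qed.

Lemma finite_ball_cover s (delta r e : R) A (xs : seq 'rV[R]_n) : 0 < r ->
  A `<=` [set y | exists2 x, x \in xs & eball x r y] -> 2 * r <= delta ->
  (size xs)%:R * (2 * r) ^+ s <= e -> exists C, small_cover s delta e A C.
Proof.
move=> r0 Axs rd se.
pose C (k : nat) : set 'rV[R]_n :=
  if (k < size xs)%N then eball (nth 0 xs k) r else set0.
have rr0 : 0 <= 2 * r by rewrite mulr_ge0// ltW.
exists C; split.
- move=> y /Axs[x xxs xy]; exists (index x xs) => //.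
  by rewrite /C index_mem xxs nth_index.
- move=> k; rewrite /C; case: ifP => _.
    by apply: le_trans (ediam_eball_le _ r0) _; rewrite lee_fin.
  apply: ge_ereal_sup => _ [->|[y [z [//]]]].
  by rewrite lee_fin (le_trans _ rd).
have wC k : (cover_weight s (C k) <=
    (if (k < size xs)%N then (2 * r) ^+ s else 0)%:E)%E.
  rewrite /C; case: ltnP => kxs; last by rewrite /cover_weight eqxx.
  rewrite /cover_weight; case: ifP => _; first by rewrite lee_fin exprn_ge0.
  by apply: expe_le; [exact: ediam_ge0|exact: ediam_eball_le].
have sumM M : \sum_(0 <= k < M) (if (k < size xs)%N then (2 * r) ^+ s else 0) <=
    (size xs)%:R * (2 * r) ^+ s.
  apply: (@le_trans _ _ ((minn M (size xs))%:R * (2 * r) ^+ s)); last first.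
    by rewrite ler_wpM2r ?exprn_ge0// ler_nat geq_minr.
  elim: M => [|M IH]; first by rewrite big_geq// min0n mul0r.
  rewrite big_nat_recr//=; case: ltnP => MN.
    rewrite (minn_idPl MN) -[M.+1%:R]natr1 [leRHS]mulrDl mul1r lerD2r.
    by move: IH; rewrite (minn_idPl (ltnW MN)).
  by rewrite addr0 (minn_idPr (leqW MN)); move: IH; rewrite (minn_idPr MN).
apply: lime_le; first by apply: is_cvg_nneseries => k _ _; exact: cover_weight_ge0.
near=> M; apply: (@le_trans _ _
  (\sum_(0 <= k < M) (if (k < size xs)%N then (2 * r) ^+ s else 0)%:E)%E).
  by apply: lee_sum => k _; exact: wC.
by rewrite sumEFin lee_fin; exact: le_trans (sumM M) se.
Unshelve. all: by end_near. Qed.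

End hausdorff_null.

(** * Packing the points of large oscillation *)

Section bad_set.
Context {R : realType} {n : nat}.
Notation mu := (lebesgue_rV n).
Notation B1 := (eball (0 : 'rV[R]_n) 1).
Implicit Types (x y z v h : 'rV[R]_n) (A : set 'rV[R]_n) (xs : seq 'rV[R]_n).

Definition separated (d : R) : rel 'rV[R]_n := fun x y => d <= enorm (x - y).

Lemma separated_uniq (d : R) xs : 0 < d -> pairwise (separated d) xs -> uniq xs.
Proof.
move=> d0; elim: xs => //= x xs IH /andP[/allP sx /IH ->]; rewrite andbT.
by apply/negP => /sx; rewrite /separated subrr enorm0 leNgt d0.
Qed.

Lemma separated_mem (d : R) xs x y : pairwise (separated d) xs ->
  x \in xs -> y \in xs -> x != y -> separated d x y.
Proof.
elim: xs => //= z xs IH /andP[/allP sz sxs]; rewrite !inE.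
move=> /orP[/eqP->|xxs] /orP[/eqP->|yxs]; rewrite ?eqxx// => xy.
- exact: sz.
- by rewrite /separated enormC; exact: sz.
- exact: IH.
Qed.

Lemma separated_trivIset (r : R) xs : pairwise (separated (2 * r)) xs ->
  trivIset [set` xs] (fun x => eball x r).
Proof.
move=> sep; apply/trivIsetP => x y /= xxs yxs xy.
have := separated_mem sep xxs yxs xy; rewrite /separated => dxy.
apply/seteqP; split => // z [zx zy]; move: dxy; rewrite leNgt => /negP; apply.
apply: le_lt_trans (ler_enorm_dist x z y) _.
by rewrite mulr_natl mulr2n enormC; apply: ltrD.
Qed.

(** A separated family of largest cardinality, when the cardinalities are bounded,
    covers by balls of the separation radius. *)
Lemma maximal_separated (d : R) A (K : nat) : 0 < d ->
  (forall xs, pairwise (separated d) xs -> (forall x, x \in xs -> A x) ->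
     (size xs <= K)%N) ->
  exists xs, [/\ pairwise (separated d) xs, forall x, x \in xs -> A x &
    A `<=` [set y | exists2 x, x \in xs & eball x d y]].
Proof.
move=> d0 bound.
pose P (N : nat) := `[< exists xs, [/\ size xs = N, pairwise (separated d) xs &
  forall x, x \in xs -> A x] >].
have P0 : exists N, P N by exists 0%N; apply/asboolP; exists [::].
have PK N : P N -> (N <= K)%N by move=> /asboolP[xs [<- sep xsA]]; exact: bound.
have [N /asboolP[xs [sN sep xsA]] maxN] := ex_maxnP P0 PK.
exists xs; split => // y Ay; apply: contrapT => far.
suff : (N.+1 <= N)%N by rewrite ltnn.
apply: maxN; apply/asboolP; exists (y :: xs); split.
- by rewrite /= sN.
- rewrite /= sep andbT; apply/allP => x xxs; rewrite /separated leNgt.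
  by apply/negP => yx; apply: far; exists x.
- by move=> x; rewrite inE => /orP[/eqP->//|]; exact: xsA.
Qed.

Variables (sigma : R -> R) (Dt : 'rV[R]_n -> 'rV[R]_n).
Hypotheses (n_gt0 : (0 < n)%N)
  (scont : {within `[0, +oo[, continuous sigma})
  (scvx : @convex_function R R^o `[0, +oo[ sigma)
  (sincr : forall s t : R, 0 <= s -> s < t -> sigma s < sigma t)
  (sge0 : forall t : R, 0 <= t -> 0 <= sigma t).
Hypotheses (mDt : measurable_fun setT Dt)
  (DtM : exists M : R, forall i x, `|Dt x 0 i| <= M).

(** The factor 2 bounds the increments by [2 * r], [4 ^+ n] comes from the volume
    of the ball of radius [2 * r], and the square of [n%:R ^+ n] from the lower
    bound [(r / n) ^+ n] of the volume of the ball of radius [r], which enters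
    twice. *)
Definition packing_constant : R := 2 * 4 ^+ n * (n%:R ^+ n) ^+ 2.

Lemma packing_constant_ge0 : 0 <= packing_constant.
Proof. by rewrite !mulr_ge0// exprn_ge0. Qed.

(** The balls are disjoint, so that the integrals over them of the mean increment
    at scale [r] add up to at most the integral over the large ball. Each of the
    former is at least of order [r ^+ (2 * n)], and the latter at most of order
    [e * r ^+ n.+1]. *)
Lemma packing_bound xs (s r t e : R) : 0 <= e -> 0 < r -> 0 < t ->
  pairwise (separated (2 * r)) xs ->
  (forall x, x \in xs -> eball x r `<=` eball 0 s) ->
  (forall x, x \in xs -> (t%:E <= mean_oscillation sigma Dt (eball x r))%E) ->
  (forall h, enorm h < 2 * r ->
    (\int[mu]_(x in eball 0 s) (sigma (enorm (Dt (x + h)%R - Dt x)))%:E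
      <= (e * enorm h)%:E)%E) ->
  (size xs)%:R * r ^+ n.-1 * t <= e * packing_constant.
Proof.
move=> e0 r0 t0 sep xss xst est.
pose m := fine (mu (eball (0 : 'rV[R]_n) r)).
pose g := @increment_near R n sigma Dt r.
have mg : measurable_fun setT g by exact: measurable_increment_near.
have g0 z : (0 <= g z)%E by exact: increment_near_ge0.
have r20 : 0 < 2 * r by rewrite mulr_gt0.
have mball x : measurable (eball x r) by exact: measurable_eball.
have ms : measurable (eball (0 : 'rV[R]_n) s) by exact: measurable_eball.
have fin (q : R) : mu (eball (0 : 'rV[R]_n) q) \is a fin_num.
  by rewrite ge0_fin_numE//; exact: lebesgue_rV_eball_fin.
pose U := \big[setU/set0]_(x <- xs) eball x r.
have mU : measurable U by exact: bigsetU_measurable.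
have Us : U `<=` eball 0 s.
  by rewrite /U -bigcup_seq => z [x /= xxs]; exact: xss.
have sumU : (\int[mu]_(z in U) g z = \sum_(x <- xs) \int[mu]_(z in eball x r) g z)%E.
  apply: ge0_integral_bigsetU => //.
  - exact: separated_uniq sep.
  - exact: separated_trivIset.
  - exact: measurable_funTS.
have H1 : (((size xs)%:R * (m ^+ 2 * t))%:E <= \int[mu]_(z in eball 0 s) g z)%E.
  apply: (@le_trans _ _ (\int[mu]_(z in U) g z)%E); last first.
    apply: ge0_subset_integral => //; exact: measurable_funTS.
  rewrite sumU (_ : _%:E = \sum_(x <- xs) (m ^+ 2 * t)%:E)%E; last first.
    by rewrite sumEFin big_const_seq count_predT iter_addr addr0 mulr_natl.
  rewrite big_seq [leRHS]big_seq; apply: lee_sum => x xxs.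
  apply: le_trans (mean_oscillation_le scont scvx sincr sge0 mDt DtM x n_gt0 r0
    (erefl m)).
  by rewrite EFinM lee_wpmul2l// ?lee_fin ?sqr_ge0//; exact: xst.
have H2 := integral_increment_near_le scont sge0 mDt e0 r0 est.
have := le_trans H1 H2; rewrite lee_fin => H.
have nR : 0 < n%:R :> R by rewrite ltr0n.
have m_ge : (r / n%:R) ^+ n <= m.
  by rewrite -lee_fin /m fineK//; exact: lebesgue_rV_eball_ge.
have M_le : fine (mu (eball (0 : 'rV[R]_n) (2 * r))) <= (4 * r) ^+ n.
  rewrite -lee_fin fineK//; apply: le_trans (lebesgue_rV_eball_le _ (ltW r20)) _.
  by rewrite lee_fin mulrA -natrM.
have rn0 : 0 < r * r ^+ n by rewrite mulr_gt0// exprn_gt0.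
have N0 : 0 < (n%:R ^+ n) ^+ 2 :> R by rewrite !exprn_gt0.
have H3 : (size xs)%:R * (((r / n%:R) ^+ n) ^+ 2 * t) <= e * (2 * r) * (4 * r) ^+ n.
  apply: le_trans (le_trans _ H) _.
    have rn_ge0 : 0 <= (r / n%:R) ^+ n by rewrite exprn_ge0// divr_ge0// ltW.
    apply: ler_wpM2l => //; apply: ler_wpM2r; first exact: ltW.
    by rewrite ler_pXn2r// nnegrE// (le_trans rn_ge0).
  by rewrite ler_wpM2l// mulr_ge0// ltW.
rewrite -(ler_pM2r rn0) -(ler_pM2r (_ : 0 < ((n%:R ^+ n) ^+ 2)^-1 :> R)) ?invr_gt0//.
have rE : r ^+ n.-1 * (r * r ^+ n) = (r ^+ n) ^+ 2.
  by rewrite mulrA -exprSr prednK// expr2.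
have -> : (size xs)%:R * r ^+ n.-1 * t * (r * r ^+ n) / (n%:R ^+ n) ^+ 2 =
    (size xs)%:R * (((r / n%:R) ^+ n) ^+ 2 * t).
  rewrite expr_div_n [in RHS]expr_div_n -rE; ring.
apply: le_trans H3 _; rewrite /packing_constant exprMn.
rewrite [leLHS](_ : _ = e * (2 * 4 ^+ n) * (r * r ^+ n)); last by ring.
rewrite [leRHS](_ : _ = e * (2 * 4 ^+ n) * (r * r ^+ n)) //.
by field; rewrite expf_neq0// gt_eqF.
Qed.

Hypothesis est : forall s e : R, 0 < s -> s < 1 -> 0 < e ->
  exists2 d : R, 0 < d & forall h, enorm h < d ->
    (\int[mu]_(x in eball 0 s) (sigma (enorm (Dt (x + h)%R - Dt x)))%:E
      <= (e * enorm h)%:E)%E.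

(** A maximal [2 * r]-separated set of points of [A] gives a cover by balls of
    radius [2 * r]. By the packing bound its weight is of order [e'], which can be
    taken as small as desired at the cost of a smaller [r]. *)
Lemma bad_set_small_cover A (s t rho delta e : R) : s < 1 -> 0 < t -> 0 < rho ->
  A `<=` eball 0 s ->
  (forall x r, A x -> 0 < r -> r < rho ->
    (t%:E <= mean_oscillation sigma Dt (eball x r))%E) ->
  0 < delta -> 0 < e -> exists C, small_cover n.-1 delta e A C.
Proof.
move=> s1 t0 rho0 As At delta0 e0.
pose s' := (1 + Num.max s 0) / 2.
have max1 : Num.max s 0 < 1 by rewrite gt_max s1 ltr01.
have max0 : 0 <= Num.max s 0 by rewrite le_max lexx orbT.
have smax : s <= Num.max s 0 by rewrite le_max lexx.
have s'0 : 0 < s' by rewrite /s'; lra.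
have s'1 : s' < 1 by rewrite /s'; lra.
have ss' : s < s' by rewrite /s'; lra.
pose c := 4 ^+ n.-1 * packing_constant + 1.
have c0 : 0 < c.
  by rewrite ltr_wpDl// mulr_ge0 ?packing_constant_ge0// exprn_ge0.
pose e' := e * t / c.
have e'0 : 0 < e' by rewrite divr_gt0// mulr_gt0.
have [d d0 dP] := est s'0 s'1 e'0.
(* The quarter makes [2 * r] smaller than [d], and the diameters [4 * r] at most
   [delta]. *)
pose q := Num.min (Num.min rho d) (Num.min (s' - s) delta).
pose r := q / 4.
have q0 : 0 < q by rewrite !lt_min rho0 d0 delta0 subr_gt0 ss'.
have qrho : q <= rho by rewrite !ge_min lexx.
have qd : q <= d by rewrite !ge_min lexx !orbT.
have qs : q <= s' - s by rewrite !ge_min lexx !orbT.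
have qdelta : q <= delta by rewrite !ge_min lexx !orbT.
have rq : r = q / 4 by [].
have r0 : 0 < r by rewrite rq divr_gt0.
have r20 : 0 < 2 * r by rewrite mulr_gt0.
have xss' x : A x -> eball x r `<=` eball 0 s'.
  move=> Ax y; have := As _ Ax; rewrite /eball/= !subr0 => xs yx.
  rewrite -[y](subrK x); apply: le_lt_trans (ler_enormD _ _) _; lra.
have bound xs : pairwise (separated (2 * r)) xs -> (forall x, x \in xs -> A x) ->
    (size xs)%:R * r ^+ n.-1 * t <= e' * packing_constant.
  move=> sep xsA.
  apply: (@packing_bound xs s' r t e') => //; first exact: ltW.
  - by move=> x /xsA; exact: xss'.
  - by move=> x /xsA Ax; apply: At => //; lra.
  - by move=> h hr; apply: dP; lra.
have rt0 : 0 < r ^+ n.-1 * t by rewrite mulr_gt0// exprn_gt0.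
have [xs [sep xsA cov]] : exists xs, [/\ pairwise (separated (2 * r)) xs,
    forall x, x \in xs -> A x & A `<=` [set y | exists2 x, x \in xs & eball x (2 * r) y]].
  apply: (@maximal_separated _ _ (Num.truncn (e' * packing_constant / (r ^+ n.-1 * t)))) => //.
  move=> xs sep xsA; have H := bound xs sep xsA.
  have T0 : 0 <= e' * packing_constant / (r ^+ n.-1 * t).
    apply: divr_ge0; last exact: ltW.
    by apply: mulr_ge0; [exact: ltW|exact: packing_constant_ge0].
  by rewrite (truncn_ge_nat _ T0) ler_pdivlMr// mulrA.
apply: (@finite_ball_cover _ _ _ _ (2 * r) _ _ xs) => //.
  lra.
have -> : 2 * (2 * r) = 4 * r by lra.
rewrite -(ler_pM2r t0) exprMn.
have four : 0 <= 4 ^+ n.-1 :> R by rewrite exprn_ge0.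
rewrite [leLHS](_ : _ = 4 ^+ n.-1 * ((size xs)%:R * r ^+ n.-1 * t)); last by ring.
apply: le_trans (ler_wpM2l four (bound xs sep xsA)) _.
rewrite /e' mulrCA (_ : e * t / c * _ = e * t * (4 ^+ n.-1 * packing_constant / c)).
  rewrite ler_piMr ?mulr_ge0// ?ltW// ltr_pdivrMr// mul1r /c ltrDl//.
by ring.
Qed.

End bad_set.

(** * Conclusion *)

Lemma limf_einf_gt0 (R : realType) (f : R -> \bar R) :
  (0 < limf_einf f (0 : R)^'+)%E ->
  exists c rho : R, [/\ 0 < c, 0 < rho &
    forall r, 0 < r -> r < rho -> (c%:E <= f r)%E].
Proof.
rewrite /limf_einf oppe_gt0 limf_esupE => /ereal_inf_lt[_ [V FV <-] supV].
have [rho /= rho0 Vrho] : exists2 rho : R, 0 < rho &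
    forall r, 0 < r -> r < rho -> V r.
  move: FV => [rho /= rho0 VP]; exists rho => // r r0 rrho; apply: VP => //=.
  by rewrite sub0r normrN gtr0_norm.
pose b := ereal_sup ((\- f)%E @` V).
have b0 : (b < 0)%E by [].
have fb r : V r -> (- b <= f r)%E.
  by move=> Vr; rewrite leeNl; apply: ereal_sup_ubound; exists r.
have [c c0 cb] : exists2 c : R, 0 < c & (c%:E <= - b)%E.
  move: b0; case: b {fb supV} => [x|//|].
    by rewrite lte_fin => x0; exists (- x) => //; rewrite oppr_gt0.
  by move=> _; exists 1 => //; rewrite leey.
exists c, rho; split => // r r0 rrho.
by apply: le_trans cb _; apply: fb; exact: Vrho.
Qed.

Theorem theorem5p1 (R : realType) (n : nat) (n_gt0 : (0 < n)%N)
    (u : 'rV[R]_n -> R) (Du : 'rV[R]_n -> 'rV[R]_n)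
    (G : 'rV[R]_n -> 'rV[R]_n) (sigma : R -> R)
    (u_Lip : Lip (eball 0 1) u)
    (Du_grad : weak_gradient (eball 0 1) u Du)
    (G_cont : {within ess_range (eball 0 1) Du, continuous G})
    (u_sol : weakly_div_free (eball 0 1) (G \o Du))
    (sigma_ge0 : forall t : R, 0 <= t -> 0 <= sigma t)
    (sigma_cont : {within `[0, +oo[, continuous sigma})
    (sigma_incr : forall s t : R, 0 <= s -> s < t -> sigma s < sigma t)
    (sigma_convex : @convex_function R R^o `[0, +oo[ sigma)
    (G_mono : forall a b : 'rV[R]_n, ess_range (eball 0 1) Du a ->
       ess_range (eball 0 1) Du b ->
       sigma (enorm (b - a)) <= dotv (G b - G a) (b - a)) :
  hausdorff n.-1
    [set x : 'rV[R]_n | eball 0 1 x /\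
       (0 < limf_einf (fun r => mean_oscillation sigma Du (eball x r))
              (0 : R)^'+)%E] = 0%E.
Proof.
have [Dt [mDt DtM N0 est]] := oscillation_estimate n_gt0 u_Lip Du_grad G_cont u_sol
  sigma_ge0 sigma_cont G_mono.
pose A (k : nat) := [set x : 'rV[R]_n | eball 0 (1 - k.+1%:R^-1) x /\
  forall r : R, 0 < r -> r < k.+1%:R^-1 ->
    ((k.+1%:R^-1)%:E <= mean_oscillation sigma Dt (eball x r))%E].
apply: hausdorff0 => delta e delta0 e0.
have k0 (k : nat) : 0 < k.+1%:R^-1 :> R by rewrite invr_gt0.
have covA j (e1 : R) : 0 < e1 -> exists C, small_cover n.-1 delta e1 (A j) C.
  move=> e10.
  apply: (@bad_set_small_cover _ _ sigma Dt n_gt0 sigma_cont sigma_convex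
    sigma_incr sigma_ge0 mDt DtM est (A j) (1 - j.+1%:R^-1) j.+1%:R^-1 j.+1%:R^-1
    delta e1 _ (k0 j) (k0 j) _ _ delta0 e10).
  - by rewrite ltrBlDr ltrDl.
  - by move=> x [].
  - by move=> x r [_ Ax]; exact: Ax.
have [C [AC Cd Ce]] := small_cover_bigcup covA e0.
exists C; split => //; apply: subset_trans AC => x [x1].
move=> /limf_einf_gt0[c [rho [c0 rho0 crho]]].
have x1' : 0 < 1 - enorm x by move: x1; rewrite /eball/= subr0 subr_gt0.
pose q := Num.min (1 - enorm x) (Num.min c rho).
have q0 : 0 < q by rewrite !lt_min x1' c0 rho0.
have [k] := ltr_add_invr q0; rewrite add0r => kq.
have kx : k.+1%:R^-1 < 1 - enorm x by apply: lt_le_trans kq _; rewrite ge_min lexx.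
have kc : k.+1%:R^-1 <= c.
  by apply: ltW; apply: lt_le_trans kq _; rewrite !ge_min lexx !orbT.
have krho : k.+1%:R^-1 <= rho.
  by apply: ltW; apply: lt_le_trans kq _; rewrite !ge_min lexx !orbT.
exists k => //; split; first by rewrite /eball/= subr0 ltrBrDl -ltrBrDr.
move=> r r0 rk.
have ballB : eball x r `<=` eball 0 1.
  move=> y; rewrite /eball/= subr0 => yx.
  rewrite -[y](subrK x); apply: le_lt_trans (ler_enormD _ _) _.
  by rewrite -ltrBrDr; exact: lt_trans yx (lt_trans rk kx).
rewrite -(@mean_oscillation_off_null _ _ sigma (eball x r) Du Dt); last 2 first.
- exact: measurable_eball.
- by apply: negligibleS N0 => y [yB yD]; split => //; exact: ballB.
apply: (@le_trans _ _ c%:E); first by rewrite lee_fin.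
by apply: crho => //; exact: lt_le_trans krho.
Qed.
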